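(* In the scalar setting $m=1$ described in the context, let $p^-<p^+$ be two real constants which are (constant) solutions of (E), and let $u:\mathbb{R}\times\overline{\Omega}\to\mathbb{R}$ be a time-global classical solution of (E) such that $$\{u(t,x);\ (t,x)\in\mathbb{R}\times\overline{\Omega}\}=(p^-,p^+),$$ the boundary condition in (E) being $\mu(t,x)\cdot\nabla_xu(t,x)=0$ on $\mathbb{R}\times\partial\Omega$, where $\mu\in C^{0,\beta}(\mathbb{R}\times\partial\Omega)$ is a unit vector field with $\inf\{\mu(t,x)\cdot\nu(x);\ (t,x)\in\mathbb{R}\times\partial\Omega\}>0$. 1. Assume that $u$ is a generalized transition wave connecting $p^-$ and $p^+$, or $p^+$ and $p^-$, with associated sets $(\Omega^\pm_t)_{t\in\mathbb{R}}$, $(\Gamma_t)_{t\in\mathbb{R}}$, and that there exists $\tau>0$ such that $$\sup\{d_\Omega(x,\Gamma_{t-\tau});\ t\in\mathbb{R},\ x\in\Gamma_t\}<+\infty .$$ Then $$(\mathrm{a})\quad\forall\,\lambda\in(p^-,p^+),\quad \sup\{d_\Omega(x,\Gamma_t);\ (t,x)\in\mathbb{R}\times\overline{\Omega},\ u(t,x)=\lambda\}<+\infty$$ and $$(\mathrm{b})\quad\forall\,C\ge0,\quad p^-<\inf\{u(t,x);\ d_\Omega(x,\Gamma_t)\le C\}\le\sup\{u(t,x);\ d_\Omega(x,\Gamma_t)\le C\}<p^+,$$ where in (b) the infimum and supremum are over $(t,x)\in\mathbb{R}\times\overline{\Omega}$ with $d_\Omega(x,\Gamma_t)\le C$. 2.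 Conversely, if (a) and (b) hold for some choice of sets $(\Omega^\pm_t,\Gamma_t)_{t\in\mathbb{R}}$ satisfying the geometric conditions (G1), (G2) and (G3), and if there is $d_0>0$ such that the sets $$\{(t,x)\in\mathbb{R}\times\overline{\Omega};\ x\in\overline{\Omega^+_t},\ d_\Omega(x,\Gamma_t)\ge d\}\quad\text{and}\quad\{(t,x)\in\mathbb{R}\times\overline{\Omega};\ x\in\overline{\Omega^-_t},\ d_\Omega(x,\Gamma_t)\ge d\}$$ are connected for all $d\ge d_0$, then $u$ is a generalized transition wave connecting $p^-$ and $p^+$, or $p^+$ and $p^-$.
   Context: Domain. $\Omega\subset\mathbb{R}^N$ ($N\ge1$) is a non-empty open connected set with outward unit normal $\nu$, globally smooth in the following sense: there exist $\beta>0$, $r_0>0$, $M>0$ such that for all $y\in\partial\Omega$ there are a rotation $R_y$ of $\mathbb{R}^N$ and a $C^{2,\beta}$ map $\phi_y:\overline{B}^{N-1}_{2r_0}\to\mathbb{R}$ with $\phi_y(0)=0$, $\|\phi_y\|_{C^{2,\beta}}\le M$ and $$\Omega\cap B(y,r_0)=\big[y+R_y(\{x\in\mathbb{R}^N;\ (x_1,\ldots,x_{N-1})\in\overline{B}^{N-1}_{2r_0},\ \phi_y(x_1,\ldots,x_{N-1})<x_N\})\big]\cap B(y,r_0),$$ where $B(y,r_0)$ is the open Euclidean ball and $\overline{B}^{N-1}_s$ is the closed ball of $\mathbb{R}^{N-1}$ with center $0$ and radius $s$ ($\Omega=\mathbb{R}^N$ is allowed). Geodesic distance. $d_\Omega(x,y)$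 is the infimum of the arc lengths of all $C^1$ curves joining $x$ to $y$ in $\overline{\Omega}$; $d_\Omega(A,B)=\inf\{d_\Omega(x,y);\ x\in A,\ y\in B\}$, $d_\Omega(x,B)=d_\Omega(\{x\},B)$; $S_\Omega(x,r)=\{y\in\overline{\Omega};\ d_\Omega(x,y)=r\}$. It is assumed that $\Omega$ has infinite diameter for $d_\Omega$. Equation (E) (scalar, with oblique boundary condition): $$u_t=\nabla_x\cdot(A(t,x)\nabla_xu)+q(t,x)\cdot\nabla_xu+f(t,x,u)\ \text{in }\Omega,\qquad \mu(t,x)\cdot\nabla_xu=0\ \text{on }\partial\Omega,\qquad t\in\mathbb{R}.$$ $A=(a_{ij})$ is a matrix field of class $C^{1,\beta}(\mathbb{R}\times\overline{\Omega})$ with $\alpha_1|\xi|^2\le \sum_{i,j}a_{ij}(t,x)\xi_i\xi_j\le\alpha_2|\xi|^2$ for some constants $0<\alpha_1\le\alpha_2$ and all $(t,x)\in\mathbb{R}\times\overline{\Omega}$, $\xi\in\mathbb{R}^N$; $q:\mathbb{R}\times\overline{\Omega}\to\mathbb{R}^N$ is of class $C^{0,\beta}(\mathbb{R}\times\overline{\Omega})$; $f:\mathbb{R}\times\overline{\Omega}\times\mathbb{R}\to\mathbb{R}$ is $C^{0,\beta}$ in $(t,x)$ locally in $u$, and locally Lipschitz-continuous in $u$ uniformly with respect to $(t,x)$. Geometric conditions. $(\Omega^-_t)_{t\in\mathbb{R}}$ and $(\Omega^+_t)_{t\in\mathbb{R}}$ are families of open nonempty unbounded (for $d_\Omega$)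 subsets of $\Omega$. (G1) For all $t$: $\Omega^-_t\cap\Omega^+_t=\emptyset$; $\partial\Omega^-_t\cap\Omega=\partial\Omega^+_t\cap\Omega=:\Gamma_t$; $\Omega^-_t\cup\Gamma_t\cup\Omega^+_t=\Omega$; $\sup\{d_\Omega(x,\Gamma_t);x\in\Omega^+_t\}=\sup\{d_\Omega(x,\Gamma_t);x\in\Omega^-_t\}=+\infty$. (G2) For each sign $\pm$, $\inf\big\{\sup\{d_\Omega(y,\Gamma_t);\ y\in\overline{\Omega^\pm_t}\cap S_\Omega(x,r)\};\ t\in\mathbb{R},\ x\in\Gamma_t\big\}\to+\infty$ as $r\to+\infty$. (G3) If $N\ge2$, there is an integer $n\ge1$ such that for each $t\in\mathbb{R}$ there are $n$ open sets $\omega_{i,t}\subset\mathbb{R}^{N-1}$, $n$ continuous maps $\psi_{i,t}:\omega_{i,t}\to\mathbb{R}$ and $n$ rotations $R_{i,t}$ of $\mathbb{R}^N$ ($1\le i\le n$) with $\Gamma_t\subset\bigcup_{1\le i\le n}R_{i,t}(\{x\in\mathbb{R}^N;\ (x_1,\ldots,x_{N-1})\in\omega_{i,t},\ x_N=\psi_{i,t}(x_1,\ldots,x_{N-1})\})$. If $N=1$, there is an integer $n\ge 1$ such that every $\Gamma_t$ has at most $n$ points. Generalized transition wave. Given two classical solutions $p^-,p^+$ of (E) on $\mathbb{R}\times\overline{\Omega}$, a generalized transition wave connecting $p^-$ and $p^+$ is a time-global (defined for all $t\in\mathbb{R}$) classical solution $u$ of (E) with $u\not\equiv p^\pm$ for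 which there exist sets $(\Omega^\pm_t)_{t\in\mathbb{R}}$, $(\Gamma_t)_{t\in\mathbb{R}}$ satisfying (G1), (G2), (G3) (the associated sets) such that for every $\epsilon>0$ there is $M$ such that, for each sign $\pm$, all $t\in\mathbb{R}$ and all $x\in\overline{\Omega^\pm_t}$: $d_\Omega(x,\Gamma_t)\ge M$ implies $|u(t,x)-p^\pm(t,x)|\le\epsilon$. ''Connecting $p^+$ and $p^-$'' means the same with the roles of $p^-$ and $p^+$ exchanged. *)

(* Defs.v *)
(* The dimension of the ambient space is N = n.+1, points
   are row vectors, and functions of (t, x) are functions on R * 'rV[R]_n.+1
   whose values outside the relevant set (e.g. R x closure Om) are irrelevant. *)
From HB Require Import structures.
From mathcomp Require Import all_boot all_order all_algebra.
From mathcomp Require Import all_classical all_reals all_analysis.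

Set Implicit Arguments.
Unset Strict Implicit.
Unset Printing Implicit Defensive.

Import Order.TTheory GRing.Theory Num.Theory.
Import numFieldNormedType.Exports.

Local Open Scope classical_set_scope.
Local Open Scope ring_scope.

Section Euclidean.
Context {R : realType} {m : nat}.
Implicit Types x y : 'rV[R]_m.

Definition dot x y : R := \sum_i x 0 i * y 0 i.

(* The library norm `|x| on row vectors is the sup norm. *)
Definition enorm x : R := Num.sqrt (dot x x).

Definition eball x (r : R) : set 'rV[R]_m := [set y | enorm (y - x) < r].

Definition basis_vec (i : 'I_m) : 'rV[R]_m := delta_mx 0 i.

End Euclidean.

(* In dimension 1 the reflection x |-> -x is admitted as a rotation, otherwise
   half-lines bounded from above would not be smooth domains. *)
Definition rotation {R : realType} {n : nat} (Q : 'M[R]_n.+1) : Prop :=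
  Q *m Q^T = 1%:M /\ ((0 < n)%N -> \det Q = 1).

Definition frontier {T : topologicalType} (S : set T) : set T :=
  closure S `\` interior S.

Section Holder.
Context {R : realType} {V W : normedModType R}.

(* Bounds on C^{k,b} norms, up to factors depending only on k and on the
   dimensions: derivatives are measured as directional derivatives along
   vectors of norm at most 1.  For k > 0 the set D is meant to be open. *)
Fixpoint holder_le (k : nat) (b M : R) (D : set V) (g : V -> W) : Prop :=
  (forall x, D x -> `|g x| <= M) /\
  match k with
  | 0%N => forall x y, D x -> D y -> `|g x - g y| <= M * `|x - y| `^ b
  | k'.+1 => forall v, `|v| <= 1 ->
      (forall x, D x -> derivable g x v) /\ holder_le k' b M D ('D_v g)
  end.

(* Class C^{k,b} on the closure of the open set D: the Hoelder bounds on D make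
   the derivatives extend continuously to the closure. *)
Definition holder_closure_le (k : nat) (b M : R) (D : set V) (g : V -> W) :
    Prop :=
  {within closure D, continuous g} /\ holder_le k b M D g.

End Holder.

Section Domain.
Context {R : realType} {n : nat}.
Notation V := 'rV[R]_n.+1.

(* (x_1, ..., x_{N-1}) and x_N *)
Definition init_coords (x : V) : 'rV[R]_n := \row_(j < n) x 0 (lift ord_max j).
Definition last_coord (x : V) : R := x 0 ord_max.

Definition boundary_chart (Om : set V) (b r0 M : R) (y : V) (Q : 'M[R]_n.+1)
    (phi : 'rV[R]_n -> R) : Prop :=
  [/\ rotation Q, phi 0 = 0,
      holder_closure_le 2 b M (eball 0 (2 * r0)) phi &
      Om `&` eball y r0 =
        [set y + x *m Q | x in
           [set x : V | enorm (init_coords x) <= 2 * r0 /\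
                        phi (init_coords x) < last_coord x]]
        `&` eball y r0].

Definition globally_smooth (b : R) (Om : set V) : Prop :=
  exists r0 M : R, [/\ 0 < r0, 0 < M &
    forall y, frontier Om y ->
      exists (Q : 'M[R]_n.+1) (phi : 'rV[R]_n -> R),
        boundary_chart Om b r0 M y Q phi].

(* (grad phi (0), -1) *)
Definition graph_normal (phi : 'rV[R]_n -> R) : V :=
  \row_(i < n.+1)
    if unlift ord_max i is Some j then 'D_(basis_vec j) phi 0 else -1.

Definition outward_unit_normal (b : R) (Om : set V) (y nu : V) : Prop :=
  exists (r0 M : R) (Q : 'M[R]_n.+1) (phi : 'rV[R]_n -> R),
    [/\ 0 < r0, boundary_chart Om b r0 M y Q phi &
        nu = (enorm (graph_normal phi))^-1 *: (graph_normal phi *m Q)].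

(* Each C^1 curve defined on [0, 1] extends to a C^1 curve defined on R. *)
Definition C1_curve (Om : set V) (x y : V) (g : R -> V) : Prop :=
  [/\ (forall s, derivable g s 1), continuous (derive1 g),
      (forall s, 0 <= s <= 1 -> closure Om (g s)), g 0 = x & g 1 = y].

Definition arc_length (g : R -> V) : \bar R :=
  \int[lebesgue_measure]_(s in `[0, 1]) (enorm (derive1 g s))%:E.

Definition geo_dist (Om : set V) (x y : V) : \bar R :=
  ereal_inf [set arc_length g | g in C1_curve Om x y].

Definition geo_dist_set (Om : set V) (x : V) (B : set V) : \bar R :=
  ereal_inf [set geo_dist Om x y | y in B].

Definition geo_sphere (Om : set V) (x : V) (r : R) : set V :=
  [set y | closure Om y /\ geo_dist Om x y = r%:E].

Definition geo_unbounded (Om B : set V) : Prop :=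
  ereal_sup [set d | exists x y, [/\ B x, B y & d = geo_dist Om x y]] = +oo%E.

End Domain.

Section Equation.
Context {R : realType} {n : nat}.
Notation V := 'rV[R]_n.+1.

Definition e_t : R * V := (1, 0).
Definition e_x (i : 'I_n.+1) : R * V := (0, basis_vec i).

Definition grad (u : R * V -> R) (z : R * V) : V := \row_i 'D_(e_x i) u z.

Definition div_A_grad (A : R * V -> 'M[R]_n.+1) (u : R * V -> R) (z : R * V) :
    R :=
  \sum_i 'D_(e_x i) (fun w => \sum_j A w i j * 'D_(e_x j) u w) z.

Definition coefficient_conditions (b : R) (Om : set V)
    (A : R * V -> 'M[R]_n.+1) (q : R * V -> V) (f : R * V -> R -> R) : Prop :=
  [/\ exists M, holder_closure_le 1 b M (setT `*` Om) A,
      exists a1 a2 : R, [/\ 0 < a1, a1 <= a2 &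
        forall (t : R) (x xi : V), closure Om x ->
          a1 * enorm xi ^+ 2
            <= \sum_i \sum_j A (t, x) i j * xi 0 i * xi 0 j
            <= a2 * enorm xi ^+ 2],
      exists M, holder_le 0 b M (setT `*` closure Om) q,
      (forall K : R, exists M, forall s, `|s| <= K ->
         holder_le 0 b M (setT `*` closure Om) (f ^~ s)) &
      forall K : R, exists L, forall (t : R) (x : V) (s s' : R),
        closure Om x -> `|s| <= K -> `|s'| <= K ->
        `|f (t, x) s - f (t, x) s'| <= L * `|s - s'|].

Definition boundary_field_conditions (b : R) (Om : set V) (nu : V -> V)
    (mu : R * V -> V) : Prop :=
  [/\ exists M, holder_le 0 b M (setT `*` frontier Om) mu,
      (forall t x, frontier Om x -> enorm (mu (t, x)) = 1) &
      (0 < ereal_inf [set s | exists (t : R) (x : V),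
             frontier Om x /\ s = (dot (mu (t, x)) (nu x))%:E])%E].

(* Classical solutions are C^1 in t and C^2 in x inside, and continuous with
   their space gradient up to the boundary. *)
Definition classical_solution (Om : set V) (A : R * V -> 'M[R]_n.+1)
    (q : R * V -> V) (f : R * V -> R -> R) (mu : R * V -> V)
    (u : R * V -> R) : Prop :=
  let Q : set (R * V) := setT `*` Om in
  [/\ {within setT `*` closure Om, continuous u},
      (forall z, Q z -> derivable u z e_t) /\
        {within Q, continuous ('D_e_t u)},
      (forall i z, Q z -> derivable u z (e_x i)) /\
        (forall i j,
          (forall z, Q z -> derivable ('D_(e_x j) u) z (e_x i)) /\
          {within Q, continuous ('D_(e_x i) ('D_(e_x j) u))}),
      (forall z, Q z ->
        'D_e_t u z = div_A_grad A u z + dot (q z) (grad u z) + f z (u z)) &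
      exists Du : R * V -> V,
        [/\ {within setT `*` closure Om, continuous Du},
            (forall z, Q z -> Du z = grad u z) &
            forall t x, frontier Om x -> dot (mu (t, x)) (Du (t, x)) = 0]].

End Equation.

Section Waves.
Context {R : realType} {n : nat}.
Notation V := 'rV[R]_n.+1.
Variable Om : set V.
Implicit Types (P Omm Omp Gam : R -> set V) (u pm pp : R * V -> R).

Definition admissible_family P : Prop :=
  forall t, [/\ open (P t), P t !=set0, P t `<=` Om & geo_unbounded Om (P t)].

Definition interface Omm (t : R) : set V := frontier (Omm t) `&` Om.

Definition G1 Omm Omp : Prop :=
  let Gam := interface Omm in
  forall t,
  [/\ Omm t `&` Omp t = set0,
      frontier (Omm t) `&` Om = frontier (Omp t) `&` Om,
      Omm t `|` Gam t `|` Omp t = Om,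
      ereal_sup [set geo_dist_set Om x (Gam t) | x in Omp t] = +oo%E &
      ereal_sup [set geo_dist_set Om x (Gam t) | x in Omm t] = +oo%E].

Definition G2_side P Gam : Prop :=
  ereal_inf [set s | exists (t : R) (x : V), Gam t x /\
    s = ereal_sup [set geo_dist_set Om y (Gam t) |
                     y in closure (P t) `&` geo_sphere Om x r]]
    @[r --> +oo%R] --> +oo%E.

Definition G2 Omm Omp : Prop :=
  G2_side Omm (interface Omm) /\ G2_side Omp (interface Omm).

Definition G3 Omm : Prop :=
  let Gam := interface Omm in
  ((0 < n)%N -> exists m : nat, (0 < m)%N /\
     forall t, exists (om : 'I_m -> set 'rV[R]_n) (psi : 'I_m -> 'rV[R]_n -> R)
                      (Q : 'I_m -> 'M[R]_n.+1),
       (forall i, [/\ open (om i), {within om i, continuous (psi i)} &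
                      rotation (Q i)]) /\
       Gam t `<=` \bigcup_i [set x *m Q i | x in
         [set x : V | om i (init_coords x) /\
                      last_coord x = psi i (init_coords x)]]) /\
  (n = 0%N -> exists m : nat, (0 < m)%N /\ forall t, (Gam t #<= `I_m)%card).

Definition geometric_conditions Omm Omp : Prop :=
  [/\ admissible_family Omm, admissible_family Omp,
      G1 Omm Omp, G2 Omm Omp & G3 Omm].

Definition converges_away P Gam u p : Prop :=
  forall eps : R, 0 < eps -> exists M : R, forall (t : R) (x : V),
    closure (P t) x -> (M%:E <= geo_dist_set Om x (Gam t))%E ->
    `|u (t, x) - p (t, x)| <= eps.

Definition not_identical u p : Prop :=
  exists (t : R) (x : V), closure Om x /\ u (t, x) <> p (t, x).

Variables (A : R * V -> 'M[R]_n.+1) (q : R * V -> V) (f : R * V -> R -> R)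
  (mu : R * V -> V).

Definition transition_wave_with Omm Omp pm pp u : Prop :=
  [/\ classical_solution Om A q f mu pm /\ classical_solution Om A q f mu pp,
      classical_solution Om A q f mu u,
      not_identical u pm /\ not_identical u pp,
      geometric_conditions Omm Omp &
      converges_away Omm (interface Omm) u pm /\
      converges_away Omp (interface Omm) u pp].

Definition transition_wave pm pp u : Prop :=
  exists Omm Omp, transition_wave_with Omm Omp pm pp u.

Definition level_sets_near_interface (pm pp : R) Gam u : Prop :=
  forall lambda : R, pm < lambda < pp ->
    (ereal_sup [set d | exists (t : R) (x : V),
       [/\ closure Om x, u (t, x) = lambda & d = geo_dist_set Om x (Gam t)]]
     < +oo)%E.

Definition values_near_interface Gam u (C : R) : set (\bar R) :=
  [set s | exists (t : R) (x : V),
     [/\ closure Om x, (geo_dist_set Om x (Gam t) <= C%:E)%E &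
         s = (u (t, x))%:E]].

Definition values_away_from_limits (pm pp : R) Gam u : Prop :=
  forall C : R, 0 <= C ->
    let S := values_near_interface Gam u C in
    [/\ (pm%:E < ereal_inf S)%E, (ereal_inf S <= ereal_sup S)%E &
        (ereal_sup S < pp%:E)%E].

Definition bounded_interface_moves Gam (tau : R) : Prop :=
  (ereal_sup [set d | exists (t : R) (x : V),
     Gam t x /\ d = geo_dist_set Om x (Gam (t - tau)%R)] < +oo)%E.

Definition far_region P Gam (d : R) : set (R * V) :=
  [set z | closure (P z.1) z.2 /\
           (d%:E <= geo_dist_set Om z.2 (Gam z.1))%E].

End Waves.

(* Main.v *)
Require Import Defs.
From HB Require Import structures.
From mathcomp Require Import all_boot all_order all_algebra.
From mathcomp Require Import all_classical all_reals all_analysis.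
From mathcomp Require Import ring lra.
Import Order.TTheory GRing.Theory Num.Theory.
Import numFieldNormedType.Exports.
Local Open Scope classical_set_scope.
Local Open Scope ring_scope.

(** For the direct part, take a side [P] on which [u] tends to [pp]. The
    difference [v] between [u] and a limit [p] is, up to sign, a nonnegative
    solution of a linear parabolic inequality with a homogeneous oblique
    boundary condition ([supersolution_of_solution]). The point is that [v] is
    bounded from below near the interface at time [t] by a constant that does
    not depend on [t]. Deep inside [P] at time [t - tau] it is at least a
    positive constant [del], by the definition of a wave. A point near the
    interface at time [t] is joined by curves of bounded length to the
    interface at time [t], from there to the interface at time [t - tau], since
    the interface moves by a bounded distance, and from there to a point deep
    inside [P], by the second geometric condition. It remains to propagate
    positivity along a curve of bounded length during the time [tau], with a
    quantitative loss ([positive_near_interface]). Applied to [u - pm] on the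
    side where [u] tends to [pp] and to [pp - u] on the other side, this bounds
    [u] away from both constants near the interface. The bound on the distance
    of a level set to the interface is the definition of the limits.

    A comparison function takes the place of the Harnack inequality: [v] is
    compared with [c * exp (- k (t - s)) * (rho^2 - |x - xi|^2)^2] in a ball
    whose centre [xi] moves and whose radius [rho] grows linearly in time. Near
    the sphere, where this function vanishes, the square makes its second
    derivatives outweigh the other terms, and elsewhere the decay in time does
    so for [k] large: it is a strict subsolution in the ball ([barrier]). At the
    boundary of the domain the comparison works as long as [mu] points out of
    the moving ball. The uniform smoothness of the domain supplies such balls
    ([ball_geometry_exists]): every point is in or on a ball of a fixed radius
    [H] inside the domain, and enlarging such a ball by a small factor makes it
    cross the boundary only where the normal is almost the radial direction,
    which by obliqueness has a positive inner product with [mu]. Steps of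
    a fixed length, from one interior ball to the next, therefore multiply the
    lower bound by a fixed factor ([positive_near_step]).

    For the converse, [u] is continuous on the connected sets of points of one
    side that are far from the interface, so it takes an interval of values on
    each. Every value strictly between [pm] and [pp] is taken at bounded
    distance from the interface only, so that these intervals shrink to a point
    as the distance grows: [u] has a limit on each side ([limit_on_side]).
    Values close to [pm] and to [pp] are taken somewhere, but not near the
    interface, so each of the two constants is one of the two limits
    ([wave_of_estimates]). *)

Set Implicit Arguments.
Unset Strict Implicit.

(** * The Euclidean norm of row vectors *)

Section EuclideanTheory.
Context {R : realType} {m : nat}.
Implicit Types (x y z : 'rV[R]_m) (a : R).

Lemma dotC x y : dot x y = dot y x.
Proof. by apply: eq_bigr => i _; rewrite mulrC. Qed.

Lemma dotDl x y z : dot (x + y) z = dot x z + dot y z.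
Proof. by rewrite -big_split; apply: eq_bigr => i _; rewrite mxE mulrDl. Qed.

Lemma dotZl a x y : dot (a *: x) y = a * dot x y.
Proof. by rewrite mulr_sumr; apply: eq_bigr => i _; rewrite mxE mulrA. Qed.

Lemma dotNl x y : dot (- x) y = - dot x y.
Proof. by rewrite -scaleN1r dotZl mulN1r. Qed.

Lemma dotBl x y z : dot (x - y) z = dot x z - dot y z.
Proof. by rewrite dotDl dotNl. Qed.

Lemma dotDr x y z : dot x (y + z) = dot x y + dot x z.
Proof. by rewrite dotC dotDl !(dotC x). Qed.

Lemma dotZr a x y : dot x (a *: y) = a * dot x y.
Proof. by rewrite dotC dotZl dotC. Qed.

Lemma dotNr x y : dot x (- y) = - dot x y.
Proof. by rewrite dotC dotNl dotC. Qed.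

Lemma dotBr x y z : dot x (y - z) = dot x y - dot x z.
Proof. by rewrite dotDr dotNr. Qed.

Lemma dot0l x : dot 0 x = 0.
Proof. by rewrite -(scale0r x) dotZl mul0r. Qed.

Lemma dot_ge0 x : 0 <= dot x x.
Proof. by apply: sumr_ge0 => i _; rewrite -expr2 sqr_ge0. Qed.

Lemma enorm_ge0 x : 0 <= enorm x.
Proof. exact: sqrtr_ge0. Qed.

Lemma sqr_enorm x : enorm x ^+ 2 = dot x x.
Proof. by rewrite sqr_sqrtr // dot_ge0. Qed.

Lemma coord_le_enorm x i : `|x 0 i| <= enorm x.
Proof.
rewrite -(ler_pXn2r (n := 2)) ?nnegrE ?enorm_ge0 // sqr_enorm.
rewrite real_normK ?num_real // /dot (bigD1 i) //= -expr2 lerDl.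
by apply: sumr_ge0 => j _; rewrite -expr2 sqr_ge0.
Qed.

Lemma enorm_eq0 x : enorm x = 0 -> x = 0.
Proof.
move=> x0; apply/rowP => i; rewrite mxE; apply/eqP.
by rewrite -normr_le0 -x0 coord_le_enorm.
Qed.

Lemma enorm0 : enorm (0 : 'rV[R]_m) = 0.
Proof. by rewrite /enorm dot0l sqrtr0. Qed.

Lemma enormZ a x : enorm (a *: x) = `|a| * enorm x.
Proof.
by rewrite /enorm dotZl dotZr mulrA -expr2 sqrtrM ?sqr_ge0 // sqrtr_sqr.
Qed.

Lemma enormN x : enorm (- x) = enorm x.
Proof. by rewrite -scaleN1r enormZ normrN normr1 mul1r. Qed.

Lemma enormBC x y : enorm (x - y) = enorm (y - x).
Proof. by rewrite -enormN opprB. Qed.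

Lemma sqr_enormD x y :
  enorm (x + y) ^+ 2 = enorm x ^+ 2 + 2 * dot x y + enorm y ^+ 2.
Proof. by rewrite !sqr_enorm !dotDl !dotDr (dotC y x); ring. Qed.

Lemma dot_le_enorm x y : dot x y <= enorm x * enorm y.
Proof.
have [x0|x0] := eqVneq (enorm x) 0.
  by rewrite (enorm_eq0 x0) dot0l enorm0 mul0r.
have [y0|y0] := eqVneq (enorm y) 0.
  by rewrite (enorm_eq0 y0) dotC dot0l enorm0 mulr0.
have xp : 0 < enorm x by rewrite lt_def x0 enorm_ge0.
have yp : 0 < enorm y by rewrite lt_def y0 enorm_ge0.
have := dot_ge0 (enorm y *: x - enorm x *: y).
rewrite !dotBl !dotBr !dotZl !dotZr -!sqr_enorm (dotC y x) => h.
have {}h : 0 <= (2 * enorm x * enorm y) * (enorm x * enorm y - dot x y) by nra.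
by rewrite pmulr_rge0 ?subr_ge0 // in h; rewrite !mulr_gt0.
Qed.

Lemma norm_dot_le x y : `|dot x y| <= enorm x * enorm y.
Proof.
by rewrite ler_norml dot_le_enorm lerNl -dotNl -(enormN x) dot_le_enorm.
Qed.

Lemma enormD x y : enorm (x + y) <= enorm x + enorm y.
Proof.
rewrite -(ler_pXn2r (n := 2)) ?nnegrE ?addr_ge0 ?enorm_ge0 //.
by rewrite sqr_enormD; have := dot_le_enorm x y; nra.
Qed.

Lemma enormB_le x y z : enorm (x - z) <= enorm (x - y) + enorm (y - z).
Proof. by rewrite (le_trans _ (enormD _ _)) // addrA subrK. Qed.

Lemma norm_le_enorm x : `|x| <= enorm x.
Proof.
rewrite [leLHS]/Num.Def.normr/= mx_normrE; apply: bigmax_le => [|[i j] _ /=].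
  exact: enorm_ge0.
by rewrite [i]ord1; exact: coord_le_enorm.
Qed.

Lemma coord_le_norm x i : `|x 0 i| <= `|x|.
Proof.
rewrite [leRHS]/Num.Def.normr/= mx_normrE.
exact: (le_bigmax _ (fun ij => `|x ij.1 ij.2|) (0, i)).
Qed.

Lemma enorm_le_norm x : enorm x <= m%:R * `|x|.
Proof.
have nn : 0 <= m%:R * `|x| by rewrite mulr_ge0.
rewrite -(ler_pXn2r (n := 2)) ?nnegrE ?enorm_ge0 // sqr_enorm.
have h : dot x x <= m%:R * `|x| ^+ 2.
  rewrite -[m in m%:R]card_ord -sum1_card natr_sum mulr_suml.
  apply: ler_sum => i _; rewrite mul1r -expr2 -real_normK ?num_real //.
  by rewrite lerXn2r ?nnegrE // coord_le_norm.
rewrite (le_trans h) // exprMn ler_wpM2r ?sqr_ge0 //.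
by rewrite -natrX ler_nat; case: (m) => // k; rewrite -[leqLHS]muln1 leq_mul.
Qed.

Lemma near_enorm x (e : R) : 0 < e -> \forall y \near x, enorm (y - x) < e.
Proof.
move=> e0; have d0 : 0 < e / m.+1%:R by rewrite divr_gt0.
apply/nbhs_ballP; exists (e / m.+1%:R) => //= y; rewrite -ball_normE /= distrC => xy.
apply: (le_lt_trans (enorm_le_norm _)).
rewrite ltr_pdivlMr // in xy; apply: le_lt_trans xy.
by rewrite mulrC ler_wpM2l // ler_nat.
Qed.

Lemma enorm_continuous : continuous (enorm : 'rV[R]_m -> R).
Proof.
move=> x; apply/(@cvgrPdist_lt _ _ _ (nbhs x)) => e e0; near=> y.
have xy : enorm (y - x) < e by near: y; exact: near_enorm.
apply: le_lt_trans xy; rewrite ler_norml.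
have := enormB_le x y 0; have := enormB_le y x 0; rewrite !subr0 (enormBC x).
by move=> *; apply/andP; split; lra.
Unshelve. all: by end_near. Qed.

Lemma eball_nbhs x a : 0 < a -> nbhs x (eball x a).
Proof. exact: near_enorm. Qed.

Lemma eball_convex x a y z (s : R) : eball x a y -> eball x a z ->
  0 <= s <= 1 -> eball x a (y + s *: (z - y)).
Proof.
rewrite /eball /= => xy xz /andP[s0 s1].
have -> : y + s *: (z - y) - x = (1 - s) *: (y - x) + s *: (z - x).
  by apply/rowP => i; rewrite !mxE; ring.
apply: (le_lt_trans (enormD _ _)); rewrite !enormZ (ger0_norm s0).
rewrite ger0_norm ?subr_ge0 //.
by have [yz|/ltW yz] := leP (enorm (y - x)) (enorm (z - x)); nra.
Qed.

Lemma closure_enorm (S : set 'rV[R]_m) x :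
  closure S x <-> forall e, 0 < e -> exists2 y, S y & enorm (y - x) < e.
Proof.
split=> [Sx e e0|Sx].
  by have [y [Sy xy]] := Sx _ (eball_nbhs x e0); exists y.
move=> B /nbhs_ballP[e /= e0 eB]; have [y Sy xy] := Sx _ e0.
exists y; split => //; apply: eB; rewrite -ball_normE /= distrC.
exact: le_lt_trans (norm_le_enorm _) xy.
Qed.

Lemma closed_eball_compact x a : compact [set y | enorm (y - x) <= a].
Proof.
apply: bounded_closed_compact.
  exists (`|x| + a); split; first exact: num_real.
  move=> b b1 y /= ya.
  by have := ler_normD (y - x) x; have := norm_le_enorm (y - x); rewrite subrK; lra.
have -> : [set y | enorm (y - x) <= a] = (fun y => enorm (y - x)) @^-1` [set s | s <= a].
  by [].
apply: closed_comp; last exact: closed_le.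
move=> y _; apply: continuous_comp; last exact: enorm_continuous.
by apply: continuousB; [exact: cvg_id|exact: cst_continuous].
Qed.

End EuclideanTheory.

(** * Directional and partial derivatives *)

Section LineDerivatives.
Context {R : realType}.

Lemma is_derive_line {V W : normedModType R} (f : V -> W) x l s d :
  is_derive (x + s *: l) l f d <->
  is_derive s 1 (fun r => f (x + r *: l)) d.
Proof.
have E : (fun h : R => h^-1 *: ((f \o shift (x + s *: l)) (h *: l) - f (x + s *: l)))
       = (fun h : R => h^-1 *: (((fun r => f (x + r *: l)) \o shift s) (h *: 1)
           - (fun r => f (x + r *: l)) s)).
  apply/funext => h /=; congr (_ *: (f _ - _)).
  by rewrite -[h *: (1 : R)]/(h * 1) mulr1 scalerDl addrCA.
by split=> -[df Df]; split;
  move: df Df; rewrite /derivable /derive E.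
Qed.

Lemma is_derive_line0 {V W : normedModType R} (f : V -> W) x l d :
  is_derive x l f d <-> is_derive (0 : R) 1 (fun r => f (x + r *: l)) d.
Proof. by rewrite -is_derive_line scale0r addr0. Qed.

Lemma derivable_is_derive {V W : normedModType R} (f : V -> W) x l :
  derivable f x l -> is_derive x l f ('D_l f x).
Proof. by move=> df; split. Qed.

Lemma is_derive_continuous (f : R -> R) (s d : R) :
  is_derive s 1 f d -> {for s, continuous f}.
Proof. by move=> df; apply/differentiable_continuous/derivable1_diffP. Qed.

Lemma line_MVT {V : normedModType R} (f : V -> R) x l h :
  (forall s, `|s| <= `|h| -> derivable f (x + s *: l) l) ->
  exists2 s, `|s| <= `|h| &
    f (x + h *: l) - f x = h * 'D_l f (x + s *: l).
Proof.
move=> df.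
have dg (s : R) : `|s| <= `|h| ->
    is_derive s 1 (fun r => f (x + r *: l)) ('D_l f (x + s *: l)).
  move=> sh; exact: (is_derive_line f x l s _).1 (derivable_is_derive (df s sh)).
have main a b : a <= b -> `|a| <= `|h| -> `|b| <= `|h| -> exists2 s, `|s| <= `|h| &
    f (x + b *: l) - f (x + a *: l) = 'D_l f (x + s *: l) * (b - a).
  move=> ab ha hb.
  have inab s : s \in `[a, b] -> `|s| <= `|h|.
    rewrite in_itv /= => /andP[as_ sb]; move: ha hb; rewrite !ler_norml; lra.
  have [|s sab|s sab E] := @MVT_segment _ (fun r => f (x + r *: l))
      (fun s => 'D_l f (x + s *: l)) _ _ ab.
  - by move=> s sab; apply/dg/inab; apply: subset_itv_oo_cc.
  - apply: continuous_in_subspaceT => t; rewrite inE => tab.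
    exact: is_derive_continuous (dg t (inab t tab)).
  - by exists s => //; exact: inab.
have [h0|h0] := leP 0 h.
  have [||s sh E] := main _ _ h0; rewrite ?normr0 //.
  by exists s => //; move: E; rewrite scale0r addr0 subr0 mulrC.
have [||s sh E] := main _ _ (ltW h0); rewrite ?normr0 //.
exists s => //; move: E; rewrite scale0r addr0 sub0r mulrN => /(congr1 -%R).
by rewrite opprB opprK mulrC.
Qed.

End LineDerivatives.

Section PartialDerivatives.
Context {R : realType} {m : nat}.
Implicit Types (f : 'rV[R]_m -> R) (x h l : 'rV[R]_m).
Notation e i := (basis_vec i).

Lemma norm_le_coords x (c : R) : 0 <= c -> (forall i, `|x 0 i| <= c) -> `|x| <= c.
Proof.
move=> c0 xc; rewrite [leLHS]/Num.Def.normr/= mx_normrE.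
by apply: bigmax_le => // -[i j] _ /=; rewrite [i]ord1.
Qed.

Lemma norm_basis_vec i : `|e i : 'rV[R]_m| <= 1.
Proof.
apply: norm_le_coords => // j; rewrite !mxE eqxx /=.
by case: (j == i); rewrite ?normr1 ?normr0.
Qed.

(** The path from [x] to [x + h] along the coordinate axes stays in a box, which
    is a ball for the sup norm. *)
Lemma telescoping_MVT f x h :
  (forall y i, `|y - x| <= `|h| -> derivable f y (e i)) ->
  exists2 p : 'I_m -> 'rV[R]_m, (forall i, `|p i - x| <= `|h|) &
    f (x + h) - f x = \sum_i h 0 i * 'D_(e i) f (p i).
Proof.
move=> df.
pose X (k : nat) := x + \row_(i < m) (if (i < k)%N then h 0 i else 0).
have XS (k : 'I_m) : X k.+1 = X k + h 0 k *: e k.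
  apply/rowP => i; rewrite !mxE eqxx /= ltnS leq_eqVlt -addrA; congr (_ + _).
  have [->|ik] := eqVneq i k; first by rewrite eqxx ltnn mulr1 add0r.
  by rewrite (inj_eq val_inj) (negbTE ik) /= mulr0 addr0.
have near (k : 'I_m) s : `|s| <= `|h 0 k| -> `|X k + s *: e k - x| <= `|h|.
  move=> sh; apply: norm_le_coords => // i; rewrite !mxE eqxx /=.
  rewrite (_ : _ - _ = (if (i < k)%N then h 0 i else 0) + s * (i == k)%:R); last by ring.
  have [->|ik] := eqVneq i k.
    by rewrite ltnn mulr1 add0r (le_trans sh) // coord_le_norm.
  by rewrite mulr0 addr0; case: ifP => _; rewrite ?normr0 // coord_le_norm.
have step (k : 'I_m) : {p | `|p - x| <= `|h| &
    f (X k.+1) - f (X k) = h 0 k * 'D_(e k) f p}.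
  apply: cid2; have [s sh|s sh E] := @line_MVT _ _ f (X k) (e k) (h 0 k).
    by apply: df; exact: near.
  by exists (X k + s *: e k); [exact: near|rewrite XS].
exists (fun k => s2val (step k)) => [k|]; first exact: (s2valP (step k)).
have -> : f (x + h) - f x = \sum_(k < m) (f (X k.+1) - f (X k)).
  rewrite -(big_mkord predT (fun k => f (X k.+1) - f (X k))).
  rewrite telescope_sumr //; congr (f _ - f _); apply/rowP => i; rewrite !mxE.
    by rewrite ltn_ord.
  by rewrite addr0.
by apply: eq_bigr => k _; exact: (s2valP' (step k)).
Qed.

Definition partials_near f x := \forall y \near x, forall i, derivable f y (e i).

(** Each step of [telescoping_MVT] contributes a partial derivative at a nearby
    point, and continuity sends these to the partial derivatives at [x]. *)
Lemma is_derive_partials f x l : partials_near f x ->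
  (forall i, {for x, continuous ('D_(e i) f)}) ->
  is_derive x l f (\sum_i l 0 i * 'D_(e i) f x).
Proof.
move=> pf cf; set d := \sum_i _.
have lim : (fun h : R => h^-1 *: ((f \o shift x) (h *: l) - f x)) @ 0^' --> d.
  apply/cvgrPdist_le => eps eps0.
  pose c := eps / (m.+1%:R * (`|l| + 1)).
  have l1 : 0 < `|l| + 1 by rewrite ltr_wpDl.
  have c0 : 0 < c by rewrite divr_gt0 ?mulr_gt0.
  have : \forall y \near x, forall i, derivable f y (e i) /\
      `|'D_(e i) f x - 'D_(e i) f y| <= c.
    near=> y => i; split; first by move: i; near: y; exact: pf.
    move: i; near: y; apply: filter_forall => i.
    by have /cvgrPdist_le/(_ _ c0) := cf i.
  move=> /nbhs_ballP[r /= r0 rP].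
  have r1 : 0 < r / (`|l| + 1) by rewrite divr_gt0.
  near=> h.
  have h0 : h != 0 by near: h; exact: nbhs_dnbhs_neq.
  have hr : `|h| < r / (`|l| + 1) by near: h; exact: dnbhs0_lt.
  have {}hr : `|h *: l| < r.
    rewrite normrZ; rewrite ltr_pdivlMr // in hr; apply: le_lt_trans hr.
    by rewrite ler_wpM2l // lerDl.
  have inr y : `|y - x| <= `|h *: l| -> forall i, derivable f y (e i) /\
      `|'D_(e i) f x - 'D_(e i) f y| <= c.
    move=> yx; apply: rP; rewrite -ball_normE /= distrC.
    exact: le_lt_trans hr.
  have [y i yx|p px E] := @telescoping_MVT f x (h *: l).
    by have [] := inr y yx i.
  rewrite /= (addrC (h *: l)) E scaler_sumr -sumrB.
  apply: (le_trans (ler_norm_sum _ _ _)).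
  have : \sum_(i < m) (c * (`|l| + 1)) <= eps.
    rewrite sumr_const card_ord -mulr_natr /c invfM mulrA divfK ?gt_eqF //.
    by rewrite -mulrA ler_piMr ?(ltW eps0) // ler_pdivrMl // mulr1 ler_nat.
  apply: le_trans; apply: ler_sum => i _.
  rewrite mxE /GRing.scale /= !mulrA mulVf // mul1r -mulrBr normrM mulrC.
  apply: ler_pM => //; first by have [] := inr _ (px i) i.
  by rewrite (le_trans (coord_le_norm _ _)) // lerDl.
by split; [apply/cvg_ex; exists d | apply: cvg_lim].
Unshelve. all: by end_near. Qed.

(** The mean value theorem for the increment of [f] in the direction [e i], as a
    function on the line of direction [e j], and then for ['D_(e j) f]. *)
Lemma mixed_difference f x i j (h : R) :
  (forall y, `|y - x| <= 2 * `|h| -> derivable f y (e j) /\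
     derivable ('D_(e j) f) y (e i)) ->
  exists2 p, `|p - x| <= 2 * `|h| &
    f (x + h *: e i + h *: e j) - f (x + h *: e i) - f (x + h *: e j) + f x
      = h ^+ 2 * 'D_(e i) ('D_(e j) f) p.
Proof.
move=> df.
have near s t : `|s| <= `|h| -> `|t| <= `|h| -> `|x + s *: e j + t *: e i - x| <= 2 * `|h|.
  move=> sh th; rewrite addrAC (addrAC x) subrr add0r.
  apply: (le_trans (ler_normD _ _)); rewrite !normrZ.
  have := norm_basis_vec i; have := norm_basis_vec j.
  have := normr_ge0 s; have := normr_ge0 t; have := normr_ge0 (e i : 'rV[R]_m).
  have := normr_ge0 (e j : 'rV[R]_m); nra.
pose g := (f \o shift (h *: e i)) \- f.
have dg s : `|s| <= `|h| -> is_derive (x + s *: e j) (e j) g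
   ('D_(e j) f (x + s *: e j + h *: e i) - 'D_(e j) f (x + s *: e j)).
  move=> sh; apply: is_deriveB; last first.
    apply: derivable_is_derive; have := near s 0 sh.
    by rewrite normr0 scale0r addr0 => /(_ (normr_ge0 _)) /df[].
  apply/is_derive_line; have -> : (fun r => (f \o shift (h *: e i)) (x + r *: e j)) =
     (fun r => f (x + h *: e i + r *: e j)).
    by apply/funext => r; rewrite /= addrAC.
  have [dj _] := df _ (near s h sh (lexx _)); rewrite addrAC in dj *.
  exact: (is_derive_line f _ _ _ _).1 (derivable_is_derive dj).
have [s sh|s sh E1] := @line_MVT _ _ g x (e j) h.
  by have [] := dg s sh.
have [t th|t th E2] := @line_MVT _ _ ('D_(e j) f) (x + s *: e j) (e i) h.
  by have [] := df _ (near s t sh th).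
exists (x + s *: e j + t *: e i); first exact: near.
rewrite expr2 -mulrA -E2 -(@derive_val _ _ _ _ _ _ _ (dg s sh)) -E1 /g /=.
by rewrite (addrAC x (h *: e j)); ring.
Qed.

Lemma eq_of_close_values (F G : 'rV[R]_m -> R) x :
  {for x, continuous F} -> {for x, continuous G} ->
  (\forall h \near 0^'+, exists p p' : 'rV[R]_m,
     [/\ `|p - x| <= 2 * h, `|p' - x| <= 2 * h & F p = G p']) ->
  F x = G x.
Proof.
move=> cF cG FG; apply/eqP; rewrite -subr_eq0 -normr_le0.
apply/ler_addgt0Pl => eps eps0; rewrite addr0.
have e2 : 0 < eps / 2 by rewrite divr_gt0.
have /cvgrPdist_le/(_ _ e2) cF' := cF; have /cvgrPdist_le/(_ _ e2) cG' := cG.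
have : \forall t \near x, `|F x - F t| <= eps / 2 /\ `|G x - G t| <= eps / 2.
  exact: filterI cF' cG'.
move=> /nbhs_ballP[r /= r0 rP].
near (0 : R)^'+ => h.
have [p [p' [px px' E]]] : exists p p' : 'rV[R]_m,
     [/\ `|p - x| <= 2 * h, `|p' - x| <= 2 * h & F p = G p'] by near: h.
have hr : h < r / 2 by near: h; apply: nbhs_right_lt; rewrite divr_gt0.
have inr y : `|y - x| <= 2 * h -> ball x r y.
  by move=> yx; rewrite -ball_normE /= distrC; apply: (le_lt_trans yx); lra.
have [c1 _] := rP p (inr p px); have [_ c2] := rP p' (inr p' px').
by move: c1 c2; rewrite E !ler_norml; lra.
Unshelve. all: by end_near. Qed.

(** Both mixed derivatives are limits of the same second difference, which is
    symmetric in [i] and [j]. *)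
Lemma schwarz f x i j :
  (\forall y \near x, [/\ derivable f y (e i), derivable f y (e j),
     derivable ('D_(e i) f) y (e j) & derivable ('D_(e j) f) y (e i)]) ->
  {for x, continuous ('D_(e i) ('D_(e j) f))} ->
  {for x, continuous ('D_(e j) ('D_(e i) f))} ->
  'D_(e i) ('D_(e j) f) x = 'D_(e j) ('D_(e i) f) x.
Proof.
move=> /nbhs_ballP[r /= r0 rP] cij cji; apply: (eq_of_close_values cij cji).
near=> h.
have h0 : 0 < h by near: h; exact: nbhs_right_gt.
have hr : h < r / 2 by near: h; apply: nbhs_right_lt; rewrite divr_gt0.
have inr y : `|y - x| <= 2 * `|h| -> ball x r y.
  rewrite gtr0_norm // => yx; rewrite -ball_normE /= distrC.
  by apply: (le_lt_trans yx); lra.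
have [y yx|p px E1] := @mixed_difference f x i j h.
  by have [_ dj _ dji] := rP y (inr y yx); split; [exact: dj|exact: dji].
have [y yx|p' px' E2] := @mixed_difference f x j i h.
  by have [di _ dij _] := rP y (inr y yx); split; [exact: di|exact: dij].
exists p, p'; rewrite -(gtr0_norm h0); split; [exact: px|exact: px'|].
have hh : h ^+ 2 != 0 by rewrite expf_neq0 ?gt_eqF.
apply: (mulfI hh); apply: etrans (esym E1) (etrans _ E2).
rewrite (addrAC x (h *: e j)); congr (_ + _).
exact: addrAC.
Unshelve. all: by end_near. Qed.

End PartialDerivatives.

(** * Derivatives at a minimum *)

Section LocalMinimum.
Context {R : realType}.

(** If [f1] had a negative derivative at 0 then [f1] would be negative just after
    0, and [f] would decrease. *)
Lemma local_min_second_derivative (f f1 : R -> R) (d c : R) : 0 < d ->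
  (forall s : R, `|s| < d -> is_derive s 1 f (f1 s)) -> is_derive (0 : R) 1 f1 c ->
  (forall s, `|s| < d -> f 0 <= f s) -> f1 0 = 0 /\ 0 <= c.
Proof.
move=> d0 df df1 fmin.
have f10 : f1 0 = 0.
  have dd : - d < d by lra.
  have d00 : `|0 : R| < d by rewrite normr0.
  have D0 : is_derive (0 : R) 1 f 0.
    apply: (@derive1_at_min _ f (- d) d 0 (ltW dd)).
    - by move=> t; rewrite in_itv /= -ltr_norml => /df[].
    - by rewrite in_itv /= oppr_lt0 d0.
    - by move=> t; rewrite in_itv /= -ltr_norml; exact: fmin.
  by rewrite -(@derive_val _ _ _ _ _ _ _ (df 0 d00)) (@derive_val _ _ _ _ _ _ _ D0).
split => //; rewrite leNgt; apply/negP => c0.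
have : h^-1 *: ((f1 \o shift 0) (h *: 1) - f1 0) @[h --> 0^'] --> c.
  by have [df1' <-] := df1; exact: df1'.
move=> /cvgr_lt/(_ _ c0); move=> near0.
have [r /= r0 rP] := near0.
pose h := Num.min d r / 2.
have [h0 hd hr] : [/\ 0 < h, h < d & h < r].
  rewrite /h; have [dr|rd] := leP d r; split; lra.
have fneg s : 0 < s -> s <= h -> f1 s < 0.
  move=> s0 sh; have := rP s; rewrite /ball_ /= sub0r normrN gtr0_norm //.
  move=> /(_ (le_lt_trans sh hr) (lt0r_neq0 s0)).
  rewrite f10 subr0 addr0 /GRing.scale /= mulr1 => neg.
  by rewrite -(pmulr_rlt0 _ (_ : 0 < s^-1)) // invr_gt0.
have [||s sh E] := @MVT _ f f1 0 h h0.
- by move=> s; rewrite in_itv /= => /andP[s0 sh]; apply: df; rewrite gtr0_norm //; lra.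
- apply: continuous_in_subspaceT => t; rewrite inE /= in_itv /= => /andP[s0 sh].
  by apply: is_derive_continuous (df t _); rewrite ger0_norm //; lra.
move: sh; rewrite in_itv /= => /andP[s0 /ltW sh].
have := fmin h; rewrite gtr0_norm // => /(_ hd); have := fneg s s0 sh.
by move: E; rewrite subr0; nra.
Qed.

(** The condition is one-sided because a parabolic comparison argument only looks
    at earlier times. *)
Lemma left_min_derivative (f : R -> R) (s c d : R) : 0 < d ->
  is_derive s 1 f c -> (forall r, s - d < r -> r <= s -> f s <= f r) -> c <= 0.
Proof.
move=> d0 df fmin; rewrite leNgt; apply/negP => c0.
have : h^-1 *: ((f \o shift s) (h *: 1) - f s) @[h --> 0^'] --> c.
  by have [df' <-] := df; exact: df'.
move=> /cvgr_gt/(_ _ c0); move=> near0.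
have [r /= r0 rP] := near0.
pose h := Num.min d r / 2.
have [h0 hd hr] : [/\ 0 < h, h < d & h < r].
  rewrite /h; have [dr|rd] := leP d r; split; lra.
have := rP (- h); rewrite /ball_ /= sub0r opprK gtr0_norm // => /(_ hr).
rewrite oppr_eq0 => /(_ (lt0r_neq0 h0)).
rewrite /GRing.scale /= mulr1 invrN mulNr oppr_gt0 pmulr_rlt0 ?invr_gt0 //.
by have := fmin (- h + s); lra.
Qed.

End LocalMinimum.

(** * The trace of a product of quadratic forms *)

Section TraceOfProduct.
Context {R : realType}.

Definition qform {m} (A : 'I_m -> 'I_m -> R) (x : 'I_m -> R) :=
  \sum_i \sum_j A i j * x i * x j.

(** Gaussian elimination: the Schur complement of the first entry is positive
    definite again. *)
Lemma positive_sum_of_squares m (A : 'I_m -> 'I_m -> R) :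
  (forall i j, A i j = A j i) ->
  (forall x, (exists i, x i != 0) -> 0 < qform A x) ->
  exists L : seq ('I_m -> R), forall i j, A i j = \sum_(l <- L) l i * l j.
Proof.
elim: m A => [|m IH] A symA posA; first by exists [::] => -[].
pose z : 'I_m.+1 := ord0; pose s := @lift m.+1 z.
have expand x : qform A x = A z z * x z ^+ 2
    + 2 * x z * (\sum_i A (s i) z * x (s i))
    + qform (fun i j => A (s i) (s j)) (x \o s).
  have -> : qform A x = (A z z * x z * x z + \sum_j A z (s j) * x z * x (s j)) +
      \sum_i (A (s i) z * x (s i) * x z + \sum_j A (s i) (s j) * x (s i) * x (s j)).
    rewrite /qform big_ord_recl big_ord_recl; congr (_ + _).
    by apply: eq_bigr => i _; rewrite big_ord_recl.
  rewrite big_split /= -/(qform (fun i j => A (s i) (s j)) (x \o s)).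
  rewrite (_ : \sum_i A z (s i) * x z * x (s i) = x z * (\sum_i A (s i) z * x (s i))).
    rewrite (_ : \sum_i A (s i) z * x (s i) * x z = x z * (\sum_i A (s i) z * x (s i))).
      by ring.
    by rewrite mulr_sumr; apply: eq_bigr => i _; ring.
  by rewrite mulr_sumr; apply: eq_bigr => i _; rewrite (symA z); ring.
have az : 0 < A z z.
  have := posA (fun i => (i == z)%:R); rewrite expand eqxx /qform.
  rewrite big1 => [|i _]; last by rewrite /s eq_sym (negbTE (neq_lift _ _)) mulr0.
  rewrite big1 => [|i _]; last first.
    by apply: big1 => j _; rewrite /comp /s [lift z i == z]eq_sym (negbTE (neq_lift _ _)) mulr0 ?mul0r.
  rewrite mulr0 !addr0 expr1n mulr1; apply.
  by exists z; rewrite eqxx oner_eq0.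
pose C i j := A (s i) (s j) - A (s i) z * A (s j) z / A z z.
have [||L LC] := IH C.
- by move=> i j; rewrite /C (symA (s i)) (mulrC (A (s i) z)).
- move=> y [i yi].
  pose b := \sum_i A (s i) z * y i.
  pose x k := if unlift z k is Some j then y j else - b / A z z.
  have xs j : x (s j) = y j by rewrite /x /s liftK.
  have xz : x z = - b / A z z by rewrite /x unlift_none.
  have := posA x; rewrite expand xz.
  rewrite (_ : \sum_i A (s i) z * x (s i) = b); last by apply: eq_bigr => j _; rewrite xs.
  rewrite (_ : qform (fun i j => A (s i) (s j)) (x \o s) = qform C y + b ^+ 2 / A z z); last first.
    rewrite expr2 {1}/b -mulrA mulr_suml -big_split /=; apply: eq_bigr => j _.
    rewrite /b mulrA mulr_sumr mulr_suml -big_split /=; apply: eq_bigr => k _.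
    by rewrite !xs /C; ring.
  move=> pos; have : 0 < A z z * (- b / A z z) ^+ 2 + 2 * (- b / A z z) * b
      + (qform C y + b ^+ 2 / A z z) by apply: pos; exists (s i); rewrite xs.
  congr (0 < _); field; exact: lt0r_neq0.
pose l0 i := A i z / Num.sqrt (A z z).
pose up (l : 'I_m -> R) k := if unlift z k is Some j then l j else 0.
exists (l0 :: map up L) => i j; rewrite big_cons big_map.
have sq : Num.sqrt (A z z) * Num.sqrt (A z z) = A z z.
  by rewrite -expr2 sqr_sqrtr // ltW.
have sn : Num.sqrt (A z z) != 0 by rewrite sqrtr_eq0 -ltNge.
have -> : l0 i * l0 j = A i z * A j z / A z z.
  by rewrite /l0 -[in RHS]sq; field.
case: (unliftP z i) => [i'|] ->; last first.
  rewrite big1 => [|l _]; last by rewrite /up unlift_none mul0r.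
  by rewrite addr0 (symA j) mulrC mulKf // lt0r_neq0.
case: (unliftP z j) => [j'|] ->; last first.
  rewrite big1 => [|l _]; last by rewrite /up unlift_none mulr0.
  by rewrite addr0 mulfK // lt0r_neq0.
rewrite (eq_bigr (fun l => l i' * l j')) => [|l _]; last by rewrite /up !liftK.
by rewrite -LC /C /s; ring.
Qed.

(** Only the symmetric part [S] of [A] matters. Written as a sum of squares of
    linear forms [l], it turns the trace into the sum of the values [qform H l]. *)
Lemma trace_product_ge0 m (A H : 'I_m -> 'I_m -> R) :
  (forall x, (exists i, x i != 0) -> 0 < qform A x) ->
  (forall i j, H i j = H j i) -> (forall x, 0 <= qform H x) ->
  0 <= \sum_i \sum_j A i j * H i j.
Proof.
move=> posA symH posH.
pose S i j := (A i j + A j i) / 2.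
have swap (K : 'I_m -> 'I_m -> R) : (forall i j, K i j = K j i) ->
    \sum_i \sum_j A i j * K i j = \sum_i \sum_j S i j * K i j.
  move=> symK; apply/eqP; rewrite -subr_eq0 -sumrB.
  under eq_bigr do rewrite -sumrB.
  have E : \sum_i \sum_j A i j * K i j = \sum_i \sum_j A j i * K i j.
    by rewrite exchange_big /=; do 2!apply: eq_bigr => ? _; rewrite symK.
  rewrite (_ : \sum_i _ = (\sum_i \sum_j A i j * K i j - \sum_i \sum_j A j i * K i j) / 2).
    by rewrite -E subrr mul0r.
  rewrite -sumrB mulr_suml; apply: eq_bigr => i _.
  by rewrite -sumrB mulr_suml; apply: eq_bigr => j _; rewrite /S; field.
have [||L LS] := @positive_sum_of_squares m S.
- by move=> i j; rewrite /S addrC.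
- move=> x /posA; rewrite /qform.
  under eq_bigr do under eq_bigr do rewrite -mulrA.
  rewrite (swap (fun i j => x i * x j)) => [|i j]; last exact: mulrC.
  by under eq_bigr do under eq_bigr do rewrite mulrA.
rewrite swap //; have -> : \sum_i \sum_j S i j * H i j = \sum_(l <- L) qform H l.
  rewrite /qform [RHS]exchange_big /=; apply: eq_bigr => i _.
  rewrite [RHS]exchange_big /=; apply: eq_bigr => j _.
  by rewrite LS mulr_suml; apply: eq_bigr => l _; ring.
by apply: sumr_ge0.
Qed.

End TraceOfProduct.

(** * Curves of class C^1 and the geodesic distance *)

Section OneVariable.
Context {R : realType}.

Lemma is_derive_mx {m : nat} (g : R -> 'rV[R]_m) (s : R) d :
  is_derive s 1 g d <->
  forall i, is_derive s 1 (fun r => g r 0 i) (d 0 i).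
Proof.
split=> [dg i|dg].
  have [dg1 dg2] := dg; split; first by move: dg1 => /derivable_mxP/(_ 0 i).
  by rewrite -dg2 (derive_mx dg1) mxE.
have dg1 : derivable g s 1.
  by apply/derivable_mxP => i j; rewrite [i]ord1; have [] := dg j.
split=> //; rewrite (derive_mx dg1); apply/rowP => i; rewrite mxE.
exact: (@derive_val _ _ _ _ _ _ _ (dg i)).
Qed.

Lemma is_derive_dot {m : nat} (g : R -> 'rV[R]_m) (s : R) d v :
  is_derive s 1 g d -> is_derive s 1 (fun r => dot v (g r)) (dot v d).
Proof.
move=> /is_derive_mx dg; rewrite /dot.
have -> : (fun r => \sum_i v 0 i * g r 0 i) = \sum_i (fun r => v 0 i * g r 0 i).
  by apply/funext => r; rewrite fct_sumE.
apply: is_derive_sum => i; exact: (@is_deriveZ _ _ _ _ (v 0 i) _ _ _ (dg i)).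
Qed.

Lemma is_derive_curve_comp {m : nat} (g : R -> 'rV[R]_m) (th : R -> R) (s : R) d c :
  is_derive (th s) 1 g d -> is_derive s 1 th c ->
  is_derive s 1 (g \o th) (c *: d).
Proof.
move=> /is_derive_mx dg dth; apply/is_derive_mx => i; rewrite mxE mulrC.
exact: (@is_derive1_comp _ (fun r => g r 0 i) th s _ _ (dg i) dth).
Qed.

(** For the quadratic functions used below the remainder is explicit, and a
    polynomial computation does the work of the rules of differentiation. *)
Lemma is_derive_quadratic_error (f : R -> R) (s d C : R) :
  (forall h, `|f (s + h) - f s - d * h| <= C * h ^+ 2) -> is_derive s 1 f d.
Proof.
move=> fC.
have C0 : 0 <= C by have := le_trans (normr_ge0 _) (fC 1); rewrite expr1n mulr1.
have lim : (fun h : R => h^-1 *: ((f \o shift s) (h *: 1) - f s)) @ 0^' --> d.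
  apply/cvgrPdist_le => e e0; near=> h.
  have h0 : h != 0 by near: h; exact: nbhs_dnbhs_neq.
  have hr : `|h| < e / (C + 1).
    by near: h; apply: dnbhs0_lt; rewrite divr_gt0 // ltr_wpDl.
  rewrite /= -[h *: (1 : R)]/(h * 1) mulr1 (addrC h) /GRing.scale /=.
  have -> : d - h^-1 * (f (s + h) - f s) = - (h^-1 * (f (s + h) - f s - d * h)) by field.
  rewrite normrN normrM normfV mulrC ler_pdivrMr ?normr_gt0 //.
  apply: (le_trans (fC h)); rewrite -real_normK ?num_real // expr2 mulrA ler_wpM2r //.
  rewrite ltr_pdivlMr ?ltr_wpDl // in hr.
  by have := normr_ge0 h; nra.
by split; [apply/cvg_ex; exists d | apply: cvg_lim].
Unshelve. all: by end_near. Qed.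

Lemma nondecreasing_of_derive (f f1 : R -> R) (a b : R) : a <= b ->
  (forall s, a <= s <= b -> is_derive s 1 f (f1 s)) ->
  (forall s, a <= s <= b -> 0 <= f1 s) -> f a <= f b.
Proof.
move=> ab df f10.
have [|t tab|s sab E] := @MVT_segment _ f f1 a b ab.
- by move=> s; rewrite in_itv /= => /andP[as_ sb]; apply: df; rewrite !ltW.
- move: t tab; apply: continuous_in_subspaceT => t; rewrite inE /= in_itv /= => tab.
  exact: is_derive_continuous (df t tab).
- by rewrite -subr_ge0 E mulr_ge0 ?subr_ge0 // f10 // -in_itv.
Qed.

(** [clamped_square] is C^1, vanishes on the negative half-line and increases
    from 0 to 1 on the unit interval: precomposing with it lets two curves be
    joined without a corner. *)
Definition clamped_square (s : R) : R := Num.max s 0 ^+ 2.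

Lemma clamped_square_unit s : s <= 1 -> 0 <= clamped_square s <= 1.
Proof.
move=> s1; rewrite /clamped_square sqr_ge0 /= expr_le1 // ?ge_max ?s1 ?ler01 //.
by rewrite le_max lexx orbT.
Qed.

Lemma is_derive_clamped_square (s : R) :
  is_derive s 1 clamped_square (2 * Num.max s 0).
Proof.
apply: (@is_derive_quadratic_error _ _ _ 1) => h; rewrite /clamped_square mul1r.
by have [h1|h1] := leP (s + h) 0; have [h2|h2] := leP s 0;
  rewrite ler_norml; apply/andP; split; nra.
Qed.

Lemma is_derive_affine (a c s : R) : is_derive s 1 (fun r => a * r + c) a.
Proof.
apply: (@is_derive_quadratic_error _ _ _ 0) => h.
by rewrite (_ : _ - _ = 0) ?normr0 ?mul0r //; ring.
Qed.

(** Lengths are handled through primitives of the speed, which can be composed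
    with a change of parameter and compared by their derivatives. *)
Definition unit_primitive (h L : R -> R) :=
  forall s : R, 0 <= s <= 1 -> is_derive s 1 L (h s).

Lemma exists_primitive (h : R -> R) : continuous h ->
  exists L, unit_primitive h L.
Proof.
move=> ch; pose L x := (\int[lebesgue_measure]_(t in `[- 1, x]) h t)%R.
exists L => s /andP[s0 s1].
(* The lower bound -1 and the upper bound 2 make 0 and 1 interior points, where
   the derivative is two-sided. *)
have [||||dL L1] := @continuous_FTC1_closed _ h (- 1) s 2.
- lra.
- apply: continuous_compact_integrable; first exact: segment_compact.
  exact: continuous_subspaceT.
- lra.
- exact: ch.
by split; [exact: dL|rewrite -derive1E].
Qed.

Lemma integral_unit_primitive (h L : R -> R) : continuous h ->
  unit_primitive h L ->
  (\int[lebesgue_measure]_(s in `[(0 : R)%R, (1 : R)%R]) (h s)%:E = (L 1 - L 0)%:E)%E.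
Proof.
move=> ch dL; have cL s : 0 <= s <= 1 -> {for s, continuous L}.
  by move=> /dL; exact: is_derive_continuous.
rewrite (@continuous_FTC2 _ h L 0 1 ltr01) //.
- exact: continuous_subspaceT.
- split.
  + by move=> s; rewrite in_itv /= => /andP[s0 s1]; case: (dL s); rewrite // !ltW.
  + by apply: cvg_at_right_filter; apply: cL; rewrite lexx ler01.
  + by apply: cvg_at_left_filter; apply: cL; rewrite lexx ler01.
- move=> s; rewrite in_itv /= => /andP[s0 s1]; rewrite derive1E.
  by apply: (@derive_val _ _ _ _ _ _ _ (dL s _)); rewrite !ltW.
Qed.

End OneVariable.

Section Curves.
Context {R : realType} {n : nat}.
Notation V := 'rV[R]_n.+1.
Implicit Types (Om B : set V) (x y z : V) (g : R -> V).

Definition speed g (s : R) : R := enorm (derive1 g s).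

Lemma C1_curve_is_derive Om x y g (s : R) : C1_curve Om x y g ->
  is_derive s 1 g (derive1 g s).
Proof. by case=> dg _ _ _ _; rewrite derive1E; exact: derivable_is_derive. Qed.

Lemma speed_continuous Om x y g : C1_curve Om x y g -> continuous (speed g).
Proof.
case=> _ cg _ _ _ s; apply: continuous_comp; first exact: cg.
exact: enorm_continuous.
Qed.

Lemma arc_lengthE Om x y g L : C1_curve Om x y g ->
  unit_primitive (speed g) L -> arc_length g = (L 1 - L 0)%:E.
Proof.
by move=> /speed_continuous cg dL; exact: integral_unit_primitive.
Qed.

Lemma arc_length_le Om x y g (F f : R -> R) : C1_curve Om x y g ->
  unit_primitive f F -> (forall s, 0 <= s <= 1 -> speed g s <= f s) ->
  (arc_length g <= (F 1 - F 0)%:E)%E.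
Proof.
move=> Cg dF gf; have [L dL] := exists_primitive (speed_continuous Cg).
rewrite (arc_lengthE Cg dL) lee_fin.
have := @nondecreasing_of_derive _ (F \- L) (f \- speed g) 0 1 ler01.
rewrite /=; have H1 : forall s : R, 0 <= s <= 1 -> is_derive s 1 (F \- L) (f s - speed g s).
  by move=> s s01; apply: is_deriveB; [exact: dF|exact: dL].
move=> /(_ H1); have H2 : forall s, 0 <= s <= 1 -> 0 <= f s - speed g s.
  by move=> s s01; rewrite subr_ge0 gf.
by move=> /(_ H2); lra.
Qed.

(** Differentiate [r |-> enorm v * L r - dot v (g r)], where [v] is the chord: by
    the Cauchy-Schwarz inequality it is nondecreasing. *)
Lemma chord_le Om x y g L (s t : R) : C1_curve Om x y g ->
  unit_primitive (speed g) L -> 0 <= s -> s <= t -> t <= 1 ->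
  enorm (g t - g s) <= L t - L s.
Proof.
move=> Cg dL s0 st t1; set v := g t - g s.
have [v0|v0] := eqVneq (enorm v) 0.
  rewrite v0 subr_ge0; apply: (@nondecreasing_of_derive _ L (speed g)) => // r /andP[sr rt].
    by apply: dL; lra.
  exact: enorm_ge0.
have vp : 0 < enorm v by rewrite lt_def v0 enorm_ge0.
pose f r := enorm v * L r - dot v (g r).
have : f s <= f t.
  apply: (@nondecreasing_of_derive _ f
    (fun r => enorm v * speed g r - dot v (derive1 g r))) => // r /andP[sr rt].
    apply: is_deriveB; last exact: is_derive_dot (C1_curve_is_derive r Cg).
    by apply: (@is_deriveZ _ _ _ _ (enorm v)); apply: dL; lra.
  by rewrite subr_ge0 dot_le_enorm.
rewrite /f => h; rewrite -(ler_pM2l vp) -expr2 sqr_enorm {2}/v dotBr; nra.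
Qed.

Lemma C1_segment Om x y :
  (forall s, 0 <= s <= 1 -> closure Om (x + s *: (y - x))) ->
  exists2 g, C1_curve Om x y g & arc_length g = (enorm (y - x))%:E.
Proof.
move=> inOm; pose g (s : R) := x + s *: (y - x).
have dg (s : R) : is_derive s 1 g (y - x).
  apply/is_derive_mx => i; rewrite (_ : (fun r => _) = (fun r => (y - x) 0 i * r + x 0 i)).
    exact: is_derive_affine.
  by apply/funext => r; rewrite !mxE addrC (mulrC r).
have g'E : derive1 g = cst (y - x).
  by apply/funext => s; rewrite derive1E; exact: (@derive_val _ _ _ _ _ _ _ (dg s)).
have Cg : C1_curve Om x y g.
  split.
  - by move=> s; have [] := dg s.
  - by rewrite g'E; exact: cst_continuous.
  - exact: inOm.
  - by rewrite /g scale0r addr0.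
  - by rewrite /g scale1r addrC subrK.
exists g => //.
have dL : unit_primitive (speed g) (fun r => enorm (y - x) * r + 0).
  by move=> s _; rewrite /speed g'E; exact: is_derive_affine.
by rewrite (arc_lengthE Cg dL) mulr1 mulr0 !addr0 subr0.
Qed.

(** The two curves are reparametrized on the two halves of the interval by
    [clamped_square], so that both have speed 0 at the junction. The sum of the
    reparametrized curves minus the common point is one formula for both
    halves. *)
Lemma C1_concat Om x y z g1 g2 : C1_curve Om x y g1 -> C1_curve Om y z g2 ->
  exists2 g, C1_curve Om x z g & (arc_length g <= arc_length g1 + arc_length g2)%E.
Proof.
move=> Cg1 Cg2.
pose th1 (s : R) := 1 - clamped_square (- 2 * s + 1).
pose th2 (s : R) := clamped_square (2 * s + - 1).
pose c1 (s : R) : R := 4 * Num.max (- 2 * s + 1) 0.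
pose c2 (s : R) : R := 4 * Num.max (2 * s + - 1) 0.
have dth1 (s : R) : is_derive s 1 th1 (c1 s).
  have h := is_derive1_comp (is_derive_clamped_square _) (is_derive_affine (- 2) 1 s).
  have -> : c1 s = 0 - 2 * Num.max (- 2 * s + 1) 0 * (- 2) by rewrite /c1; ring.
  exact: is_deriveB.
have dth2 (s : R) : is_derive s 1 th2 (c2 s).
  have h := is_derive1_comp (is_derive_clamped_square _) (is_derive_affine 2 (- 1) s).
  have -> : c2 s = 2 * Num.max (2 * s + - 1) 0 * 2 by rewrite /c2; ring.
  exact: h.
have cmax a c : continuous (fun s : R => 4 * Num.max (a * s + c) 0 : R).
  move=> s; apply: cvgM; first exact: cvg_cst.
  apply: (@continuous_max _ _ (fun r => a * r + c) (cst 0)).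
    exact: is_derive_continuous (is_derive_affine a c s).
  exact: cst_continuous.
have c10 s : 0 <= c1 s by rewrite mulr_ge0 // le_max lexx orbT.
have c20 s : 0 <= c2 s by rewrite mulr_ge0 // le_max lexx orbT.
have th1I s : 0 <= s <= 1 -> 0 <= th1 s <= 1.
  move=> s01; have := @clamped_square_unit _ (- 2 * s + 1); rewrite /th1; lra.
have th2I s : 0 <= s <= 1 -> 0 <= th2 s <= 1.
  move=> s01; have := @clamped_square_unit _ (2 * s + - 1); rewrite /th2; lra.
have th1R s : 1 / 2 <= s -> th1 s = 1.
  by move=> s2; rewrite /th1 /clamped_square max_r ?expr0n ?subr0 //; lra.
have th2L s : s <= 1 / 2 -> th2 s = 0.
  by move=> s2; rewrite /th2 /clamped_square max_r ?expr0n //; lra.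
have [_ cg1 in1 g10 g11] := Cg1; have [_ cg2 in2 g20 g21] := Cg2.
pose g s := (g1 \o th1) s + (g2 \o th2) s - y.
pose g' s := c1 s *: derive1 g1 (th1 s) + c2 s *: derive1 g2 (th2 s).
have dg (s : R) : is_derive s 1 g (g' s).
  rewrite -[g' s]subr0; apply: is_deriveB; apply: is_deriveD.
    exact: is_derive_curve_comp (C1_curve_is_derive _ Cg1) (dth1 s).
  exact: is_derive_curve_comp (C1_curve_is_derive _ Cg2) (dth2 s).
have g'E : derive1 g = g'.
  by apply/funext => s; rewrite derive1E; exact: (@derive_val _ _ _ _ _ _ _ (dg s)).
have gL s : s <= 1 / 2 -> g s = g1 (th1 s).
  by move=> s2; rewrite /g /= th2L // g20 addrK.
have gR s : 1 / 2 <= s -> g s = g2 (th2 s).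
  by move=> s2; rewrite /g /= th1R // g11 addrC addKr.
have Cg : C1_curve Om x z g.
  split.
  - by move=> s; have [] := dg s.
  - have cterm (c th : R -> R) (h : R -> V) : continuous c -> continuous th ->
        continuous h -> continuous (fun s => c s *: h (th s)).
      move=> cc cth ch s; apply: cvgZ; first exact: cc.
      exact: (@continuous_comp _ _ _ th h s (cth s) (ch (th s))).
    rewrite g'E => s; apply: cvgD.
      apply: cterm => //; first exact: cmax.
      by move=> r; exact: is_derive_continuous (dth1 r).
    apply: cterm => //; first exact: cmax.
    by move=> r; exact: is_derive_continuous (dth2 r).
  - move=> s s01; have [s2|/ltW s2] := leP s (1 / 2).
      by rewrite gL //; apply/in1/th1I.
    by rewrite gR //; apply/in2/th2I.
  - rewrite gL; last by lra.
    by rewrite /th1 /clamped_square mulr0 add0r max_l // expr1n subrr.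
  - rewrite gR; last by lra.
    by rewrite /th2 /clamped_square mulr1 (_ : 2 + - 1 = 1) ?max_l ?expr1n //; lra.
exists g => //.
have [L1 dL1] := exists_primitive (speed_continuous Cg1).
have [L2 dL2] := exists_primitive (speed_continuous Cg2).
pose F s := (L1 \o th1) s + (L2 \o th2) s.
pose f s := speed g1 (th1 s) * c1 s + speed g2 (th2 s) * c2 s.
have dF : unit_primitive f F.
  move=> s s01; apply: is_deriveD; apply: is_derive1_comp => //.
    exact/dL1/th1I.
  exact/dL2/th2I.
have t10 : th1 0 = 0.
  by rewrite /th1 /clamped_square mulr0 add0r max_l // expr1n subrr.
have t11 : th1 1 = 1 by apply: th1R; lra.
have t20 : th2 0 = 0 by apply: th2L; lra.
have t21 : th2 1 = 1.
  by rewrite /th2 /clamped_square mulr1 (_ : 2 + - 1 = 1) ?max_l ?expr1n //; lra.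
have := arc_length_le Cg dF; rewrite (arc_lengthE Cg1 dL1) (arc_lengthE Cg2 dL2).
rewrite -EFinD /F /= t10 t11 t20 t21.
rewrite (_ : _ - (_ + _) = L1 1 - L1 0 + (L2 1 - L2 0)); last by ring.
apply => s s01; rewrite /speed g'E; apply: (le_trans (enormD _ _)).
by rewrite !enormZ !ger0_norm // mulrC (mulrC (c2 s)).
Qed.

(** The points divide the arc length [L] equally: the intermediate value theorem
    provides them, and [chord_le] bounds the steps. *)
Lemma curve_chain Om x y g (D e : R) (k : nat) : C1_curve Om x y g ->
  (arc_length g <= D%:E)%E -> (0 < k)%N -> D <= k%:R * e ->
  exists z : nat -> V, [/\ z 0%N = x, z k = y,
    forall i, closure Om (z i) &
    forall i, (i < k)%N -> enorm (z i.+1 - z i) <= e].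
Proof.
move=> Cg gD k0 De; have [L dL] := exists_primitive (speed_continuous Cg).
rewrite (arc_lengthE Cg dL) lee_fin in gD.
have [_ _ inOm g0 g1] := Cg.
have Lmono s t : 0 <= s -> s <= t -> t <= 1 -> L s <= L t.
  move=> s0 st t1; apply: (@nondecreasing_of_derive _ L (speed g)) => // r /andP[sr rt].
    by apply: dL; lra.
  exact: enorm_ge0.
have kp : 0 < k%:R :> R by rewrite ltr0n.
pose T i := L 0 + (L 1 - L 0) * (minn i k)%:R / k%:R.
have step i : {s : R | 0 <= s <= 1 & L s = T i}.
  apply: cid2; have [||s s01 E] := @IVT _ L 0 1 (T i) ler01.
  - apply: continuous_in_subspaceT => t; rewrite inE /= in_itv /= => t01.
    exact: is_derive_continuous (dL t t01).
  - have L01 := Lmono 0 1 (lexx _) ler01 (lexx _).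
    rewrite min_l // max_r // /T -mulrA.
    have : 0 <= (minn i k)%:R / k%:R :> R by rewrite divr_ge0.
    have : (minn i k)%:R / k%:R <= 1 :> R by rewrite ler_pdivrMr // mul1r ler_nat geq_minr.
    by move=> *; apply/andP; split; nra.
  - by exists s => //; rewrite in_itv /= in s01.
pose s i := s2val (step i).
have sI i : 0 <= s i <= 1 by exact: (s2valP (step i)).
have sT i : L (s i) = T i by exact: (s2valP' (step i)).
have dist i j : T i <= T j -> enorm (g (s j) - g (s i)) <= T j - T i.
  rewrite -!sT; have /andP[i0 i1] := sI i; have /andP[j0 j1] := sI j.
  have [ij|/ltW ji] := leP (s i) (s j); first by move=> _; exact: chord_le Cg dL _ _ _.
  move=> LL; rewrite enormBC; apply: (le_trans (chord_le Cg dL j0 ji i1)).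
  by have := Lmono _ _ j0 ji i1; lra.
exists (fun i => if i == 0%N then x else if i == k then y else g (s i)).
have E0 : g (s 0%N) = x.
  apply/eqP; rewrite -subr_eq0; apply/eqP/enorm_eq0/eqP.
  rewrite eq_le enorm_ge0 andbT -g0; apply: le_trans (chord_le Cg dL _ _ _) _.
  - by []. - by have /andP[] := sI 0%N. - by have /andP[] := sI 0%N.
  - by rewrite sT /T min0n mulr0 mul0r addr0 subrr.
have Ek : g (s k) = y.
  apply/eqP; rewrite -subr_eq0; apply/eqP/enorm_eq0/eqP.
  rewrite eq_le enorm_ge0 andbT -g1 enormBC; apply: le_trans (chord_le Cg dL _ _ _) _.
  - by have /andP[] := sI k. - by have /andP[] := sI k. - by [].
  - by rewrite sT /T minnn mulfK ?gt_eqF // subr_le0; lra.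
have E i : (if i == 0%N then x else if i == k then y else g (s i)) = g (s i).
  by case: eqP => [->//|_]; case: eqP => [->|].
split=> // [|i|i ik]; first by rewrite eqxx (gtn_eqF k0).
  by rewrite E; apply: inOm.
rewrite (E i.+1) (E i); have TT : T i.+1 - T i = (L 1 - L 0) / k%:R.
  by rewrite /T (minn_idPl ik) (minn_idPl (ltnW ik)) -natr1; field; rewrite gt_eqF.
have L01 := Lmono 0 1 (lexx _) ler01 (lexx _).
apply: le_trans (dist _ _ _) _.
  by rewrite -subr_ge0 TT divr_ge0 // subr_ge0.
by rewrite TT ler_pdivrMr // mulrC; lra.
Qed.

Lemma geo_dist_set_lt Om x B (M : \bar R) : (geo_dist_set Om x B < M)%E ->
  exists y g, [/\ B y, C1_curve Om x y g & (arc_length g < M)%E].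
Proof.
move=> /ereal_inf_lt[_ [y By <-]] /ereal_inf_lt[_ [g Cg <-] gM].
by exists y, g.
Qed.

Lemma geo_dist_le Om x y g : C1_curve Om x y g ->
  (geo_dist Om x y <= arc_length g)%E.
Proof. by move=> Cg; apply: ereal_inf_lbound; exists g. Qed.

Lemma geo_dist_set_le Om x y B g : B y -> C1_curve Om x y g ->
  (geo_dist_set Om x B <= arc_length g)%E.
Proof.
move=> By Cg; apply: (le_trans _ (geo_dist_le Cg)).
by apply: ereal_inf_lbound; exists y.
Qed.

Lemma geo_dist_set_self Om x B : closure Om x -> B x ->
  (geo_dist_set Om x B <= 0)%E.
Proof.
move=> Ox Bx; have [s _|g Cg gE] := @C1_segment Om x x.
  by rewrite subrr scaler0 addr0.
by rewrite (le_trans (geo_dist_set_le Bx Cg)) // gE subrr enorm0.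
Qed.

(** The triangle inequality, along a given first curve since the infimum in the
    geodesic distance need not be attained. *)
Lemma geo_dist_set_curve Om x y B g : C1_curve Om x y g ->
  (geo_dist_set Om x B <= arc_length g + geo_dist_set Om y B)%E.
Proof.
move=> Cg; rewrite leNgt; apply/negP => lt.
have [L dL] := exists_primitive (speed_continuous Cg).
rewrite (arc_lengthE Cg dL) in lt.
have : (geo_dist_set Om y B < geo_dist_set Om x B - (L 1 - L 0)%:E)%E.
  by rewrite lteBrDl.
move=> /geo_dist_set_lt[z [g2 [Bz Cg2 l2]]].
have [g3 Cg3 l3] := C1_concat Cg Cg2.
have := geo_dist_set_le Bz Cg3; rewrite leNgt => /negP; apply.
apply: (le_lt_trans l3); rewrite (arc_lengthE Cg dL).
by rewrite lteBrDl in l2.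
Qed.

End Curves.

(** * Paraboloids tangent to the boundary *)

Section Tangency.
Context {R : realType} {n : nat}.
Notation V := 'rV[R]_n.+1.
Implicit Types (Om : set V) (x y a nu : V).

Lemma dot_mulmx {m} (x y : 'rV[R]_m) (Q : 'M[R]_m) : Q *m Q^T = 1%:M ->
  dot (x *m Q) (y *m Q) = dot x y.
Proof.
have E (u v : 'rV[R]_m) : dot u v = (u *m v^T) 0 0.
  by rewrite mxE; apply: eq_bigr => i _; rewrite mxE.
by move=> QQ; rewrite !E trmx_mul mulmxA -(mulmxA x) QQ mulmx1.
Qed.

Lemma dot_last_init x y :
  dot x y = last_coord x * last_coord y + dot (init_coords x) (init_coords y).
Proof.
rewrite /dot (bigD1_ord ord_max) //=; congr (_ + _).
by apply: eq_bigr => j _; rewrite !mxE.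
Qed.

(** [telescoping_MVT] applied to [phi] and then to its partial derivatives
    leaves a remainder with second derivatives only, which [M] bounds. *)
Lemma taylor_chart {m} (b M r : R) (phi : 'rV[R]_m -> R) (h : 'rV[R]_m) :
  0 < r -> holder_closure_le 2 b M (eball 0 (2 * r)) phi ->
  enorm h < r / m.+1%:R ->
  `|phi h - phi 0 - \sum_i h 0 i * 'D_(basis_vec i) phi 0|
    <= m%:R ^+ 2 * M * enorm h ^+ 2.
Proof.
move=> r0 [_ [bd0 /= C2]] hr; set D := eball 0 (2 * r) in C2.
have C2' i := C2 (basis_vec i) (norm_basis_vec i).
have inD p : `|p| <= `|h| -> D p.
  move=> ph; rewrite /D /eball /= subr0; apply: (le_lt_trans (enorm_le_norm p)).
  apply: (@le_lt_trans _ _ (m.+1%:R * enorm h)).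
    by rewrite ler_pM // ?ler_nat // (le_trans ph) // norm_le_enorm.
  by rewrite mulrC -ltr_pdivlMr // (lt_le_trans hr) // ler_wpM2r ?invr_ge0 //; lra.
have D0 : D 0 by apply: inD; rewrite normr0.
have M0 : 0 <= M := le_trans (normr_ge0 _) (bd0 0 D0).
have [y i yh|p ph E] := @telescoping_MVT _ _ phi 0 h.
  by have [+ _] := C2' i; apply; apply: inD; rewrite -[y]subr0.
rewrite add0r in E; rewrite E -sumrB; apply: (le_trans (ler_norm_sum _ _ _)).
have {}ph i : `|p i| <= `|h| by rewrite -[p i]subr0.
have second i : `|'D_(basis_vec i) phi (p i) - 'D_(basis_vec i) phi 0| <= m%:R * M * `|h|.
  have [y j yp|q' qp E'] := @telescoping_MVT _ _ ('D_(basis_vec i) phi) 0 (p i).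
    have [_ [_ D2]] := C2' i; have [+ _] := D2 _ (norm_basis_vec j); apply.
    by apply: inD; rewrite -[y]subr0 (le_trans yp).
  rewrite add0r in E'; rewrite E'; apply: (le_trans (ler_norm_sum _ _ _)).
  rewrite -[m in m%:R]card_ord -sum1_card natr_sum !mulr_suml.
  apply: ler_sum => j _; rewrite normrM mul1r mulrC; apply: ler_pM => //.
    have [_ [_ D2]] := C2' i; have [_ [bd _]] := D2 _ (norm_basis_vec j); apply: bd.
    by apply: inD; rewrite -[q' j]subr0 (le_trans (qp j)).
  exact: le_trans (coord_le_norm _ _) (ph i).
apply: (@le_trans _ _ (\sum_(i < m) `|h| * (m%:R * M * `|h|))).
  apply: ler_sum => i _; rewrite -mulrBr normrM; apply: ler_pM => //.
  exact: coord_le_norm.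
rewrite sumr_const card_ord -[leLHS]mulr_natr.
have hh : `|h| ^+ 2 <= enorm h ^+ 2.
  by rewrite lerXn2r ?nnegrE ?enorm_ge0 // norm_le_enorm.
rewrite (_ : _ * m%:R = m%:R ^+ 2 * M * `|h| ^+ 2); last by ring.
by rewrite ler_wpM2l // mulr_ge0 // exprn_ge0.
Qed.

(** Near [y] the set lies between the two paraboloids that are tangent at [y]
    to the hyperplane orthogonal to [nu]. *)
Definition tangent_at Om (C r : R) y nu := enorm nu = 1 /\
  forall x, enorm (x - y) < r ->
    (dot nu (x - y) < - (C * enorm (x - y) ^+ 2) -> Om x) /\
    (Om x -> dot nu (x - y) <= C * enorm (x - y) ^+ 2).

Lemma graph_normal_ge1 (phi : 'rV[R]_n -> R) : 1 <= enorm (graph_normal phi).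
Proof.
have := coord_le_enorm (graph_normal phi) ord_max.
by rewrite mxE unlift_none normrN normr1.
Qed.

(** In the rotated coordinates, membership is the sign of the last coordinate
    minus [phi], which is the linear form [- dot N] up to the Taylor remainder.
    Since the graph normal [N] has length at least 1, normalizing it only
    improves the estimate. *)
Lemma chart_tangent Om (b r0 M : R) y Q phi : 0 < r0 ->
  boundary_chart Om b r0 M y Q phi ->
  tangent_at Om (n%:R ^+ 2 * M) (r0 / n.+1%:R) y
    ((enorm (graph_normal phi))^-1 *: (graph_normal phi *m Q)).
Proof.
move=> r00 [[QQ _] phi0 C2 chart]; set N := graph_normal phi.
have N1 : 1 <= enorm N by exact: graph_normal_ge1.
have Np : 0 < enorm N by lra.
have QQ' : Q^T *m Q = 1%:M by exact: mulmx1C.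
split.
  rewrite enormZ gtr0_norm ?invr_gt0 //.
  have -> : enorm (N *m Q) = enorm N by rewrite /enorm dot_mulmx.
  by rewrite mulVf // gt_eqF.
move=> x xy; set z := (x - y) *m Q^T.
have zQ : z *m Q = x - y by rewrite /z -mulmxA QQ' mulmx1.
have ez : enorm z = enorm (x - y) by rewrite -zQ /enorm dot_mulmx.
have izz : enorm (init_coords z) <= enorm z.
  rewrite -(ler_pXn2r (n := 2)) ?nnegrE ?enorm_ge0 // !sqr_enorm dot_last_init.
  by rewrite lerDr -expr2 sqr_ge0.
have xyr : enorm (x - y) < r0.
  apply: (lt_le_trans xy); rewrite ler_pdivrMr // ler_peMr ?(ltW r00) //.
  by rewrite ler1n.
have OmE : Om x <-> phi (init_coords z) < last_coord z.
  have -> : Om x <-> (Om `&` eball y r0) x by split=> [|[]].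
  rewrite chart; split=> [[[z' [_ lt] E] _]|lt].
    suff -> : z = z' by [].
    by rewrite /z -E addrC addKr -mulmxA QQ mulmx1.
  split; last exact: xyr.
  exists z; last by rewrite zQ addrC subrK.
  split=> //; rewrite (le_trans izz) // ez; lra.
have tay := taylor_chart r00 C2 (le_lt_trans izz (eq_ind_r (fun e => e < _) xy ez)).
have M0 : 0 <= n%:R ^+ 2 * M.
  rewrite mulr_ge0 ?exprn_ge0 //; have [_ [bd _]] := C2.
  by apply: le_trans (normr_ge0 _) (bd 0 _); rewrite /eball /= subr0 enorm0; lra.
have Nz : dot N z = (\sum_i init_coords z 0 i * 'D_(basis_vec i) phi 0) - last_coord z.
  rewrite dot_last_init {1}/last_coord mxE unlift_none mulN1r addrC; congr (_ - _).
  by apply: eq_bigr => i _; rewrite !mxE liftK mulrC.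
rewrite phi0 subr0 in tay.
have {}tay : `|phi (init_coords z) - (dot N z + last_coord z)|
    <= n%:R ^+ 2 * M * enorm (x - y) ^+ 2.
  rewrite Nz subrK (le_trans tay) // ler_wpM2l // -ez.
  by rewrite lerXn2r ?nnegrE ?enorm_ge0.
rewrite dotZl -zQ dot_mulmx // zQ.
move: tay; rewrite ler_norml => /andP[tay1 tay2].
set K := n%:R ^+ 2 * M * _ in tay1 tay2 *.
have K0 : 0 <= K by rewrite mulr_ge0 ?exprn_ge0 ?enorm_ge0.
split=> [lt|/OmE lt].
  apply/OmE; rewrite mulrC ltr_pdivrMr // in lt; nra.
rewrite mulrC ler_pdivrMr //; nra.
Qed.

(** If the normals differed, a short step from [y] along [nu' - nu] would be
    inside according to [nu] and outside according to [nu']. *)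
Lemma tangent_unique Om (C C' r r' : R) y nu nu' : 0 < r -> 0 < r' ->
  0 <= C -> 0 <= C' ->
  tangent_at Om C r y nu -> tangent_at Om C' r' y nu' -> nu = nu'.
Proof.
move=> r0 r'0 C0 C'0 [nu1 T] [nu1' T']; pose e := nu' - nu.
have [e0|e0] := eqVneq (enorm e) 0.
  by apply/eqP; rewrite eq_sym -subr_eq0; apply/eqP/enorm_eq0.
have ep : 0 < enorm e by rewrite lt_def e0 enorm_ge0.
have e2 : enorm e ^+ 2 = 2 - 2 * dot nu nu'.
  by rewrite sqr_enorm /e !dotBl !dotBr -!sqr_enorm nu1 nu1' (dotC nu' nu); ring.
have ne : dot nu e = - (enorm e ^+ 2 / 2).
  by rewrite e2 /e dotBr -sqr_enorm nu1; field.
have ne' : dot nu' e = enorm e ^+ 2 / 2.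
  by rewrite e2 /e dotBr -sqr_enorm nu1' dotC; field.
pose B := 2 * C + 2 * C' + enorm e / r + enorm e / r' + 1.
have er : 0 <= enorm e / r by rewrite divr_ge0 ?ltW.
have er' : 0 <= enorm e / r' by rewrite divr_ge0 ?ltW.
have B0 : 0 < B by rewrite /B; lra.
pose s := B^-1; have s0 : 0 < s by rewrite invr_gt0.
have sB : s * B = 1 by rewrite mulVf // gt_eqF.
have sr q : 0 < q -> enorm e / q < B -> enorm (y + s *: e - y) < q.
  move=> q0 eq; rewrite addrC addKr enormZ gtr0_norm // /s mulrC.
  by rewrite ltr_pdivrMr // mulrC -ltr_pdivrMr.
have rB : enorm e / r < B by rewrite /B; lra.
have rB' : enorm e / r' < B by rewrite /B; lra.
have [in1 _] := T (y + s *: e) (sr r r0 rB).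
have [_ in2] := T' (y + s *: e) (sr r' r'0 rB').
have d1 : enorm (y + s *: e - y) ^+ 2 = s ^+ 2 * enorm e ^+ 2.
  by rewrite addrC addKr enormZ gtr0_norm // exprMn.
have d2 : y + s *: e - y = s *: e by rewrite addrC addKr.
rewrite d1 d2 dotZr ne in in1; rewrite d1 d2 dotZr ne' in in2.
have E2 : 0 < enorm e ^+ 2 by rewrite exprn_gt0.
have sC : s * C < 1 / 2 by rewrite /B in sB; nra.
have sC' : s * C' < 1 / 2 by rewrite /B in sB; nra.
have /in1/in2 : s * - (enorm e ^+ 2 / 2) < - (C * (s ^+ 2 * enorm e ^+ 2)).
  have : 0 < (s * enorm e ^+ 2) * (1 / 2 - s * C) by rewrite mulr_gt0 ?mulr_gt0 ?subr_gt0.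
  by lra.
move=> h; exfalso; move: h; apply/negP; rewrite -ltNge.
have : 0 < (s * enorm e ^+ 2) * (1 / 2 - s * C') by rewrite mulr_gt0 ?mulr_gt0 ?subr_gt0.
by lra.
Qed.

(** The charts that define the normal [nu y] need not be uniform in [y], but
    the normal they define is that of the uniform charts. *)
Lemma smooth_tangent (b : R) Om (nu : V -> V) : globally_smooth b Om ->
  (forall y, frontier Om y -> outward_unit_normal b Om y (nu y)) ->
  exists r C : R, [/\ 0 < r, 0 < C &
    forall y, frontier Om y -> tangent_at Om C r y (nu y)].
Proof.
move=> [r0 [M [r00 M0 charts]]] normal.
have C0 : 0 <= n%:R ^+ 2 * M by rewrite mulr_ge0 ?exprn_ge0 // ltW.
have r1 : 0 < r0 / n.+1%:R by rewrite divr_gt0.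
exists (r0 / n.+1%:R), (n%:R ^+ 2 * M + 1); split => // [|y fy]; first lra.
have [Q [phi ch]] := charts y fy.
have [r' [M' [Q' [phi' [r'0 ch' ->]]]]] := normal y fy.
have T := chart_tangent r00 ch; have T' := chart_tangent r'0 ch'.
have C'0 : 0 <= n%:R ^+ 2 * M'.
  rewrite mulr_ge0 ?exprn_ge0 //; have [_ _ [_ [bd _]] _] := ch'.
  by apply: le_trans (normr_ge0 _) (bd 0 _); rewrite /eball /= subr0 enorm0; lra.
have <- := tangent_unique r1 (divr_gt0 r'0 (ltr0Sn _ n)) C0 C'0 T T'.
have [nu1 Tx] := T; split => // x xy; have [in1 in2] := Tx x xy.
have := sqr_ge0 (enorm (x - y)) => e2; split=> [lt|/in2 le].
  by apply: in1; apply: (lt_le_trans lt); rewrite lerN2 ler_wpM2r //; lra.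
by apply: (le_trans le); rewrite ler_wpM2r //; lra.
Qed.

End Tangency.

(** * Interior balls and the oblique direction *)

Section InteriorBalls.
Context {R : realType} {n : nat}.
Notation V := 'rV[R]_n.+1.
Variables (Om : set V) (nu : V -> V) (r C : R).
Hypotheses (Om_open : open Om) (r_gt0 : 0 < r) (C_gt0 : 0 < C).
Hypothesis tan : forall y, frontier Om y -> tangent_at Om C r y (nu y).
Implicit Types (x y z a : V) (H rho : R).

Lemma open_frontierP y : frontier Om y <-> closure Om y /\ ~ Om y.
Proof. by have E := (interior_id Om).1 Om_open; rewrite /frontier E; split. Qed.

Lemma closure_cases z : closure Om z -> Om z \/ frontier Om z.
Proof.
by move=> cz; have [|nz] := pselect (Om z); [left|right; apply/open_frontierP].
Qed.

Lemma normal_unit y : frontier Om y -> enorm (nu y) = 1.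
Proof. by case/tan. Qed.

(** A point [x] of this ball satisfies
    [dot (nu y) (x - y) < - (2 * H)^-1 * enorm (x - y) ^+ 2], which is below the
    inner paraboloid as soon as [2 * C * H <= 1]. *)
Lemma inner_tangent_ball y H : frontier Om y -> 0 < H -> 2 * H <= r ->
  2 * C * H <= 1 -> eball (y - H *: nu y) H `<=` Om.
Proof.
move=> fy H0 Hr CH x; rewrite /eball /= => xa; have [nu1 T] := tan fy.
have E : x - (y - H *: nu y) = (x - y) + H *: nu y.
  by rewrite opprB addrCA addrC.
have a2 : enorm (x - (y - H *: nu y)) ^+ 2 < H ^+ 2.
  by rewrite ltrXn2r ?enorm_ge0 // ltW.
rewrite E sqr_enormD dotZr enormZ nu1 mulr1 real_normK ?num_real // dotC in a2.
have xy : enorm (x - y) < 2 * H.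
  have := enormB_le x (y - H *: nu y) y.
  rewrite (_ : y - H *: nu y - y = - (H *: nu y)); last by rewrite addrC addKr.
  by rewrite enormN enormZ nu1 mulr1 gtr0_norm //; lra.
have [|+ _] := T x; first lra.
apply; have := sqr_ge0 (enorm (x - y)).
by have := mulr_ge0 (sqr_ge0 (enorm (x - y))) (_ : 0 <= 1 - 2 * C * H); nra.
Qed.

(** The points of the ball in the direction [nu x] from its centre are in the
    set, hence below the outer paraboloid at [x]. *)
Lemma ball_depth a x rho : eball a rho `<=` Om -> 0 < rho -> frontier Om x ->
  enorm (x - a) + rho <= r ->
  rho - C * (enorm (x - a) + rho) ^+ 2 <= dot (nu x) (x - a).
Proof.
move=> aO rho0 fx xr; rewrite leNgt; apply/negP => lt.
have [nu1 T] := tan fx.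
pose X := dot (nu x) (x - a) + C * (enorm (x - a) + rho) ^+ 2.
pose q := (Num.max X 0 + rho) / 2.
have [q0 Xq qr] : [/\ 0 <= q, X < q & q < rho].
  by rewrite /q /X; have [|] := leP X 0; rewrite /X => ?; split; lra.
pose p := a + q *: nu x.
have pa : enorm (p - a) = q.
  by rewrite /p addrC addKr enormZ nu1 mulr1 ger0_norm.
have px : enorm (p - x) <= enorm (x - a) + q.
  by have := enormB_le p a x; rewrite pa (enormBC a x); lra.
have [|_ +] := T p; first lra.
have /[swap]/[apply] : Om p by apply: aO; rewrite /eball /= pa.
have E : p - x = q *: nu x - (x - a) by apply/rowP => i; rewrite !mxE; ring.
rewrite E.
rewrite dotBr dotZr -sqr_enorm nu1 expr1n mulr1.
rewrite -E.
have : C * enorm (p - x) ^+ 2 <= C * (enorm (x - a) + rho) ^+ 2.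
  by rewrite ler_wpM2l ?ltW // ltrXn2r // ?enorm_ge0 //; have := enorm_ge0 (x - a); lra.
by move: Xq; rewrite /X; lra.
Qed.

(** If the ball of radius [H] around [z] leaves the set, let [y] be a point of
    the complement nearest to [z]. By [ball_depth] the normal at [y] is almost
    [y - z], so the inner tangent ball at [y] contains [z]. *)
Lemma interior_ball z H : Om z -> 0 < H -> 2 * H <= r -> 8 * C * H <= 1 ->
  exists2 a, eball a H `<=` Om & enorm (z - a) < H.
Proof.
move=> Oz H0 Hr CH.
have [zO|] := pselect (eball z H `<=` Om).
  by exists z => //; rewrite subrr enorm0.
move=> /existsNP[p /not_implyP[pz Op]]; rewrite /eball /= in pz.
pose K := [set y | enorm (y - z) <= enorm (p - z)] `&` ~` Om.
have cK : compact K.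
  apply: (@subclosed_compact _ _ [set y | enorm (y - z) <= enorm (p - z)]).
  - apply: closedI; last exact: open_closedC.
    by apply: compact_closed; [exact: norm_hausdorff|exact: closed_eball_compact].
  - exact: closed_eball_compact.
  - exact: subIsetl.
have K0 : K !=set0 by exists p; split => /=.
have dcont : continuous (fun y : V => enorm (y - z)).
  move=> y; apply: (@continuous_comp _ _ _ (fun y => y - z) enorm).
    by apply: continuousB; [exact: cvg_id|exact: cst_continuous].
  exact: enorm_continuous.
have [y + ymin] := compact_EVT_min K0 cK (continuous_subspaceT dcont).
rewrite inE => -[/= yz Oy]; pose h := enorm (y - z).
have h0 : 0 < h.
  rewrite lt_def enorm_ge0 andbT; apply/eqP => /enorm_eq0/eqP.
  by rewrite subr_eq0 => /eqP yzE; rewrite yzE in Oy.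
have hO : eball z h `<=` Om.
  move=> x /= xz; apply: contrapT => Ox.
  have : h <= enorm (x - z).
    apply: ymin; rewrite inE; split => //=.
    by apply: (le_trans (ltW xz)); exact: yz.
  by rewrite leNgt xz.
have fy : frontier Om y.
  apply/open_frontierP; split => //; apply/closure_enorm => e e0.
  pose s := Num.min (e / (2 * h)) 1.
  have s0 : 0 < s by rewrite lt_min ltr01 divr_gt0 // mulr_gt0.
  have s1 : s <= 1 by rewrite ge_min lexx orbT.
  have se : s * h < e.
    have : s <= e / (2 * h) by rewrite ge_min lexx.
    by rewrite ler_pdivlMr ?mulr_gt0 //; nra.
  exists (y + s *: (z - y)).
    apply: hO; rewrite /eball /=.
    have -> : y + s *: (z - y) - z = (1 - s) *: (y - z).
      by apply/rowP => i; rewrite !mxE; ring.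
    rewrite enormZ ger0_norm ?subr_ge0 // -/h; nra.
  by rewrite addrC addKr enormZ gtr0_norm // enormBC.
have hH : h < H by rewrite (le_lt_trans _ pz).
have depth := ball_depth hO h0 fy.
exists (y - H *: nu y).
  by apply: inner_tangent_ball => //; nra.
rewrite -(ltr_pXn2r (n := 2)) ?nnegrE ?enorm_ge0 ?(ltW H0) //.
have -> : z - (y - H *: nu y) = H *: nu y - (y - z).
  by apply/rowP => i; rewrite !mxE; ring.
rewrite sqr_enormD enormN enormZ normal_unit // dotNr dotZl -/h mulr1.
rewrite real_normK ?num_real //.
have {}depth : h - C * (h + h) ^+ 2 <= dot (nu y) (y - z) by apply: depth; rewrite -/h; lra.
have : 0 < h * (2 * H - h - 8 * C * H * h) by rewrite mulr_gt0 //; nra.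
by have := ler_wpM2l (ltW H0) depth; nra.
Qed.

Lemma closed_interior_ball z H : closure Om z -> 0 < H -> 2 * H <= r ->
  8 * C * H <= 1 -> exists2 a, eball a H `<=` Om & enorm (z - a) <= H.
Proof.
move=> cz H0 Hr CH; have [Oz|fz] := closure_cases cz.
  by have [a aO za] := interior_ball Oz H0 Hr CH; exists a => //; exact: ltW.
exists (z - H *: nu z); first by apply: inner_tangent_ball => //; nra.
by rewrite opprB addrC subrK enormZ normal_unit // mulr1 gtr0_norm.
Qed.

(** Seen from a boundary point that it almost touches, an interior ball of
    radius [H] has its centre almost at [- H *: nu x]. *)
Lemma almost_touching_ball a x H (k c : R) : eball a H `<=` Om -> 0 < H ->
  frontier Om x -> enorm (x - a) <= (1 + k) * H -> 0 <= k <= 1 -> 3 * H <= r ->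
  0 < c -> 3 * k <= c ^+ 2 / 4 -> 18 * C * H <= c ^+ 2 / 4 ->
  enorm (x - a - H *: nu x) < c * H.
Proof.
move=> aO H0 fx xa k01 Hr c0 kc Hc.
rewrite -(ltr_pXn2r (n := 2)) ?nnegrE ?enorm_ge0 ?mulr_ge0 ?ltW //.
rewrite sqr_enormD enormN enormZ normal_unit // dotNr dotZr mulr1.
rewrite real_normK ?num_real // dotC.
have depth : H - C * (enorm (x - a) + H) ^+ 2 <= dot (nu x) (x - a).
  by apply: ball_depth => //; nra.
have e0 := enorm_ge0 (x - a).
have b1 : enorm (x - a) ^+ 2 <= ((1 + k) * H) ^+ 2.
  by rewrite lerXn2r ?nnegrE //; nra.
have b2 : C * (enorm (x - a) + H) ^+ 2 <= C * (3 * H) ^+ 2.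
  by rewrite ler_wpM2l ?(ltW C_gt0) // lerXn2r ?nnegrE //; nra.
have k3 : ((1 + k) * H) ^+ 2 <= (1 + 3 * k) * H ^+ 2.
  by have := mulr_ge0 (_ : 0 <= k * (1 - k)) (sqr_ge0 H); nra.
have CH2 : 2 * H * (C * (3 * H) ^+ 2) <= c ^+ 2 / 4 * H ^+ 2.
  by have := ler_wpM2r (sqr_ge0 H) Hc; nra.
have kH2 := ler_wpM2r (sqr_ge0 H) kc.
have HH : 0 < H ^+ 2 by rewrite exprn_gt0.
have cH : 0 < c ^+ 2 * H ^+ 2 by rewrite mulr_gt0 ?exprn_gt0.
have := ler_wpM2l (ltW H0) depth; rewrite exprMn; nra.
Qed.

Lemma inward_displacement x (m : V) (c h : R) : frontier Om x -> enorm m = 1 ->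
  c <= dot m (nu x) -> 0 < h -> h < r -> C * h < c -> Om (x - h *: m).
Proof.
move=> fx m1 mc h0 hr Ch; have [nu1 T] := tan fx.
have E : x - h *: m - x = - (h *: m) by rewrite addrC addKr.
have e : enorm (- (h *: m)) = h by rewrite enormN enormZ m1 mulr1 gtr0_norm.
have [|+ _] := T (x - h *: m); rewrite E e //.
by apply; rewrite dotNr dotZr (dotC _ m); nra.
Qed.

End InteriorBalls.

(** The geometric facts used for the propagation of positivity: every point is
    in, or touches, a ball of a fixed radius [H] inside the domain, and such
    balls can be enlarged by the factor [1 + k] across the boundary in such a
    way that [mu] points out of the enlarged ball. *)
Definition ball_geometry {R : realType} {n : nat} (Om : set 'rV[R]_n.+1)
    (mu : R * 'rV[R]_n.+1 -> 'rV[R]_n.+1) (H k : R) : Prop :=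
  [/\ forall z, Om z -> exists2 a, eball a H `<=` Om & enorm (z - a) < H,
      forall z, closure Om z -> exists2 a, eball a H `<=` Om & enorm (z - a) <= H,
      forall t a x, eball a H `<=` Om -> frontier Om x ->
        enorm (x - a) <= (1 + k) * H -> 0 < dot (mu (t, x)) (x - a),
      forall t x, frontier Om x -> exists2 e, 0 < e &
        forall h, 0 < h -> h < e -> Om (x - h *: mu (t, x)) &
      forall a y, eball a H `<=` Om -> frontier Om y ->
        enorm (y - a) <= (1 + k) * H -> exists a0,
        [/\ eball a0 H `<=` Om, enorm (y - a0) <= H & enorm (a0 - a) < H]].

Section BallGeometry.
Context {R : realType} {n : nat}.
Notation V := 'rV[R]_n.+1.

Lemma obliqueness_constant (b : R) (Om : set V) (nu : V -> V) (mu : R * V -> V) :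
  boundary_field_conditions b Om nu mu ->
  exists2 c : R, 0 < c <= 1 &
    forall t x, frontier Om x -> c <= dot (mu (t, x)) (nu x).
Proof.
move=> [_ _ inf0].
set S := [set s | _] in inf0.
have lb t x : frontier Om x -> (ereal_inf S <= (dot (mu (t, x)) (nu x))%:E)%E.
  by move=> fx; apply: ereal_inf_lbound; exists t, x.
case: (ereal_inf S) inf0 lb => [s||] //.
  rewrite lte_fin => s0 lb; exists (Num.min s 1) => [|t x fx].
    by rewrite lt_min s0 ltr01 ge_min lexx orbT.
  by rewrite ge_min -lee_fin lb.
(* The infimum is +oo when the boundary is empty. *)
move=> _ lb; exists 1 => [|t x fx]; first by rewrite ltr01 lexx.
by have := lb t x fx; rewrite leye_eq.
Qed.

(** If an interior ball of centre [a] almost touches the boundary at [x], then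
    [x - a] is [H *: nu x] up to an error less than [c * H], where [c] is the
    obliqueness constant; such an error cannot make the inner product with [mu]
    nonpositive. *)
Lemma ball_geometry_exists (b : R) (Om : set V) (nu : V -> V) (mu : R * V -> V) :
  open Om -> globally_smooth b Om ->
  (forall y, frontier Om y -> outward_unit_normal b Om y (nu y)) ->
  boundary_field_conditions b Om nu mu ->
  exists H k : R, [/\ 0 < H, 0 < k <= 1 & ball_geometry Om mu H k].
Proof.
move=> Om_open smooth normal bfc.
have [c /andP[c0 c1] muc] := obliqueness_constant bfc.
have [_ mu1 _] := bfc.
have [r [C [r0 C0 tan]]] := smooth_tangent smooth normal.
have c2 : 0 < c ^+ 2 by rewrite exprn_gt0.
have c21 : c ^+ 2 <= 1 by rewrite expr_le1 // ltW.
(* These are the values for which [almost_touching_ball] has error [c * H]. *)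
pose k := c ^+ 2 / 12; pose H := Num.min (r / 3) (c ^+ 2 / (72 * C)).
have C72 : 0 < 72 * C by rewrite mulr_gt0.
have H0 : 0 < H by rewrite lt_min !divr_gt0.
have Hr : 3 * H <= r.
  have : H <= r / 3 by rewrite ge_min lexx.
  by lra.
have HC : H * (72 * C) <= c ^+ 2.
  by rewrite -ler_pdivlMr // ge_min lexx orbT.
have k0 : 0 < k by rewrite divr_gt0.
have k1 : k <= 1 by rewrite /k; lra.
have touch a x : eball a H `<=` Om -> frontier Om x ->
    enorm (x - a) <= (1 + k) * H -> enorm (x - a - H *: nu x) < c * H.
  move=> aO fx xa; apply: (almost_touching_ball C0 tan aO _ fx xa) => //.
  - by rewrite (ltW k0). - by rewrite /k; lra. - by lra.
exists H, k; split => //; first by rewrite k0.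
split.
- by move=> z Oz; apply: (interior_ball Om_open C0 tan) => //; lra.
- by move=> z cz; apply: (closed_interior_ball Om_open C0 tan) => //; lra.
- move=> t a x aO fx xa; pose e := x - a - H *: nu x.
  have -> : x - a = H *: nu x + e by apply/rowP => i; rewrite !mxE; ring.
  rewrite dotDr dotZr.
  have := norm_dot_le (mu (t, x)) e; rewrite mu1 // mul1r ler_norml => /andP[h1 _].
  have := touch a x aO fx xa; rewrite -/e => h2.
  by have := ler_wpM2l (ltW H0) (muc t x fx); lra.
- move=> t x fx; exists (Num.min r (c / C)) => [|h h0].
    by rewrite lt_min r0 divr_gt0.
  rewrite lt_min ltr_pdivlMr // mulrC => /andP[hr hc].
  exact: (inward_displacement tan fx (mu1 t x fx) (muc t x fx)).
- move=> a y aO fy ya; exists (y - H *: nu y); split.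
  + by apply: (inner_tangent_ball tan) => //; lra.
  + by rewrite opprB addrC subrK enormZ (normal_unit tan) // mulr1 gtr0_norm.
  + rewrite addrAC (lt_le_trans (touch a y aO fy ya)) // ler_piMl // ltW //.
Qed.

End BallGeometry.

(** * Comparison with a moving barrier *)

Section Barrier.
Context {R : realType} {n : nat}.
Notation V := 'rV[R]_n.+1.
Implicit Types (Om : set V) (mu : R * V -> V) (v : R * V -> R) (x y a d l : V).

Lemma enorm_le_of_sqr x (r : R) : 0 <= r -> enorm x ^+ 2 <= r ^+ 2 -> enorm x <= r.
Proof. by move=> r0; rewrite ler_pXn2r ?nnegrE ?enorm_ge0. Qed.

Lemma enorm_lt_of_sqr x (r : R) : 0 <= r -> enorm x ^+ 2 < r ^+ 2 -> enorm x < r.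
Proof. by move=> r0; rewrite ltr_pXn2r ?nnegrE ?enorm_ge0. Qed.

(** First and second derivatives [c1] and [c2] at 0, when the first derivative
    [f1] is only known near 0. *)
Definition derivatives_at_0 (F : R -> R) (c1 c2 : R) := exists (d : R) (f1 : R -> R),
  [/\ 0 < d, forall s : R, `|s| < d -> is_derive s 1 F (f1 s), f1 0 = c1 &
      is_derive (0 : R) 1 f1 c2].

(** What the comparison argument uses of a classical solution of a linear
    parabolic inequality with oblique boundary condition; [al], [K] and [L]
    bound the coefficients. The derivatives are existentially quantified values
    at a point, so that no regularity beyond them is carried along. The last
    clause is the boundary condition: [v] does not increase to first order when
    one moves inwards along [mu]. *)
Definition supersolution Om mu (al K L : R) v : Prop :=
  [/\ {within setT `*` closure Om, continuous v},
      forall (t : R) x, Om x -> exists (vt : R) (G : V) (Hs Am : 'M[R]_n.+1) (B : V),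
        [/\ is_derive t 1 (fun s => v (s, x)) vt,
            forall l, derivatives_at_0 (fun s => v (t, x + s *: l)) (dot l G)
              (\sum_i \sum_j Hs i j * l 0 i * l 0 j) /\ (forall i j, Hs i j = Hs j i),
            forall xi : V, al * enorm xi ^+ 2
              <= \sum_i \sum_j Am i j * xi 0 i * xi 0 j,
            \sum_i Am i i <= K /\ enorm B <= K &
            \sum_i \sum_j Am i j * Hs i j + dot B G - L * v (t, x) <= vt] &
      forall t x, frontier Om x -> forall e : R, 0 < e -> exists2 h0 : R, 0 < h0 &
        forall h, 0 < h -> h < h0 -> v (t, x - h *: mu (t, x)) <= v (t, x) + e * h].

(** The barrier vanishes on the boundary of a ball that moves with velocity
    [d] and grows at speed [g]. *)
Definition moving_center (s0 : R) a d (t : R) : V := a + (t - s0) *: d.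
Definition moving_radius (s0 rho0 g t : R) : R := rho0 + (t - s0) * g.
Definition moving_paraboloid (s0 rho0 g : R) a d (z : R * V) : R :=
  moving_radius s0 rho0 g z.1 ^+ 2 - enorm (z.2 - moving_center s0 a d z.1) ^+ 2.

Lemma moving_paraboloid_continuous s0 rho0 g a d :
  continuous (moving_paraboloid s0 rho0 g a d).
Proof.
have c1 : continuous (fun z : R * V => z.1 - s0).
  by move=> z; apply: cvgB; [exact: cvg_fst|exact: cvg_cst].
have sq (f : R * V -> R) : continuous f -> continuous (fun z => f z ^+ 2).
  by move=> cf z; exact: (cvgM (cf z) (cf z)).
have cr : continuous (fun z : R * V => moving_radius s0 rho0 g z.1 : R).
  move=> z; apply: cvgD; first exact: cvg_cst.
  by apply: cvgM; [exact: c1|exact: cvg_cst].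
have cc : continuous (fun z : R * V => enorm (z.2 - moving_center s0 a d z.1)).
  move=> z.
  apply: (@continuous_comp _ _ _ (fun z : R * V => z.2 - moving_center s0 a d z.1) enorm).
    apply: cvgB; first exact: cvg_snd.
    apply: cvgD; first exact: cvg_cst.
    by apply: cvgZ; [exact: c1|exact: cvg_cst].
  exact: enorm_continuous.
by move=> z; apply: cvgB; [exact: sq cr z|exact: sq cc z].
Qed.

Lemma is_derive_moving_paraboloid s0 rho0 g a d x (t : R) :
  is_derive t 1 (fun s => moving_paraboloid s0 rho0 g a d (s, x))
    (2 * (moving_radius s0 rho0 g t * g + dot (x - moving_center s0 a d t) d)).
Proof.
apply: (@is_derive_quadratic_error _ _ _ _ `|g ^+ 2 - dot d d|) => h.
rewrite /moving_paraboloid /=.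
have -> : x - moving_center s0 a d (t + h) = (x - moving_center s0 a d t) + (- h) *: d.
  by apply/rowP => i; rewrite !mxE; ring.
set y := x - _; have -> : moving_radius s0 rho0 g (t + h) = moving_radius s0 rho0 g t + h * g.
  by rewrite /moving_radius; ring.
clearbody y; rewrite !sqr_enorm dotDl !dotDr !dotZl !dotZr (dotC d y).
have -> : forall p q k : R, (p + h * g) ^+ 2 - (q + - h * k + (- h * k + - h * (- h * dot d d))) -
   (p ^+ 2 - q) - 2 * (p * g + k) * h = (g ^+ 2 - dot d d) * h ^+ 2 by move=> *; ring.
by rewrite normrM (ger0_norm (sqr_ge0 h)).
Qed.

Lemma is_derive_exp_decay (k s0 t : R) :
  is_derive t 1 (fun s => expR (- k * (s - s0))) (- k * expR (- k * (t - s0))).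
Proof.
have -> : (fun s => expR (- k * (s - s0))) = expR \o (fun s => - k * s + k * s0).
  by apply/funext => s /=; congr expR; ring.
rewrite [- k * expR _]mulrC (_ : - k * (t - s0) = - k * t + k * s0); last by ring.
apply: is_derive1_comp; exact: is_derive_affine.
Qed.

Lemma is_derive_sqr (f : R -> R) (t c : R) : is_derive t 1 f c ->
  is_derive t 1 (fun s => f s ^+ 2) (2 * f t * c).
Proof.
move=> df; rewrite (_ : 2 * f t * c = f t *: c + f t *: c).
  under eq_fun do rewrite expr2; exact: is_deriveM.
by rewrite /GRing.scale /=; ring.
Qed.

(** This is the barrier along a line: [P] is the value of the paraboloid, [m] the
    inner product of the position and the direction of the line, and [q] the
    square of the length of this direction. *)
Lemma derivatives_sqr_paraboloid (P m q k : R) :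
  derivatives_at_0 (fun s => k * (P - 2 * s * m - s ^+ 2 * q) ^+ 2)
    (- (4 * k * P * m)) (k * (8 * m ^+ 2 - 4 * P * q)).
Proof.
pose Q s : R := P - 2 * s * m - s ^+ 2 * q.
pose Q' s : R := - (2 * q) * s + (- 2 * m).
have dQ (s : R) : is_derive s 1 Q (Q' s).
  apply: (@is_derive_quadratic_error _ _ _ _ `|q|) => h.
  rewrite (_ : _ - _ = - q * h ^+ 2); last by rewrite /Q /Q'; ring.
  by rewrite normrM normrN (ger0_norm (sqr_ge0 h)).
have dQ' (s : R) : is_derive s 1 Q' (- (2 * q)) by exact: is_derive_affine.
exists 1, (fun s => k * (2 * Q s * Q' s)); split => //.
- by move=> s _; apply: (@is_deriveZ _ _ _ _ k); exact: is_derive_sqr.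
- by rewrite /Q /Q'; ring.
- rewrite (_ : k * _ = k *: (2 *: (Q 0 *: (- (2 * q)) + Q' 0 *: Q' 0))); last first.
    by rewrite /GRing.scale /= /Q /Q'; ring.
  apply: (@is_deriveZ _ _ _ (fun s => 2 * Q s * Q' s) k).
  under eq_fun do rewrite -mulrA.
  exact: (@is_deriveZ _ _ _ (fun s => Q s * Q' s) 2).
Qed.

(** The first and second order conditions at a minimum of the difference between
    a function and the barrier along a line. *)
Lemma touching_from_above (F : R -> R) (c1 c2 P m q k d : R) :
  derivatives_at_0 F c1 c2 -> 0 < d ->
  (forall s, `|s| < d -> F 0 - k * P ^+ 2 <=
     F s - k * (P - 2 * s * m - s ^+ 2 * q) ^+ 2) ->
  c1 = - (4 * k * P * m) /\ k * (8 * m ^+ 2 - 4 * P * q) <= c2.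
Proof.
move=> [d1 [f1 [d10 dF f10 df1]]] d0 Fmin.
have [d2 [g1 [d20 dG g10 dg1]]] := derivatives_sqr_paraboloid P m q k.
pose dd := Num.min d (Num.min d1 d2).
have dd0 : 0 < dd by rewrite !lt_min d0 d10 d20.
pose w (s : R) := k * (P - 2 * s * m - s ^+ 2 * q) ^+ 2.
have H1 (s : R) : `|s| < dd -> is_derive s 1 (F \- w) (f1 s - g1 s).
  by rewrite !lt_min => /and3P[_ s1 s2]; apply: is_deriveB; [exact: dF|exact: dG].
have H2 : is_derive (0 : R) 1 (f1 \- g1) (c2 - k * (8 * m ^+ 2 - 4 * P * q)).
  exact: is_deriveB.
have H3 (s : R) : `|s| < dd -> (F \- w) 0 <= (F \- w) s.
  rewrite !lt_min => /and3P[sd _ _] /=.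
  by rewrite /w expr0n /= mulr0 !mul0r !subr0; exact: Fmin.
have [] := local_min_second_derivative dd0 H1 H2 H3.
by rewrite /= f10 g10 => /eqP; rewrite subr_eq0 => /eqP ->; rewrite subr_ge0.
Qed.

(** The constant [k] makes the decaying barrier a strict subsolution: the
    quadratic polynomial in [P] of [decay_rate_poly] has no positive value. Its
    discriminant dictates the fraction. *)
Definition decay_rate (al K L r0 r1 W : R) : R :=
  L + (8 * r1 * W + 4 * K + 4 * K * r1 + 8 * al) ^+ 2 / (32 * al * r0 ^+ 2).

Lemma decay_rate_poly (al K L r0 r1 W P rho : R) : 0 < al -> 0 < r0 -> r0 <= rho ->
  (L - decay_rate al K L r0 r1 W) * P ^+ 2
    + (8 * r1 * W + 4 * K + 4 * K * r1 + 8 * al) * P - 8 * al * rho ^+ 2 <= 0.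
Proof.
move=> al0 r00 r0r; rewrite /decay_rate; set be := 8 * r1 * W + _ + _ + _.
have D0 : 0 < 32 * al * r0 ^+ 2 by rewrite !mulr_gt0 ?exprn_gt0.
have rr : r0 ^+ 2 <= rho ^+ 2 by rewrite lerXn2r ?nnegrE // ltW // (lt_le_trans r00).
have : 0 <= (be * P - 16 * al * r0 ^+ 2) ^+ 2 / (32 * al * r0 ^+ 2).
  by rewrite divr_ge0 ?sqr_ge0 // ltW.
have -> : (be * P - 16 * al * r0 ^+ 2) ^+ 2 / (32 * al * r0 ^+ 2) =
    be ^+ 2 / (32 * al * r0 ^+ 2) * P ^+ 2 - be * P + 8 * al * r0 ^+ 2.
  by field; rewrite !gt_eqF.
by have := ler_wpM2l (ltW al0) rr; nra.
Qed.

Lemma enorm_expand x l (s : R) :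
  enorm (x + s *: l) ^+ 2 = enorm x ^+ 2 + 2 * s * dot x l + s ^+ 2 * enorm l ^+ 2.
Proof.
by rewrite sqr_enormD dotZr enormZ exprMn real_normK ?num_real // mulrA.
Qed.

(** At such a minimum the gradients of [v] and of the barrier agree, the Hessian
    of [v] dominates that of the barrier and the time derivative of [v] is at
    most that of the barrier. Hence the inequality satisfied by [v] passes to
    the barrier, where [decay_rate_poly] contradicts it. The contradiction is
    strict because [v] is less than the barrier at this point. *)
Lemma no_interior_touching Om mu (al K L : R) v (s0 rho0 g r0 r1 W c t0 : R) a d x0 :
  let eta := moving_paraboloid s0 rho0 g a d in
  let k := decay_rate al K L r0 r1 W in
  let w z := c * expR (- k * (z.1 - s0)) * eta z ^+ 2 in
  open Om -> supersolution Om mu al K L v ->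
  0 < al -> 0 < K -> 0 < L -> 0 < r0 -> 0 <= W -> 0 < c ->
  `|g| <= W -> enorm d <= W ->
  r0 <= moving_radius s0 rho0 g t0 <= r1 -> Om x0 -> s0 < t0 -> 0 < eta (t0, x0) ->
  v (t0, x0) < w (t0, x0) ->
  (forall t x, s0 <= t <= t0 -> Om x -> 0 <= eta (t, x) ->
     v (t0, x0) - w (t0, x0) <= v (t, x) - w (t, x)) -> False.
Proof.
move=> eta k w Om_open [_ super _] al0 K0 L0 r00 W0 c0 gW dW /andP[rr0 rr1] Ox0 st0 eta0 vw vmin.
have [vt [G [Hs [Am [B [dvt exps ell [trK BK] ineq]]]]]] := super t0 x0 Ox0.
set rho := moving_radius s0 rho0 g t0 in rr0 rr1.
pose y := x0 - moving_center s0 a d t0.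
pose P := eta (t0, x0); pose E := expR (- k * (t0 - s0)).
have E0 : 0 < E by exact: expR_gt0.
have cE : 0 < c * E by rewrite mulr_gt0.
have PE : P = rho ^+ 2 - enorm y ^+ 2 by [].
have rho_gt0 : 0 < rho by rewrite (lt_le_trans r00).
have y0 := enorm_ge0 y.
have yr : enorm y <= r1.
  apply: (le_trans _ rr1); apply: enorm_le_of_sqr; first exact: ltW.
  by rewrite -subr_ge0 -PE; exact: ltW.
pose wt := c * (E * (2 * P * (2 * (rho * g + dot y d))) - k * E * P ^+ 2).
have dwt : is_derive t0 1 (fun s => w (s, x0)) wt.
  rewrite /w /=; under eq_fun do rewrite -mulrA.
  apply: (@is_deriveZ _ _ _ _ c).
  rewrite (_ : _ - _ = E *: (2 * P * (2 * (rho * g + dot y d))) + P ^+ 2 *: (- k * E)); last first.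
    by rewrite /GRing.scale /=; ring.
  apply: is_deriveM; first exact: is_derive_exp_decay.
  by apply: is_derive_sqr; exact: is_derive_moving_paraboloid.
have near_eta : \forall z \near (t0, x0), 0 < eta z.
  have : {for (t0, x0), continuous eta} by exact: moving_paraboloid_continuous.
  by move=> /cvgr_gt; apply.
have [e1 e10 e1P] : exists2 e : R, 0 < e & forall s x, `|s - t0| < e -> enorm (x - x0) < e ->
    Om x /\ 0 < eta (s, x).
  have : \forall z \near (t0, x0), Om z.2 /\ 0 < eta z.
    have OmN : \forall z \near (t0, x0), Om z.2.
      apply: (@cvg_snd _ _ _ (nbhs x0)); exact: open_nbhs_nbhs.
    exact: filterI OmN near_eta.
  move=> /nbhs_ballP[e /= e0 eP]; exists e => // s x se xe.
  apply: (eP (s, x)); rewrite -ball_normE /= prod_normE /= gt_max.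
  rewrite distrC se distrC (le_lt_trans (norm_le_enorm _)) //.
(* Only the times up to t0 compete in the minimum. *)
have vtwt : vt - wt <= 0.
  apply: (@left_min_derivative _ ((fun s => v (s, x0)) \- (fun s => w (s, x0))) t0 _
    (Num.min e1 (t0 - s0)) _ (is_deriveB dvt dwt)).
  - by rewrite lt_min e10 subr_gt0.
  - move=> s lts st /=.
    have [h1 h2] : t0 - s < e1 /\ t0 - s < t0 - s0.
      by apply/andP; rewrite -lt_min; lra.
    have [||Os es] := e1P s x0; first by rewrite distrC ger0_norm // subr_ge0.
      by rewrite subrr enorm0.
    by apply: vmin => //; [apply/andP; split; lra|exact: ltW].
have along l : dot l G = - (4 * (c * E) * P * dot y l) /\
    (c * E) * (8 * dot y l ^+ 2 - 4 * P * enorm l ^+ 2)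
      <= \sum_i \sum_j Hs i j * l 0 i * l 0 j.
  have [ex _] := exps l.
  apply: (@touching_from_above _ _ _ _ _ _ _ (e1 / (enorm l + 1)) ex).
    by rewrite divr_gt0 // ltr_wpDl ?enorm_ge0.
  move=> s; rewrite ltr_pdivlMr ?ltr_wpDl ?enorm_ge0 // => sl.
  have [||Ox ex0] := e1P t0 (x0 + s *: l); first by rewrite subrr normr0.
    rewrite addrC addKr enormZ (le_lt_trans _ sl) // ler_wpM2l //.
    by rewrite lerDl.
  have := vmin t0 (x0 + s *: l) _ Ox (ltW ex0); rewrite lexx (ltW st0) => /(_ isT).
  rewrite scale0r addr0.
  rewrite /w [(_, _).1]/= -/P -/E.
  have -> : eta (t0, x0 + s *: l) = P - 2 * s * dot y l - s ^+ 2 * enorm l ^+ 2.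
    rewrite PE /eta /moving_paraboloid /= (addrAC x0) -/y enorm_expand -/rho.
    by rewrite !opprD !addrA.
  by [].
have GE : G = (- (4 * (c * E) * P)) *: y.
  apply/eqP; rewrite -subr_eq0; apply/eqP; set D := G - _.
  have [dG _] := along D; apply: enorm_eq0; apply/eqP.
  rewrite -sqrf_eq0 sqr_enorm {2}/D dotBr dG dotZr (dotC D y); apply/eqP; ring.
(* The Hessian of the difference at the minimum. *)
pose Hp i j := Hs i j - (c * E) * (8 * (y 0 i * y 0 j) - 4 * P * (i == j)%:R).
have quad (X : 'I_n.+1 -> R) : \sum_i \sum_j (i == j)%:R * X i * X j = \sum_i X i * X i.
  apply: eq_bigr => i _; rewrite (bigD1 i) //= eqxx mul1r big1 ?addr0 // => j ji.
  by rewrite eq_sym (negbTE ji) !mul0r.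
have tr : 0 <= \sum_i \sum_j Am i j * Hp i j.
  apply: (@trace_product_ge0 R n.+1 (fun i j => Am i j)).
  - move=> xi [i xi0]; have := ell (\row_i xi i).
    rewrite (_ : \sum_i _ = qform (fun i j => Am i j) xi); last first.
      by apply: eq_bigr => i' _; apply: eq_bigr => j' _; rewrite !mxE.
    apply: lt_le_trans; rewrite mulr_gt0 // exprn_gt0 //.
    apply: (lt_le_trans _ (coord_le_enorm _ i)).
    by rewrite mxE normr_gt0.
  - move=> i j; rewrite /Hp; have [_ ->] := exps 0.
    by rewrite (mulrC (y 0 i)) eq_sym.
  - move=> xi; have [_] := along (\row_i xi i).
    rewrite -subr_ge0; congr (0 <= _).
    rewrite (_ : \sum_i \sum_j _ = \sum_i \sum_j Hs i j * xi i * xi j); last first.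
      by apply: eq_bigr => i' _; apply: eq_bigr => j' _; rewrite !mxE.
    have -> : dot y (\row_i xi i) ^+ 2 = \sum_i \sum_j y 0 i * y 0 j * xi i * xi j.
      rewrite /dot expr2 mulr_suml; apply: eq_bigr => i _.
      by rewrite mulr_sumr; apply: eq_bigr => j _; rewrite !mxE; ring.
    have -> : enorm (\row_i xi i) ^+ 2 = \sum_i \sum_j (i == j)%:R * xi i * xi j.
      by rewrite quad sqr_enorm; apply: eq_bigr => i _; rewrite !mxE.
    rewrite /qform !mulr_sumr -!sumrB mulr_sumr -sumrB; apply: eq_bigr => i _.
    rewrite !mulr_sumr -!sumrB mulr_sumr -sumrB; apply: eq_bigr => j _.
    by rewrite /Hp; ring.
have trE : \sum_i \sum_j Am i j * Hp i j = \sum_i \sum_j Am i j * Hs i j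
    - (c * E) * (8 * (\sum_i \sum_j Am i j * y 0 i * y 0 j) - 4 * P * \sum_i Am i i).
  have -> : \sum_i Am i i = \sum_i \sum_j Am i j * (i == j)%:R.
    apply: eq_bigr => i _; rewrite (bigD1 i) //= eqxx mulr1 big1 ?addr0 // => j ji.
    by rewrite eq_sym (negbTE ji) mulr0.
  rewrite !mulr_sumr -sumrB mulr_sumr -sumrB; apply: eq_bigr => i _.
  rewrite !mulr_sumr -sumrB mulr_sumr -sumrB; apply: eq_bigr => j _.
  by rewrite /Hp; ring.
rewrite trE in tr; rewrite GE dotZr in ineq.
have elly := ell y; set Q := \sum_i \sum_j Am i j * y 0 i * y 0 j in elly tr.
set TH := \sum_i \sum_j Am i j * Hs i j in tr ineq.
set TA := \sum_i Am i i in trK tr.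
have BY : dot B y <= K * r1.
  apply: (le_trans (dot_le_enorm _ _)); apply: ler_pM; rewrite ?enorm_ge0 //.
have Yd : dot y d <= r1 * W.
  by apply: (le_trans (dot_le_enorm _ _)); apply: ler_pM; rewrite ?enorm_ge0.
have rg : rho * g <= r1 * W.
  have gW' : g <= W by apply: (le_trans (ler_norm g)).
  by apply: (@le_trans _ _ (rho * W)); [rewrite ler_wpM2l // ltW|rewrite ler_wpM2r].
have P0 : 0 < P by [].
have vw' : v (t0, x0) < c * E * P ^+ 2 by [].
have poly := decay_rate_poly K L r1 W P al0 r00 rr0; rewrite -/k in poly.
set be := 8 * r1 * W + _ + _ + _ in poly.
have F1 : c * E * (8 * Q - 4 * P * TA) - 4 * (c * E) * P * dot B y - L * v (t0, x0) <= wt.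
  by lra.
have F2 : c * E * (8 * (al * enorm y ^+ 2) - 4 * P * K) - 4 * (c * E) * P * (K * r1)
    - L * (c * E * P ^+ 2) < wt.
  have A1 : c * E * (8 * (al * enorm y ^+ 2)) <= c * E * (8 * Q).
    by rewrite ler_wpM2l ?(ltW cE) //; lra.
  have cEP : 0 < c * E * P by rewrite mulr_gt0.
  have A2 : c * E * P * TA <= c * E * P * K by rewrite ler_wpM2l ?(ltW cEP).
  have A3 : c * E * P * dot B y <= c * E * P * (K * r1) by rewrite ler_wpM2l ?(ltW cEP).
  have A4 : L * v (t0, x0) < L * (c * E * P ^+ 2) by rewrite ltr_pM2l.
  by lra.
have F3 : wt <= c * E * (8 * (r1 * W) * P - k * P ^+ 2).
  have A5 : c * E * P * (rho * g + dot y d) <= c * E * P * (2 * (r1 * W)).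
    by rewrite ler_wpM2l ?mulr_ge0 ?(ltW cE) ?(ltW P0) //; lra.
  by rewrite /wt; lra.
have y2 : enorm y ^+ 2 = rho ^+ 2 - P by rewrite PE; ring.
rewrite y2 in F2.
have : 0 < c * E * ((L - k) * P ^+ 2 + be * P - 8 * al * rho ^+ 2) by rewrite /be; lra.
by rewrite pmulr_rgt0 // ltNge poly.
Qed.

(** When the point is moved inwards along [mu] by [h], the barrier increases at
    least by a fixed multiple of [h], since [mu] points out of the ball, whereas
    [v] increases at most by an arbitrarily small multiple of [h]. *)
Lemma no_boundary_touching Om mu (al K L : R) v (s0 rho0 g k c t0 : R) a d x0 :
  let eta := moving_paraboloid s0 rho0 g a d in
  let w z := c * expR (- k * (z.1 - s0)) * eta z ^+ 2 in
  supersolution Om mu al K L v ->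
  (forall t x, frontier Om x -> enorm (mu (t, x)) = 1) ->
  (forall t x, frontier Om x -> exists2 e, 0 < e &
        forall h, 0 < h -> h < e -> Om (x - h *: mu (t, x))) ->
  0 < c -> frontier Om x0 -> 0 < eta (t0, x0) ->
  0 < dot (mu (t0, x0)) (x0 - moving_center s0 a d t0) ->
  (forall x, Om x -> 0 <= eta (t0, x) ->
     v (t0, x0) - w (t0, x0) <= v (t0, x) - w (t0, x)) -> False.
Proof.
move=> eta w [_ _ obl] mu1 inward c0 fx0 eta0 mu0 vmin.
set m := mu (t0, x0) in mu0 *; pose y := x0 - moving_center s0 a d t0.
pose P := eta (t0, x0); pose E := expR (- k * (t0 - s0)).
have E0 : 0 < E by exact: expR_gt0.
pose q := dot m y; have q0 : 0 < q by [].
pose A := c * E * P * q; have A0 : 0 < A by rewrite !mulr_gt0.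
have [h0 h00 slope] := obl t0 x0 fx0 A A0.
have [e e0 inOm] := inward t0 x0 fx0.
pose h := Num.min q (Num.min h0 e) / 2.
have [hp hq hh he] : [/\ 0 < h, h <= q, h < h0 & h < e].
  rewrite /h; have : 0 < Num.min q (Num.min h0 e) by rewrite !lt_min q0 h00 e0.
  have : Num.min q (Num.min h0 e) <= q by rewrite ge_min lexx.
  have : Num.min q (Num.min h0 e) <= h0 by rewrite !ge_min lexx orbT.
  have : Num.min q (Num.min h0 e) <= e by rewrite !ge_min lexx !orbT.
  by move=> *; split; lra.
have etaE : eta (t0, x0 - h *: m) = P + 2 * h * q - h ^+ 2.
  rewrite /P /eta /moving_paraboloid /=.
  have -> : x0 - h *: m - moving_center s0 a d t0 = y + (- h) *: m.
    by apply/rowP => i; rewrite !mxE; ring.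
  rewrite enorm_expand -/y.
  by rewrite mu1 // (dotC y) -/q; ring.
have P0 : 0 < P by [].
have eta1 : P + h * q <= eta (t0, x0 - h *: m).
  by rewrite etaE; have := ler_wpM2l (ltW hp) hq; nra.
have hq0 : 0 < h * q by rewrite mulr_gt0.
have := vmin _ (inOm h hp he) _; rewrite -/m => vmin'.
have {}vmin' := vmin' (ltW (lt_le_trans (ltr_wpDr (ltW hq0) P0) eta1)).
have := slope h hp hh; rewrite -/m => sl.
have wdiff : w (t0, x0) + 2 * A * h <= w (t0, x0 - h *: m).
  rewrite /w [(_, _).1]/= -/P -/E /A.
  have : (P + h * q) ^+ 2 <= eta (t0, x0 - h *: m) ^+ 2.
    by rewrite lerXn2r ?nnegrE //; lra.
  have cE : 0 < c * E by rewrite mulr_gt0.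
  move=> /(ler_wpM2l (ltW cE)); have := mulr_ge0 (ltW cE) (sqr_ge0 (h * q)).
  by rewrite sqrrD; nra.
have : 0 < A * h by rewrite mulr_gt0.
by lra.
Qed.

(** If the bound failed, the minimum of [v] minus the barrier over the moving
    closed ball up to time [t1] would be negative. It is not attained at the
    initial time, where the barrier is at most [del], nor on the sphere, where
    the barrier vanishes, and the two preceding lemmas exclude the rest. *)
Lemma barrier Om mu (al K L : R) v (s0 sig rho0 g r0 r1 W del : R) a d :
  let eta := moving_paraboloid s0 rho0 g a d in
  let k := decay_rate al K L r0 r1 W in
  open Om -> supersolution Om mu al K L v ->
  (forall t x, frontier Om x -> enorm (mu (t, x)) = 1) ->
  (forall t x, frontier Om x -> exists2 e, 0 < e &
        forall h, 0 < h -> h < e -> Om (x - h *: mu (t, x))) ->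
  0 < al -> 0 < K -> 0 < L -> 0 < r0 -> 0 <= W -> 0 < del ->
  `|g| <= W -> enorm d <= W ->
  (forall t, s0 <= t <= s0 + sig -> r0 <= moving_radius s0 rho0 g t <= r1) ->
  (forall t x, s0 <= t <= s0 + sig -> frontier Om x ->
     enorm (x - moving_center s0 a d t) < moving_radius s0 rho0 g t ->
     0 < dot (mu (t, x)) (x - moving_center s0 a d t)) ->
  (forall z, 0 <= v z \/ ~ closure Om z.2) ->
  (forall x, closure Om x -> enorm (x - a) < rho0 -> del <= v (s0, x)) ->
  forall t x, s0 <= t <= s0 + sig -> closure Om x -> 0 < eta (t, x) ->
    del / r1 ^+ 4 * expR (- k * (t - s0)) * eta (t, x) ^+ 2 <= v (t, x).
Proof.
move=> eta k Om_open super mu1 inward al0 K0 L0 r00 W0 del0 gW dW rad obl vpos init.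
move=> t1 x1 t1I cx1 eta1.
have [s0t1 t1s] := andP t1I.
have r1p : 0 < r1 by have /andP[] := rad t1 t1I; lra.
pose c := del / r1 ^+ 4.
have c0 : 0 < c by rewrite divr_gt0 // exprn_gt0.
pose w z := c * expR (- k * (z.1 - s0)) * eta z ^+ 2.
rewrite -/(w (t1, x1)) leNgt; apply/negP => vw1.
pose Kc : set (R * V) := [set z | [/\ s0 <= z.1 <= t1, closure Om z.2 & 0 <= eta z]].
have inI t : s0 <= t <= t1 -> s0 <= t <= s0 + sig by lra.
have ball_of z : Kc z -> enorm (z.2 - a) <= r1 + sig * W.
  move=> [tI _ e0]; have /andP[rr0 rr1] := rad _ (inI _ tI).
  have yr : enorm (z.2 - moving_center s0 a d z.1) <= moving_radius s0 rho0 g z.1.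
    by apply: enorm_le_of_sqr; [lra|rewrite -subr_ge0].
  have := enormB_le z.2 (moving_center s0 a d z.1) a.
  have -> : moving_center s0 a d z.1 - a = (z.1 - s0) *: d.
    by rewrite /moving_center addrC addKr.
  rewrite enormZ ger0_norm; last by lra.
  have : (z.1 - s0) * enorm d <= sig * W.
    by apply: ler_pM; rewrite ?enorm_ge0 //; lra.
  by lra.
have ceta : continuous eta by exact: moving_paraboloid_continuous.
have cw : continuous w.
  move=> z; apply: cvgM; last first.
    exact: (cvgM (ceta z) (ceta z)).
  apply: cvgM; first exact: cvg_cst.
  apply: (@continuous_comp _ _ _ (fun z : R * V => - k * (z.1 - s0)) expR).
    apply: cvgM; first exact: cvg_cst.
    by apply: cvgB; [exact: cvg_fst|exact: cvg_cst].
  exact: continuous_expR.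
have cK : compact Kc.
  apply: (@subclosed_compact _ _ (`[s0, t1]%classic `*` [set y | enorm (y - a) <= r1 + sig * W])).
  - have -> : Kc = (fst @^-1` `[s0, t1]) `&` (snd @^-1` closure Om) `&` (eta @^-1` [set e | 0 <= e]).
      by apply/seteqP; split=> [z [? ? ?]|z [[]]] /=; rewrite ?in_itv //=; split.
    apply: closedI; [apply: closedI|]; apply: closed_comp.
    + by move=> z _; exact: cvg_fst.
    + exact: itv_closed.
    + by move=> z _; exact: cvg_snd.
    + exact: closed_closure.
    + by move=> z _; exact: ceta.
    + exact: closed_ge.
  - by apply: compact_setX; [exact: segment_compact|exact: closed_eball_compact].
  - by move=> z Kz; split; [case: Kz => /=; rewrite in_itv|exact: ball_of].
have K1 : Kc (t1, x1) by split => //=; [rewrite s0t1 lexx|exact: ltW].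
have [vcont _ _] := super.
have gcont : {within Kc, continuous (v \- w)}.
  have vK : {within Kc, continuous v}.
    by apply: continuous_subspaceW vcont => z [_ cz _]; split.
  by move=> z; apply: cvgB; [exact: vK|exact: (continuous_subspaceT cw)].
have [[t0 x0]] := compact_EVT_min (ex_intro _ _ K1) cK gcont.
rewrite inE => -[/= t0I cx0 eta0] gmin.
have {}gmin z : Kc z -> v (t0, x0) - w (t0, x0) <= v z - w z.
  by move=> Kz; apply: gmin; rewrite inE.
have vw0 : v (t0, x0) < w (t0, x0).
  by have := gmin _ K1; rewrite /= in vw1 *; lra.
have v0 : 0 <= v (t0, x0) by case: (vpos (t0, x0)).
have {}eta0 : 0 < eta (t0, x0).
  rewrite lt_def eta0 andbT; apply/eqP => e0.
  by move: vw0; rewrite /w e0 expr0n mulr0 ltNge v0.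
have [s0t0 t0t1] := andP t0I.
have st0 : s0 < t0.
  rewrite lt_def s0t0 andbT; apply/eqP => t0E; move: vw0; apply/negP; rewrite -leNgt.
  have radE : moving_radius s0 rho0 g s0 = rho0 by rewrite /moving_radius subrr mul0r addr0.
  have cenE : moving_center s0 a d s0 = a by rewrite /moving_center subrr scale0r addr0.
  have /andP[rr0 rr1] : r0 <= rho0 <= r1.
    by rewrite -radE; apply: rad; lra.
  rewrite /w t0E /= subrr mulr0 expR0 mulr1.
  have etaE : eta (s0, x0) = rho0 ^+ 2 - enorm (x0 - a) ^+ 2.
    by rewrite /eta /moving_paraboloid /= radE cenE.
  apply: (@le_trans _ _ del).
    have e2 : eta (s0, x0) ^+ 2 <= r1 ^+ 4.
      rewrite (_ : r1 ^+ 4 = (r1 ^+ 2) ^+ 2); last by rewrite -exprM.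
      rewrite lerXn2r ?nnegrE ?sqr_ge0 //; first by rewrite -t0E ltW.
      rewrite etaE; have := sqr_ge0 (enorm (x0 - a)).
      have : rho0 ^+ 2 <= r1 ^+ 2 by rewrite lerXn2r ?nnegrE //; lra.
      by lra.
    apply: (le_trans (ler_wpM2l (ltW c0) e2)).
    by rewrite /c divfK // expf_neq0 // gt_eqF.
  apply: init => //; apply: enorm_lt_of_sqr; first by lra.
  by rewrite -subr_gt0 -etaE -t0E.
have [Ox0|fx0] := closure_cases Om_open cx0.
  apply: (@no_interior_touching Om mu al K L v s0 rho0 g r0 r1 W c t0 a d x0) => //.
    by apply: rad; lra.
  move=> t x tI Ox ex; apply: gmin; split => //=; first lra.
  exact: subset_closure.
apply: (@no_boundary_touching Om mu al K L v s0 rho0 g k c t0 a d x0) => //.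
  apply: obl => //; first lra.
  have /andP[rr0 _] := rad _ (inI _ t0I).
  by apply: enorm_lt_of_sqr; [lra|rewrite -subr_gt0].
move=> x Ox ex; apply: gmin; split => //=.
exact: subset_closure.
Qed.

End Barrier.

(** * Classical solutions and their linearization *)

Lemma within_comp {T U W : topologicalType} (A : set T) (B : set U)
    (g : T -> U) (f : U -> W) : {within A, continuous g} ->
  (forall x, A x -> B (g x)) -> {within B, continuous f} ->
  {within A, continuous (f \o g)}.
Proof.
move=> /subspace_continuousP cg AB /subspace_continuousP cf.
apply/subspace_continuousP => x Ax P /(cf _ (AB _ Ax)) fP.
have N : nbhs x (fun y => A y -> B (g y) -> P (f (g y))) := cg x Ax _ fP.
have N' : nbhs x (fun y => A y -> P (f (g y))).
  by apply: filterS N => y Ny Ay; exact: (Ny Ay (AB y Ay)).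
exact: N'.
Qed.

Lemma within_open_continuous {T U : topologicalType} (A : set T) (f : T -> U) x :
  open A -> {within A, continuous f} -> A x -> {for x, continuous f}.
Proof.
by move=> oA; rewrite continuous_open_subspace // => cf Ax; apply: cf; rewrite inE.
Qed.

Lemma pair_continuous {T U : topologicalType} (t : T) :
  continuous (fun x : U => (t, x)).
Proof.
move=> x B [[B1 B2] /= [nB1 nB2] sB]; apply: filterS nB2 => y B2y.
by apply: sB; split => //=; exact: nbhs_singleton nB1.
Qed.

Section Slices.
Context {R : realType}.
Context {V W : normedModType R}.

Lemma slice_quotient (F : R * V -> W) t x l :
  (fun h : R => h^-1 *: ((F \o shift (t, x)) (h *: (0, l)) - F (t, x))) =
  (fun h : R => h^-1 *: (((fun y => F (t, y)) \o shift x) (h *: l) - F (t, x))).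
Proof.
apply/funext => h /=; congr (_ *: (F _ - _)).
by rewrite -[LHS]/(h *: 0 + t, h *: l + x) scaler0 add0r.
Qed.

Lemma derive_slice (F : R * V -> W) t x l :
  'D_l (fun y => F (t, y)) x = 'D_((0, l) : R * V) F (t, x).
Proof. by rewrite /derive slice_quotient. Qed.

Lemma derivable_slice (F : R * V -> W) t x l :
  derivable F (t, x) ((0, l) : R * V) -> derivable (fun y => F (t, y)) x l.
Proof. by rewrite /derivable slice_quotient. Qed.

Lemma is_derive_time (F : R * V -> W) (t : R) x :
  derivable F (t, x) ((1, 0) : R * V) ->
  is_derive t 1 (fun s => F (s, x)) ('D_((1, 0) : R * V) F (t, x)).
Proof.
have E : (fun h : R => h^-1 *: ((F \o shift (t, x)) (h *: (1, 0)) - F (t, x))) =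
    (fun h : R => h^-1 *: (((fun s => F (s, x)) \o shift t) (h *: 1) - F (t, x))).
  apply/funext => h /=; congr (_ *: (F _ - _)).
  by rewrite -[LHS]/(h *: 1 + t, h *: 0 + x) scaler0 add0r.
by rewrite /derivable /derive E => d; split.
Qed.

Lemma slice_continuous (U : topologicalType) (F : R * V -> U) t x :
  {for (t, x), continuous F} -> {for x, continuous (fun y => F (t, y))}.
Proof.
move=> cF; apply: (@continuous_comp _ _ _ (fun y => (t, y)) F); last exact: cF.
exact: pair_continuous.
Qed.

End Slices.

Lemma is_deriveMl {R : realType} (F : R -> R) (k s c : R) :
  is_derive s 1 F c -> is_derive s 1 (fun r => k * F r) (k * c).
Proof. by move=> dF; exact: (@is_deriveZ _ _ _ F k). Qed.

Section SecondOrder.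
Context {R : realType} {m : nat}.
Implicit Types (f : 'rV[R]_m -> R) (x l : 'rV[R]_m).
Notation e i := (basis_vec i).

Lemma open_line (O : set 'rV[R]_m) x l : open O -> O x ->
  exists2 d : R, 0 < d & forall s, `|s| < d -> O (x + s *: l).
Proof.
move=> oO Ox; have /nbhs_ballP[r /= r0 rP] : nbhs x O by exact: open_nbhs_nbhs.
have l1 : 0 < `|l| + 1 by rewrite ltr_wpDl.
exists (r / (`|l| + 1)) => [|s]; first by rewrite divr_gt0.
rewrite ltr_pdivlMr // => sl; apply: rP; rewrite -ball_normE /=.
rewrite opprD addrA subrr add0r normrN normrZ (le_lt_trans _ sl) //.
by rewrite ler_wpM2l // lerDl.
Qed.

Lemma derivatives_along_line (O : set 'rV[R]_m) f x l : open O -> O x ->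
  (forall y i, O y -> derivable f y (e i)) ->
  (forall y i, O y -> {for y, continuous ('D_(e i) f)}) ->
  (forall y i j, O y -> derivable ('D_(e j) f) y (e i)) ->
  (forall y i j, O y -> {for y, continuous ('D_(e i) ('D_(e j) f))}) ->
  derivatives_at_0 (fun s => f (x + s *: l)) (\sum_i l 0 i * 'D_(e i) f x)
    (\sum_i \sum_j 'D_(e i) ('D_(e j) f) x * l 0 i * l 0 j).
Proof.
move=> oO Ox df cdf ddf cddf; have [d d0 dP] := open_line l oO Ox.
have nearO y : O y -> \forall z \near y, O z by move=> Oy; exact: open_nbhs_nbhs.
exists d, (fun s => \sum_i l 0 i * 'D_(e i) f (x + s *: l)); split => //.
- move=> s /dP Os; apply/(is_derive_line f x l s).
  apply: is_derive_partials; last by move=> i; exact: cdf.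
  by apply: filterS (nearO _ Os) => y Oy i; exact: df.
- by rewrite scale0r addr0.
- have -> : (fun s => \sum_i l 0 i * 'D_(e i) f (x + s *: l)) =
      \sum_i (fun s => l 0 i * 'D_(e i) f (x + s *: l)).
    by apply/funext => s; rewrite fct_sumE.
  rewrite exchange_big /=.
  have -> : \sum_j \sum_i 'D_(e i) ('D_(e j) f) x * l 0 i * l 0 j =
      \sum_j l 0 j * \sum_i l 0 i * 'D_(e i) ('D_(e j) f) x.
    apply: eq_bigr => j _; rewrite mulr_sumr; apply: eq_bigr => i _.
    by ring.
  apply: is_derive_sum => j.
  apply: is_deriveMl.
  apply: (is_derive_line0 ('D_(e j) f) x l _).1.
  apply: is_derive_partials; last by move=> i; exact: cddf.
  by apply: filterS (nearO _ Ox) => y Oy i; exact: ddf.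
Qed.

Lemma schwarz_open (O : set 'rV[R]_m) f x i j : open O -> O x ->
  (forall y i, O y -> derivable f y (e i)) ->
  (forall y i j, O y -> derivable ('D_(e j) f) y (e i)) ->
  (forall y i j, O y -> {for y, continuous ('D_(e i) ('D_(e j) f))}) ->
  'D_(e i) ('D_(e j) f) x = 'D_(e j) ('D_(e i) f) x.
Proof.
move=> oO Ox df ddf cddf; apply: schwarz; [|exact: cddf|exact: cddf].
have nearO : \forall z \near x, O z by exact: open_nbhs_nbhs.
by apply: filterS nearO => y Oy; split; [exact: df|exact: df|exact: ddf|exact: ddf].
Qed.

Lemma derivatives_at_0_affine (F : R -> R) (c1 c2 sg p : R) :
  derivatives_at_0 F c1 c2 ->
  derivatives_at_0 (fun s => sg * (F s - p)) (sg * c1) (sg * c2).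
Proof.
move=> [d [f1 [d0 dF f10 df1]]]; exists d, (fun s => sg * f1 s); split => //.
- move=> s sd; apply: is_deriveMl.
  rewrite -[f1 s]subr0; apply: is_deriveB; exact: dF.
- by rewrite f10.
- exact: is_deriveMl.
Qed.

End SecondOrder.

Section ClassicalSolutions.
Context {R : realType} {n : nat}.
Notation V := 'rV[R]_n.+1.
Variables (Om : set V) (A : R * V -> 'M[R]_n.+1) (q : R * V -> V)
  (f : R * V -> R -> R) (mu : R * V -> V) (u : R * V -> R).
Hypotheses (Om_open : open Om) (u_sol : classical_solution Om A q f mu u).

Let Q : set (R * V) := setT `*` Om.

Lemma open_cylinder : open Q.
Proof.
have -> : Q = snd @^-1` Om by apply/seteqP; split=> [z []|z Oz].
by apply: open_comp => // z _; exact: cvg_snd.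
Qed.

Lemma gradient_continuous t x i : Om x -> {for (t, x), continuous ('D_(e_x i) u)}.
Proof.
move=> Ox; have [_ _ _ _ [Du [Duc Dug _]]] := u_sol.
apply: (within_open_continuous open_cylinder); last by split.
have cD : {within Q, continuous (fun z => Du z 0 i)}.
  apply: (within_comp (A := Q) (B := setT) (g := Du) (f := fun M : V => M 0 i)) => //.
    by apply: continuous_subspaceW Duc => z [_ Oz]; split => //; exact: subset_closure.
  by apply: continuous_subspaceT; exact: coord_continuous.
apply: subspace_eq_continuous cD => z; rewrite inE => Qz.
by rewrite /from_subspace /= Dug // mxE.
Qed.

Lemma slice_derivatives t : [/\ forall y i, Om y -> derivable (fun y => u (t, y)) y (basis_vec i),
  forall y i, Om y -> {for y, continuous ('D_(basis_vec i) (fun y => u (t, y)))},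
  forall y i j, Om y -> derivable ('D_(basis_vec j) (fun y => u (t, y))) y (basis_vec i) &
  forall y i j, Om y ->
    {for y, continuous ('D_(basis_vec i) ('D_(basis_vec j) (fun y => u (t, y))))}].
Proof.
have [_ _ [ux uxx] _ _] := u_sol.
have E1 j : 'D_(basis_vec j) (fun y => u (t, y)) = fun y => 'D_(e_x j) u (t, y).
  by apply/funext => y; rewrite derive_slice.
have E2 i j : 'D_(basis_vec i) ('D_(basis_vec j) (fun y => u (t, y))) =
    fun y => 'D_(e_x i) ('D_(e_x j) u) (t, y).
  by apply/funext => y; rewrite E1; exact: (derive_slice ('D_(e_x j) u)).
split.
- by move=> y i Oy; apply: derivable_slice; apply: ux; split.
- by move=> y i Oy; rewrite E1; exact: (slice_continuous (@gradient_continuous t y i Oy)).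
- by move=> y i j Oy; rewrite E1; apply: (derivable_slice (F := 'D_(e_x j) u)); apply: (uxx i j).1; split.
- move=> y i j Oy; rewrite E2; apply: (slice_continuous (F := 'D_(e_x i) ('D_(e_x j) u))).
  by apply: (within_open_continuous open_cylinder (uxx i j).2); split.
Qed.

Definition hessian (z : R * V) : 'M[R]_n.+1 :=
  \matrix_(i, j) 'D_(e_x i) ('D_(e_x j) u) z.

Lemma slice_hessian t x i j :
  'D_(basis_vec i) ('D_(basis_vec j) (fun y => u (t, y))) x = hessian (t, x) i j.
Proof.
have E1 : 'D_(basis_vec j) (fun y => u (t, y)) = fun y => 'D_(e_x j) u (t, y).
  by apply/funext => y; rewrite derive_slice.
by rewrite E1 mxE; exact: (derive_slice ('D_(e_x j) u)).
Qed.

Lemma hessian_sym t x i j : Om x -> hessian (t, x) i j = hessian (t, x) j i.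
Proof.
move=> Ox; have [df _ ddf cddf] := slice_derivatives t.
by rewrite -!slice_hessian; exact: (schwarz_open _ _ Om_open Ox df ddf cddf).
Qed.

Lemma solution_along_line t x l : Om x ->
  derivatives_at_0 (fun s => u (t, x + s *: l)) (dot l (grad u (t, x)))
    (\sum_i \sum_j hessian (t, x) i j * l 0 i * l 0 j).
Proof.
move=> Ox; have [df cdf ddf cddf] := slice_derivatives t.
have := derivatives_along_line l Om_open Ox df cdf ddf cddf.
rewrite (_ : \sum_i _ = dot l (grad u (t, x))); last first.
  by apply: eq_bigr => i _; rewrite mxE derive_slice.
rewrite (_ : \sum_i \sum_j _ = \sum_i \sum_j hessian (t, x) i j * l 0 i * l 0 j) //.
by apply: eq_bigr => i _; apply: eq_bigr => j _; rewrite slice_hessian.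
Qed.

Lemma div_A_gradE z : Q z -> (forall i, derivable A z (e_x i)) ->
  div_A_grad A u z = \sum_i \sum_j A z i j * hessian z i j +
    \sum_i \sum_j 'D_(e_x j) u z * 'D_(e_x i) A z i j.
Proof.
move=> Qz dA; rewrite -big_split /=; apply: eq_bigr => i _.
rewrite -big_split /=.
have -> : (fun w => \sum_j A w i j * 'D_(e_x j) u w) =
    \sum_j ((fun w => A w i j) * 'D_(e_x j) u).
  by apply/funext => w; rewrite fct_sumE.
have [_ _ [_ uxx] _ _] := u_sol.
apply: derive_val; apply: is_derive_sum => j.
have -> : A z i j * hessian z i j + 'D_(e_x j) u z * 'D_(e_x i) A z i j =
    A z i j *: 'D_(e_x i) ('D_(e_x j) u) z + 'D_(e_x j) u z *: 'D_(e_x i) (fun w => A w i j) z.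
  by rewrite mxE (derive_mx (dA i)) mxE.
apply: is_deriveM; apply: derivable_is_derive.
  by move: (dA i) => /derivable_mxP/(_ i j).
by apply: (uxx i j).1.
Qed.

(** The gradient is continuous up to the boundary, so the oblique boundary
    condition makes [u] vary to first order only along [mu]. *)
Lemma oblique_flatness t x : enorm (mu (t, x)) = 1 -> frontier Om x ->
  (exists2 e : R, 0 < e & forall h, 0 < h -> h < e -> Om (x - h *: mu (t, x))) ->
  forall e : R, 0 < e -> exists2 h0 : R, 0 < h0 &
    forall h, 0 < h -> h < h0 -> `|u (t, x - h *: mu (t, x)) - u (t, x)| <= e * h.
Proof.
move=> m1 fx [e1 e10 inOm] e e0; set m := mu (t, x) in m1 inOm *.
have [uc _ _ _ [Du [Duc Dug Dub]]] := u_sol.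
have cx : closure Om x by case: fx.
pose N : R := n.+1%:R; have N0 : 0 < N by rewrite ltr0n.
have : \forall z \near (t, x), (setT `*` closure Om) z -> `|Du (t, x) - Du z| < e / N.
  move: Duc => /subspace_continuousP/(_ (t, x) (conj I cx)) /cvgrPdist_lt.
  by apply; rewrite divr_gt0.
move=> /nbhs_ballP[r /= r0 rP].
exists (Num.min e1 r) => [|h h0]; first by rewrite lt_min e10 r0.
rewrite lt_min => /andP[he1 hr].
have shift s : x + s *: - m = x - s *: m by rewrite scalerN.
have inO s : 0 < s -> s <= h -> Om (x + s *: - m).
  by move=> s0 sh; rewrite shift; apply: inOm => //; exact: le_lt_trans he1.
have [df cdf _ _] := slice_derivatives t.
have dF (s : R) : 0 < s -> s <= h ->
    is_derive s 1 (fun s => u (t, x + s *: - m)) (- dot m (Du (t, x + s *: - m))).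
  move=> s0 sh; have Os := inO s s0 sh.
  apply/(is_derive_line (fun y => u (t, y)) x (- m) s).
  have -> : - dot m (Du (t, x + s *: - m)) =
      \sum_i (- m) 0 i * 'D_(basis_vec i) (fun y => u (t, y)) (x + s *: - m).
    rewrite -dotNl Dug; last by split.
    by apply: eq_bigr => i _; rewrite !mxE derive_slice.
  apply: is_derive_partials; last by move=> i; exact: cdf.
  have nO : \forall z \near (x + s *: - m), Om z by exact: open_nbhs_nbhs.
  by apply: filterS nO => y Oy i; exact: df.
have cF : {within `[0, h], continuous (fun s => u (t, x + s *: - m))}.
  apply: (within_comp (A := `[0, h]) (B := setT `*` closure Om) (g := fun s => (t, x + s *: - m)) (f := u)).
  - apply: continuous_subspaceT => s.
    apply: (@continuous_comp _ _ _ (fun s : R => x + s *: - m) (fun y => (t, y))).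
      apply: cvgD; first exact: cvg_cst.
      by apply: cvgZ; [exact: cvg_id|exact: cvg_cst].
    exact: pair_continuous.
  - move=> s; rewrite /= in_itv /= => /andP[s0 sh]; split => //=.
    move: s0; rewrite le_eqVlt => /predU1P[<-|s0]; first by rewrite scale0r addr0.
    by apply: subset_closure; exact: inO.
  - exact: uc.
have [||s] := @MVT _ (fun s => u (t, x + s *: - m)) (fun s => - dot m (Du (t, x + s *: - m))) 0 h h0.
- by move=> s; rewrite in_itv /= => /andP[s0 /ltW sh]; exact: dF.
- exact: cF.
rewrite in_itv /= => /andP[s0 sh]; rewrite subr0 scale0r addr0 shift => ->.
rewrite normrM (gtr0_norm h0) ler_wpM2r ?(ltW h0) // normrN.
have -> : dot m (Du (t, x + s *: - m)) = dot m (Du (t, x + s *: - m) - Du (t, x)).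
  by rewrite dotBr Dub // subr0.
apply: (le_trans (norm_dot_le _ _)); rewrite m1 mul1r.
apply: (le_trans (enorm_le_norm _)); rewrite -/N mulrC -ler_pdivlMr // distrC ltW //.
apply: (rP (t, x + s *: - m)); last first.
  by split => //=; apply: subset_closure; apply: inO => //; exact: ltW.
rewrite -ball_normE /= prod_normE /= subrr normr0 gt_max r0 /=.
rewrite opprD addrA subrr add0r normrN normrZ normrN (gtr0_norm s0).
apply: le_lt_trans (lt_trans sh hr); rewrite ler_piMr ?(ltW s0) //.
by rewrite -m1 norm_le_enorm.
Qed.

End ClassicalSolutions.

Section Linearization.
Context {R : realType} {n : nat}.
Notation V := 'rV[R]_n.+1.

Lemma constant_solution_source (Om : set V) A q f mu (p : R) t x :
  classical_solution Om A q f mu (fun=> p) -> Om x -> f (t, x) p = 0.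
Proof.
move=> [_ _ _ /(_ (t, x)) eqn _] Ox; have := eqn (conj I Ox).
have D0 (l z : R * V) : 'D_l (fun=> p) z = 0 := derive_cst p z l.
rewrite (_ : 'D_e_t _ _ = 0); last exact: D0.
rewrite (_ : div_A_grad _ _ _ = 0); last first.
  rewrite /div_A_grad; apply: big1 => i _.
  rewrite (_ : (fun w => _) = cst 0); first exact: derive_cst.
  by apply/funext => w; apply: big1 => j _; rewrite (_ : 'D_(e_x j) _ _ = 0) ?mulr0; [|exact: D0].
rewrite (_ : grad _ _ = 0); last by apply/rowP => i; rewrite !mxE; exact: D0.
by rewrite dotC dot0l !add0r.
Qed.

(** The difference with a constant solution solves a linear equation, whose
    zeroth order coefficient is bounded since [f] is Lipschitz in [u]. *)
Lemma supersolution_of_solution (b : R) (Om : set V) A q f mu (u : R * V -> R) (p : R) :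
  open Om -> coefficient_conditions b Om A q f ->
  (forall t x, frontier Om x -> enorm (mu (t, x)) = 1) ->
  (forall t x, frontier Om x -> exists2 e, 0 < e &
        forall h, 0 < h -> h < e -> Om (x - h *: mu (t, x))) ->
  classical_solution Om A q f mu (fun=> p) -> classical_solution Om A q f mu u ->
  (exists M, forall t x, closure Om x -> `|u (t, x)| <= M) ->
  exists al K L : R, [/\ 0 < al, 0 < K, 0 < L & forall sg : R, `|sg| = 1 ->
    (forall t x, closure Om x -> 0 <= sg * (u (t, x) - p)) ->
    supersolution Om mu al K L (fun z => sg * (u z - p))].
Proof.
move=> Om_open [[M [_ [AM A1]]] [al [a2 [al0 _ ell]]] [Mq [qM _]] _ lip] mu1 inward p_sol u_sol [Mu uM].
have [L0 lipL] := lip (Num.max Mu `|p|).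
pose N : R := n.+1%:R; have N1 : 1 <= N by rewrite ler1n.
pose K := N * (N * `|M| + `|Mq|) + N * `|M| + 1.
have NM : 0 <= N * `|M| by rewrite mulr_ge0 //; lra.
have NMq : 0 <= N * `|M| + `|Mq| by rewrite addr_ge0.
have sumN (F : 'I_n.+1 -> R) (c : R) : (forall i, F i <= c) -> \sum_i F i <= N * c.
  move=> Fc; rewrite (_ : N * c = \sum_(i < n.+1) c); first exact: ler_sum.
  by rewrite sumr_const card_ord -[RHS]mulr_natl.
exists al, K, (`|L0| + 1); split => //.
- by rewrite /K ltr_wpDl // addr_ge0 // mulr_ge0 //; lra.
move=> sg sg1 vpos; split.
- have [uc _ _ _ _] := u_sol.
  move=> z; apply: cvgM; first exact: cvg_cst.
  by apply: cvgB; [exact: uc|exact: cvg_cst].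
- move=> t x Ox; pose z := (t, x); have Qz : (setT `*` Om) z by split.
  have cx : closure Om x by exact: subset_closure.
  have e1 i : `|e_x i : R * V| <= 1.
    by rewrite prod_normE /= normr0 ge_max ler01 norm_basis_vec.
  have dA i : derivable A z (e_x i) by have [+ _] := A1 _ (e1 i); apply.
  have entry (X : 'M[R]_n.+1) i j : `|X i j| <= `|X|.
    rewrite [leRHS]/Num.Def.normr/= mx_normrE.
    exact: (le_bigmax _ (fun ij => `|X ij.1 ij.2|) (i, j)).
  have [_ [ut _] _ eqn _] := u_sol.
  have hE i j : (sg *: hessian u z) i j = sg * hessian u z i j by rewrite mxE.
  exists (sg * 'D_e_t u z), (sg *: grad u z), (sg *: hessian u z), (A z),
    (\row_j (\sum_i 'D_(e_x i) A z i j + q z 0 j)); split.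
  + apply: is_deriveMl.
    rewrite -['D_e_t u z]subr0; apply: is_deriveB; apply: is_derive_time; exact: ut.
  + move=> l; split; last first.
      by move=> i j; rewrite [LHS]mxE [RHS]mxE (hessian_sym Om_open u_sol t i j Ox).
    have := derivatives_at_0_affine sg p (solution_along_line Om_open u_sol t l Ox).
    rewrite dotZr (_ : sg * \sum_i _ = \sum_i \sum_j (sg *: hessian u z) i j * l 0 i * l 0 j) //.
    rewrite mulr_sumr; apply: eq_bigr => i _; rewrite mulr_sumr.
    by apply: eq_bigr => j _; rewrite hE; ring.
  + by move=> xi; have /andP[] := ell t x xi cx.
  + split.
      apply: (@le_trans _ _ (N * `|M|)); last by rewrite /K; have := mulr_ge0 (le_trans ler01 N1) NMq; lra.
      apply: sumN => i; apply: (le_trans (ler_norm _)); apply: (le_trans (entry _ _ _)).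
      by apply: (le_trans (AM z Qz)); exact: ler_norm.
    apply: (le_trans (enorm_le_norm _)); rewrite -/N.
    apply: (@le_trans _ _ (N * (N * `|M| + `|Mq|))); last by rewrite /K; lra.
    rewrite ler_wpM2l ?(le_trans ler01 N1) //.
    apply: norm_le_coords => // j; rewrite mxE; apply: (le_trans (ler_normD _ _)).
    apply: lerD.
      apply: (le_trans (ler_norm_sum _ _ _)); apply: sumN => i.
      apply: (le_trans (entry _ _ _)); have [_ [bd _]] := A1 _ (e1 i).
      by apply: (le_trans (bd z Qz)); exact: ler_norm.
    apply: (le_trans (coord_le_norm _ _)); apply: (le_trans (qM z _)); last exact: ler_norm.
    by split.
  + rewrite (eqn z Qz) (div_A_gradE u_sol Qz dA) !mulrDr.
    rewrite (_ : \sum_i \sum_j A z i j * (sg *: hessian u z) i j =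
        sg * \sum_i \sum_j A z i j * hessian u z i j); last first.
      rewrite mulr_sumr; apply: eq_bigr => i _; rewrite mulr_sumr.
      by apply: eq_bigr => j _; rewrite hE; ring.
    rewrite dotZr (_ : dot (\row_j _) (grad u z) =
        \sum_i \sum_j 'D_(e_x j) u z * 'D_(e_x i) A z i j + dot (q z) (grad u z)); last first.
      rewrite exchange_big /dot -big_split /=; apply: eq_bigr => j _.
      by rewrite !mxE mulrDl mulr_suml; congr (_ + _); apply: eq_bigr => i _; rewrite mulrC.
    rewrite mulrDr !addrA lerD2l.
    have fb : `|f z (u z)| <= (`|L0| + 1) * (sg * (u z - p)).
      have := lipL t x (u z) p cx; rewrite (constant_solution_source t p_sol Ox) subr0.
      rewrite !le_max uM // lexx orbT => /(_ isT isT) h; apply: (le_trans h).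
      have -> : `|u z - p| = sg * (u z - p).
        by rewrite -[RHS]ger0_norm ?vpos // normrM sg1 mul1r.
      by rewrite ler_wpM2r ?vpos // (le_trans (ler_norm L0)) // lerDl.
    have h : `|sg * f z (u z)| = `|f z (u z)| by rewrite normrM sg1 mul1r.
    have := ler_norm (- (sg * f z (u z))); rewrite normrN h => h'.
    by have := le_trans h' fb; rewrite -/z !mulrDr; lra.
- move=> t x fx e e0.
  have [h0 h00 h0P] := oblique_flatness Om_open u_sol (mu1 t x fx) fx (inward t x fx) e0.
  exists h0 => // h hp hh; have := h0P h hp hh.
  set U := u (t, x - _); set U0 := u (t, x) => UU.
  have : `|sg * (U - U0)| <= e * h by rewrite normrM sg1 mul1r.
  by rewrite ler_norml => /andP[_]; lra.
Qed.

End Linearization.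

(** * Propagation of positivity *)

Section Propagation.
Context {R : realType} {n : nat}.
Notation V := 'rV[R]_n.+1.
Variables (Om : set V) (mu : R * V -> V) (H k al K L : R) (v : R * V -> R).
Hypotheses (Om_open : open Om) (geom : ball_geometry Om mu H k)
  (H_gt0 : 0 < H) (k_int : 0 < k <= 1)
  (mu_unit : forall t x, frontier Om x -> enorm (mu (t, x)) = 1)
  (al_gt0 : 0 < al) (K_gt0 : 0 < K) (L_gt0 : 0 < L)
  (v_super : supersolution Om mu al K L v)
  (v_ge0 : forall t x, closure Om x -> 0 <= v (t, x)).
Implicit Types (s t sig del : R) (a p x y z : V).

Lemma mu_inward t x : frontier Om x -> exists2 e, 0 < e &
  forall h, 0 < h -> h < e -> Om (x - h *: mu (t, x)).
Proof. by have [_ _ _ inward _] := geom; exact: inward. Qed.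

Lemma v_ge0_or (z : R * V) : 0 <= v z \/ ~ closure Om z.2.
Proof.
by case: z => t x; have [/v_ge0|] := pselect (closure Om x); [left|right].
Qed.

(** The barrier lives on a ball with fixed centre [a] whose radius grows from
    that of the small ball to [(1 + k) * H]; [ball_geometry] makes [mu] point out
    of it wherever it meets the boundary. *)
Lemma positivity_expands sig : 0 < sig -> exists2 th : R, 0 < th &
  forall s a del, 0 < del -> eball a H `<=` Om ->
    (forall x, enorm (x - a) < k * H / 16 -> del <= v (s, x)) ->
    forall x, closure Om x -> enorm (x - a) <= (1 + k / 2) * H ->
    th * del <= v (s + sig, x).
Proof.
move=> sig0; have /andP[k0 k1] := k_int; have Hp := H_gt0; have kH : 0 < k * H by rewrite mulr_gt0.
pose r0 := k * H / 16; pose r1 := (1 + k) * H; pose W := 2 * H / sig.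
have r00 : 0 < r0 by rewrite divr_gt0.
have r10 : 0 < r1 by rewrite mulr_gt0 //; lra.
have r01 : r0 < r1 by rewrite /r0 /r1; lra.
have W0 : 0 <= W by rewrite /W divr_ge0 ?mulr_ge0 // ltW.
pose g := (r1 - r0) / sig.
have g0 : 0 < g by rewrite divr_gt0 // subr_gt0.
have gW : `|g| <= W.
  by rewrite gtr0_norm // /g /W ler_pM2r ?invr_gt0 // /r0 /r1; nra.
have gs : sig * g = r1 - r0 by rewrite /g mulrC divfK // gt_eqF.
pose th := (r1 ^+ 4)^-1 * expR (- decay_rate al K L r0 r1 W * sig) * (k * H ^+ 2) ^+ 2.
exists th => [|s a del del0 aO init x cx xa].
  by rewrite !mulr_gt0 ?invr_gt0 ?exprn_gt0 ?expR_gt0 // mulr_gt0 // exprn_gt0.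
have rad t : s <= t <= s + sig -> r0 <= moving_radius s r0 g t <= r1.
  move=> tI; rewrite /moving_radius; have : 0 <= (t - s) * g by rewrite mulr_ge0 //; lra.
  have : (t - s) * g <= sig * g by rewrite ler_wpM2r ?(ltW g0) //; lra.
  by rewrite gs; lra.
have cen t : moving_center s a 0 t = a by rewrite /moving_center scaler0 addr0.
have [_ _ obl _ _] := geom.
have := @barrier R n Om mu al K L v s sig r0 g r0 r1 W del a 0.
move=> /(_ Om_open v_super mu_unit mu_inward al_gt0 K_gt0 L_gt0 r00 W0 del0 gW).
rewrite enorm0 => /(_ W0 rad) bar.
have etaE : k * H ^+ 2 <= moving_paraboloid s r0 g a 0 (s + sig, x).
  rewrite /moving_paraboloid /= cen /moving_radius (_ : s + sig - s = sig); last by ring.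
  rewrite gs (_ : r0 + (r1 - r0) = r1); last by ring.
  have : enorm (x - a) ^+ 2 <= ((1 + k / 2) * H) ^+ 2.
    by rewrite lerXn2r ?nnegrE ?enorm_ge0 // mulr_ge0 ?ltW //; lra.
  have : 0 < k * H ^+ 2 by rewrite mulr_gt0 // exprn_gt0.
  have := mulr_ge0 (sqr_ge0 k) (sqr_ge0 H); rewrite /r1; nra.
have kH2 : 0 < k * H ^+ 2 by rewrite mulr_gt0 // exprn_gt0.
apply: le_trans (bar _ v_ge0_or _ (s + sig) x _ cx _).
- rewrite /th (_ : s + sig - s = sig); last by ring.
  rewrite (_ : _ * del = del / r1 ^+ 4 * expR (- decay_rate al K L r0 r1 W * sig) * (k * H ^+ 2) ^+ 2); last by ring.
  rewrite ler_wpM2l //; last by rewrite lerXn2r ?nnegrE ?(ltW kH2) ?(le_trans (ltW kH2) etaE).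
  by rewrite mulr_ge0 ?expR_ge0 // divr_ge0 ?ltW // exprn_gt0.
- move=> t y tI fy; rewrite cen => ya; apply: obl => //.
  by apply: (le_trans (ltW ya)); have /andP[] := rad t tI.
- by move=> y cy ya; exact: init.
- by apply/andP; split; lra.
- exact: lt_le_trans etaE.
Qed.

(** The barrier lives on a small ball that moves from [p] to [a] inside the
    interior ball, and so never meets the boundary. *)
Lemma positivity_moves sig : 0 < sig -> exists2 th : R, 0 < th &
  forall s p a del, 0 < del -> eball a H `<=` Om ->
    enorm (p - a) <= (1 - k / 8) * H ->
    (forall x, enorm (x - p) < k * H / 8 -> del <= v (s, x)) ->
    forall x, enorm (x - a) < k * H / 16 -> th * del <= v (s + sig, x).
Proof.
move=> sig0; have /andP[k0 k1] := k_int; have Hp := H_gt0; have kH : 0 < k * H by rewrite mulr_gt0.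
pose r0 := k * H / 8; pose W := H / sig.
have r00 : 0 < r0 by rewrite divr_gt0.
have W0 : 0 <= W by rewrite /W divr_ge0 // ltW.
pose th := (r0 ^+ 4)^-1 * expR (- decay_rate al K L r0 r0 W * sig) * (r0 ^+ 2 / 2) ^+ 2.
exists th => [|s p a del del0 aO pa init x xa].
  by rewrite !mulr_gt0 ?invr_gt0 ?exprn_gt0 ?expR_gt0 // divr_gt0 // exprn_gt0.
pose d := sig^-1 *: (a - p).
have dW : enorm d <= W.
  rewrite /d enormZ gtr0_norm ?invr_gt0 // mulrC /W ler_wpM2r ?invr_ge0 ?(ltW sig0) //.
  by rewrite enormBC (le_trans pa) //; nra.
have rad t : s <= t <= s + sig -> r0 <= moving_radius s r0 0 t <= r0.
  by move=> _; rewrite /moving_radius mulr0 addr0 lexx.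
have inball t y : s <= t <= s + sig -> enorm (y - moving_center s p d t) < r0 -> eball a H y.
  move=> tI yc; rewrite /eball /=.
  have ca : enorm (moving_center s p d t - a) <= (1 - k / 8) * H.
    have -> : moving_center s p d t - a = (1 - (t - s) / sig) *: (p - a).
      by apply/rowP => i; rewrite !mxE; field; rewrite gt_eqF.
    have h1 : 0 <= (t - s) / sig by rewrite divr_ge0 //; lra.
    have h2 : (t - s) / sig <= 1 by rewrite ler_pdivrMr // mul1r; lra.
    rewrite enormZ ger0_norm ?subr_ge0 //; have := enorm_ge0 (p - a); nra.
  have := enormB_le y (moving_center s p d t) a; rewrite /r0 in yc; lra.
have Ox : Om x by apply: aO; rewrite /eball /=; nra.
have := @barrier R n Om mu al K L v s sig r0 0 r0 r0 W del p d.
move=> /(_ Om_open v_super mu_unit mu_inward al_gt0 K_gt0 L_gt0 r00 W0 del0).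
rewrite normr0 => /(_ W0 dW rad) bar.
have etaE : r0 ^+ 2 / 2 <= moving_paraboloid s r0 0 p d (s + sig, x).
  rewrite /moving_paraboloid /= /moving_radius mulr0 addr0.
  have -> : moving_center s p d (s + sig) = a.
    by apply/rowP => i; rewrite !mxE; field; rewrite gt_eqF.
  have : enorm (x - a) ^+ 2 <= (r0 / 2) ^+ 2.
    by rewrite lerXn2r ?nnegrE ?enorm_ge0 // /r0 ?divr_ge0 ?ltW //; lra.
  by have := sqr_ge0 r0; nra.
have r02 : 0 < r0 ^+ 2 / 2 by rewrite divr_gt0 // exprn_gt0.
apply: le_trans (bar _ v_ge0_or _ (s + sig) x _ (subset_closure Ox) _).
- rewrite /th (_ : s + sig - s = sig); last by ring.
  rewrite (_ : _ * del = del / r0 ^+ 4 * expR (- decay_rate al K L r0 r0 W * sig) * (r0 ^+ 2 / 2) ^+ 2); last by ring.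
  rewrite ler_wpM2l //; last by rewrite lerXn2r ?nnegrE ?(ltW r02) ?(le_trans (ltW r02) etaE).
  by rewrite mulr_ge0 ?expR_ge0 // divr_ge0 ?ltW // exprn_gt0.
- move=> t y tI fy; rewrite {1}/moving_radius mulr0 addr0 => yc.
  by have [_] := (open_frontierP Om_open y).1 fy; case; apply: aO; exact: inball yc.
- by move=> y cy yp; exact: init.
- by apply/andP; split; lra.
- exact: lt_le_trans etaE.
Qed.

(** [positive_near s del z]: at time [s] the function is at least [del] in the
    middle of an interior ball that contains or touches [z]. *)
Definition positive_near s del z := exists a,
  [/\ eball a H `<=` Om, enorm (z - a) <= H &
      forall x, enorm (x - a) < k * H / 16 -> del <= v (s, x)].

(** During the first half of the time positivity expands from the middle of the
    old interior ball. This covers a small ball around a point of the new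
    interior ball slightly inwards of [z2]. During the second half that small
    ball moves to the middle of the new interior ball. *)
Lemma positive_near_step sig : 0 < sig -> exists2 th : R, 0 < th &
  forall s del z1 z2, 0 < del -> closure Om z2 -> enorm (z2 - z1) <= k * H / 4 ->
    positive_near s del z1 -> positive_near (s + sig) (th * del) z2.
Proof.
move=> sig0; have /andP[k0 k1] := k_int; have Hp := H_gt0; have kH : 0 < k * H by rewrite mulr_gt0.
have sig2 : 0 < sig / 2 by rewrite divr_gt0.
have [th1 th10 ex] := positivity_expands sig2.
have [th2 th20 mo] := positivity_moves sig2.
exists (th2 * th1) => [|s del z1 z2 del0 cz2 z12 [a1 [a1O za1 init]]].
  exact: mulr_gt0.
have [_ balls _ _ _] := geom; have [a2 a2O za2] := balls z2 cz2.
exists a2; split => // x xa2.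
rewrite (_ : s + sig = s + sig / 2 + sig / 2); last by field.
rewrite -mulrA.
apply: (mo (s + sig / 2) (z2 + (k / 8) *: (a2 - z2)) a2 (th1 * del) _ a2O) => //.
- exact: mulr_gt0.
- have -> : z2 + (k / 8) *: (a2 - z2) - a2 = (1 - k / 8) *: (z2 - a2).
    by apply/rowP => i; rewrite !mxE; ring.
  rewrite enormZ ger0_norm; last by lra.
  by rewrite ler_wpM2l //; lra.
- move=> y yp.
  have pz : enorm (z2 + (k / 8) *: (a2 - z2) - z2) <= k * H / 8.
    rewrite addrC addKr enormZ ger0_norm; last by lra.
    by rewrite enormBC; nra.
  have pa : enorm (z2 + (k / 8) *: (a2 - z2) - a2) <= (1 - k / 8) * H.
    have -> : z2 + (k / 8) *: (a2 - z2) - a2 = (1 - k / 8) *: (z2 - a2).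
      by apply/rowP => i; rewrite !mxE; ring.
    rewrite enormZ ger0_norm; last by lra.
    by rewrite ler_wpM2l //; lra.
  move: yp pz pa; set p := z2 + _ => yp pz pa.
  apply: (ex s a1 del del0 a1O init).
    apply: subset_closure; apply: a2O; rewrite /eball /=.
    by have := enormB_le y p a2; lra.
  have := enormB_le y p a1; have := enormB_le p z2 a1; have := enormB_le z2 z1 a1; lra.
Qed.

(** The steps have the length that [positive_near_step] can handle. *)
Definition linked (m : nat) x y := exists z : nat -> V,
  [/\ z 0%N = x, z m = y, forall i, (i <= m)%N -> closure Om (z i) &
      forall i, (i < m)%N -> enorm (z i.+1 - z i) <= k * H / 4].

Lemma linked_sym m x y : linked m x y -> linked m y x.
Proof.
move=> [z [z0 zm cz st]]; exists (fun i => z (m - i)%N); split.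
- by rewrite subn0. - by rewrite subnn.
- by move=> i im; apply: cz; exact: leq_subr.
- move=> i im; rewrite enormBC.
  have -> : (m - i = (m - i.+1).+1)%N by rewrite -subSn.
  by apply: st; rewrite ltn_subrL /= (leq_ltn_trans _ im).
Qed.

(** The steps share the given time [sig], so that chains of different lengths
    take the same time and only the factor [th] depends on [m]. *)
Lemma positive_near_linked sig (m : nat) : 0 < sig -> exists2 th : R, 0 < th &
  forall s del x y, 0 < del -> linked m x y ->
    positive_near s del x -> positive_near (s + sig) (th * del) y.
Proof.
elim: m sig => [|m IH] sig sig0.
  have [th th0 step] := positive_near_step sig0.
  exists th => // s del x y del0 [z [<- <- cz _]]; apply: step => //; first exact: cz.
  by rewrite subrr enorm0 divr_ge0 // mulr_ge0 // ltW //; case/andP: k_int.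
have sig2 : 0 < sig / 2 by rewrite divr_gt0.
have [th1 th10 IH1] := IH _ sig2.
have [th2 th20 step] := positive_near_step sig2.
exists (th2 * th1) => [|s del x y del0 [z [z0 zm cz st]] px]; first exact: mulr_gt0.
rewrite (_ : s + sig = s + sig / 2 + sig / 2); last by field.
rewrite -mulrA; apply: (step _ (th1 * del) (z m) y).
- exact: mulr_gt0.
- by rewrite -zm; exact: cz.
- by rewrite -zm; exact: st.
- apply: (IH1 s del x (z m) del0 _ px); exists z; split => //.
  + by move=> i im; apply: cz; exact: leqW.
  + by move=> i im; apply: st; exact: leqW.
Qed.

Lemma curve_linked (D : R) : exists m : nat, forall x y g,
  C1_curve Om x y g -> (arc_length g <= D%:E)%E -> linked m x y.
Proof.
have /andP[k0 k1] := k_int; have e0 : 0 < k * H / 4 by rewrite divr_gt0 // mulr_gt0.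
pose m := (Num.trunc (`|D| / (k * H / 4))).+1.
exists m => x y g Cg gD.
have [|z [z0 zm cz st]] := @curve_chain R n Om x y g D (k * H / 4) m Cg gD (ltn0Sn _).
  rewrite -ler_pdivrMr // (le_trans _ (ltW (truncnS_gt _))) //.
  by rewrite ler_pM2r ?invr_gt0 // ler_norm.
by exists z; split.
Qed.

Lemma positive_near_at sig : 0 < sig -> exists2 th : R, 0 < th &
  forall s del x, 0 < del -> closure Om x ->
    positive_near s del x -> th * del <= v (s + sig, x).
Proof.
move=> sig0; have /andP[k0 k1] := k_int; have Hp := H_gt0.
have [th th0 ex] := positivity_expands sig0.
exists th => // s del x del0 cx [a [aO xa init]].
by apply: (ex s a del del0 aO init x cx); rewrite (le_trans xa) //; nra.
Qed.

End Propagation.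

(** * The two sides of the interface *)

Section Sides.
Context {R : realType} {n : nat}.
Notation V := 'rV[R]_n.+1.
Implicit Types (Om : set V) (P Pc Gam : R -> set V).

Definition splits Om Gam P Pc := forall t, [/\ open (P t), open (Pc t),
  P t `&` Pc t = set0, P t `<=` Om & Om `<=` P t `|` Gam t `|` Pc t].

Lemma connected_in_side {T : topologicalType} (S A B : set T) : open A -> open B ->
  A `&` B = set0 -> connected S -> S `<=` A `|` B -> S `&` A !=set0 -> S `<=` A.
Proof.
move=> oA oB AB conS SAB SA; have SAE : S `&` A = S.
  apply: conS => //; first by exists A.
  exists (~` B); first exact: open_closedC.
  apply/seteqP; split=> x [Sx h]; split => //.
    by move=> Bx; have : (A `&` B) x by []; rewrite AB.
  by case: (SAB x Sx).
by rewrite -SAE; exact: subIsetr.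
Qed.

Lemma segment_in_side (A B : set V) x y : open A -> open B -> A `&` B = set0 ->
  (forall s : R, 0 <= s <= 1 -> (A `|` B) (x + s *: (y - x))) -> A x -> A y.
Proof.
move=> oA oB AB seg Ax; pose h (s : R) := x + s *: (y - x).
have ch : continuous h.
  move=> s; apply: cvgD; first exact: cvg_cst.
  by apply: cvgZ; [exact: cvg_id|exact: cvg_cst].
have con : connected (h @` `[0, 1]).
  apply: connected_continuous_connected; first exact: segment_connected.
  exact: continuous_subspaceT.
have h0 : h 0 = x by rewrite /h scale0r addr0.
have h1 : h 1 = y by rewrite /h scale1r addrC subrK.
apply: (connected_in_side oA oB AB con).
- by move=> _ [s /= sI <-]; apply: seg; rewrite in_itv /= in sI.
- by exists x; split => //; exists 0; rewrite //= in_itv /= lexx ler01.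
- by exists 1; rewrite //= in_itv /= lexx ler01.
Qed.

(** Every point of a suitable interior ball near [y] is joined to [y] by a curve
    of length at most [4 * H], so the ball is far from the interface, and
    a segment that avoids the interface does not change sides. When [y] is a
    boundary point, the interior ball is that of a point [w] of the side close
    to [y], and the curve goes through the centre of the tangent ball at [y]. *)
Lemma deep_ball Om mu (H k : R) Gam P Pc t y (M : R) : open Om ->
  ball_geometry Om mu H k -> 0 < H -> 0 < k <= 1 -> splits Om Gam P Pc ->
  0 < M -> closure (P t) y -> ((M + 4 * H)%:E <= geo_dist_set Om y (Gam t))%E ->
  exists w a, [/\ Om w, enorm (y - w) <= k * H / 4, eball a H `<=` Om, enorm (w - a) <= H &
    forall x, eball a H x -> P t x /\ (M%:E <= geo_dist_set Om x (Gam t))%E].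
Proof.
move=> Om_open [balls _ _ _ overlap] H0 /andP[k0 k1] spl M0 Py far.
have [oP oPc PPc PO OmP] := spl t.
have kH : 0 < k * H by rewrite mulr_gt0.
have cy : closure Om y by apply: closure_subset Py.
suff [w [a [Pw yw aO wa close]]] : exists w a,
    [/\ P t w, enorm (y - w) <= k * H / 4, eball a H `<=` Om, enorm (w - a) < H &
      forall x, eball a H x ->
        (geo_dist_set Om y (Gam t) <= (4 * H)%:E + geo_dist_set Om x (Gam t))%E].
  have farx x : eball a H x -> (M%:E <= geo_dist_set Om x (Gam t))%E.
    move=> /close /(le_trans far); rewrite addrC EFinD -leeBlDl // -EFinB.
    by rewrite (_ : 4 * H + M - 4 * H = M) //; ring.
  have offG x : eball a H x -> ~ Gam t x.
    move=> xa Gx; have := le_trans (farx x xa) (geo_dist_set_self (subset_closure (aO x xa)) Gx).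
    by rewrite lee_fin leNgt M0.
  exists w, a; split => //; [exact: PO|exact: ltW|] => x xa; split; last exact: farx.
  apply: (segment_in_side oP oPc PPc _ Pw) => s s01.
  have sa : eball a H (w + s *: (x - w)) by exact: eball_convex.
  by case: (OmP _ (aO _ sa)) => [[|/(offG _ sa)]|] //; [left|right].
have seg_len a x1 x2 : eball a H `<=` Om -> eball a H x1 -> eball a H x2 ->
    exists2 g, C1_curve Om x1 x2 g & (arc_length g <= (2 * H)%:E)%E.
  move=> aO x1a x2a; have [s s01|g Cg gE] := @C1_segment _ _ Om x1 x2.
    by apply: subset_closure; apply: aO; exact: eball_convex.
  exists g => //; rewrite gE lee_fin; rewrite /eball /= in x1a x2a.
  by have := enormB_le x2 a x1; rewrite (enormBC a x1); lra.
have [Oy|fy] := closure_cases Om_open cy.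
  have Pyt : P t y.
    case: (OmP y Oy) => [[//|Gy]|Pcy].
      have := le_trans far (geo_dist_set_self cy Gy).
      by rewrite lee_fin leNgt addr_gt0 // mulr_gt0.
    have [z [Pz Pcz]] := Py _ (open_nbhs_nbhs (conj oPc Pcy)).
    by have : (P t `&` Pc t) z by []; rewrite PPc.
  have [a aO ya] := balls y Oy.
  exists y, a; split => //; first by rewrite subrr enorm0 divr_ge0 ?ltW.
  move=> x xa; have [g Cg gl] := seg_len a y x aO ya xa.
  apply: (le_trans (geo_dist_set_curve (Gam t) Cg)); apply: leeD2r.
  by apply: (le_trans gl); rewrite lee_fin; lra.
have [w Pw wy] := (closure_enorm (P t) y).1 Py (k * H / 4) (divr_gt0 kH (ltr0Sn _ 3)).
have Ow := PO _ Pw; have [a aO wa] := balls w Ow.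
have [|a0 [a0O ya0 a0a]] := overlap a y aO fy.
  by have := enormB_le y w a; rewrite (enormBC y w); lra.
exists w, a; split => //; first by rewrite enormBC ltW.
move=> x xa; have [s /andP[s0 s1]|g1 Cg1 g1l] := @C1_segment _ _ Om y a0.
  move: s0; rewrite le_eqVlt => /predU1P[<-|s0]; first by rewrite scale0r addr0.
  apply: subset_closure; apply: a0O; rewrite /eball /=.
  have -> : y + s *: (a0 - y) - a0 = (1 - s) *: (y - a0).
    by apply/rowP => i; rewrite !mxE; ring.
  by rewrite enormZ ger0_norm ?subr_ge0 //; have := enorm_ge0 (y - a0); nra.
have [g2 Cg2 g2l] := seg_len a a0 x aO a0a xa.
have d1 := geo_dist_set_curve (Gam t) Cg1.
have d2 := geo_dist_set_curve (Gam t) Cg2.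
apply: (le_trans d1); apply: (le_trans (leeD2l _ d2)); rewrite addeA; apply: leeD2r.
rewrite g1l; apply: (le_trans (leeD2l _ g2l)); rewrite -EFinD lee_fin enormBC.
by lra.
Qed.

End Sides.

Section NearInterface.
Context {R : realType} {n : nat}.
Notation V := 'rV[R]_n.+1.

Lemma lt_pinfty_bound (x : \bar R) : (x < +oo)%E -> exists2 D : R, 0 < D & (x < D%:E)%E.
Proof.
case: x => [r||] // _; last by exists 1; rewrite ?ltNyr.
exists (`|r| + 1); first by rewrite ltr_wpDl.
by rewrite lte_fin (le_lt_trans (ler_norm r)) // ltrDl.
Qed.

(** Five stages share the time [tau]: from a deep interior ball to the point [y]
    given by the second geometric condition, along a curve to the interface at
    time [t - tau], along a curve to the interface at time [t], along a curve to
    the given point [x], and from the middle of an interior ball to [x] itself.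
    The lengths of the curves are bounded independently of [t] and [x]. *)
Lemma positive_near_interface (Om : set V) mu (H k al K L tau M del C : R)
    (v : R * V -> R) (Gam P Pc : R -> set V) :
  open Om -> ball_geometry Om mu H k -> 0 < H -> 0 < k <= 1 ->
  (forall t x, frontier Om x -> enorm (mu (t, x)) = 1) ->
  0 < al -> 0 < K -> 0 < L -> supersolution Om mu al K L v ->
  (forall t x, closure Om x -> 0 <= v (t, x)) ->
  splits Om Gam P Pc -> G2_side Om P Gam -> 0 < tau -> bounded_interface_moves Om Gam tau ->
  0 < del ->
  (forall t x, closure (P t) x -> (M%:E <= geo_dist_set Om x (Gam t))%E -> del <= v (t, x)) ->
  exists2 del' : R, 0 < del' &
    forall t x, closure Om x -> (geo_dist_set Om x (Gam t) <= C%:E)%E -> del' <= v (t, x).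
Proof.
move=> Om_open geom H0 k01 mu1 al0 K0 L0 super v0 spl g2 tau0 moves del0 deep.
have /andP[k0 k1] := k01.
have [D D0 DP] := lt_pinfty_bound moves.
pose M1 := Num.max M 1.
have M10 : 0 < M1 by rewrite lt_max ltr01 orbT.
pose F (r : R) := ereal_inf [set s | exists t x,
    Gam t x /\ s = ereal_sup [set geo_dist_set Om y (Gam t) |
      y in closure (P t) `&` geo_sphere Om x r]].
have [r rP] : exists r : R, ((M1 + 4 * H + 1)%:E <= F r)%E.
  have g2' : F r @[r --> +oo%R] --> +oo%E := g2.
  have nr : \forall r \near pinfty_nbhs R, ((M1 + 4 * H + 1)%:E <= F r)%E.
    exact: cvgey_ge g2' _.
  by near (pinfty_nbhs R) => r; exists r; near: r.
have [m1 link1] := curve_linked Om H0 k01 (r + 1).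
have [m2 link2] := curve_linked Om H0 k01 D.
have [m3 link3] := curve_linked Om H0 k01 (C + 1).
pose sig := tau / 5; have sig0 : 0 < sig by rewrite divr_gt0.
have [th0 th00 st0] := positive_near_step Om_open geom H0 k01 mu1 al0 K0 L0 super v0 sig0.
have [th1 th10 st1] := positive_near_linked Om_open geom H0 k01 mu1 al0 K0 L0 super v0 m1 sig0.
have [th2 th20 st2] := positive_near_linked Om_open geom H0 k01 mu1 al0 K0 L0 super v0 m2 sig0.
have [th3 th30 st3] := positive_near_linked Om_open geom H0 k01 mu1 al0 K0 L0 super v0 m3 sig0.
have [th4 th40 st4] := positive_near_at Om_open geom H0 k01 mu1 al0 K0 L0 super v0 sig0.
have p0 := mulr_gt0 th00 del0; have p1 := mulr_gt0 th10 p0.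
have p2 := mulr_gt0 th20 p1; have p3 := mulr_gt0 th30 p2.
exists (th4 * (th3 * (th2 * (th1 * (th0 * del))))) => [|t x cx xC].
  exact: mulr_gt0.
have [|z [g3 [Gz Cg3 l3]]] := @geo_dist_set_lt _ _ Om x (Gam t) (C + 1)%:E.
  by rewrite (le_lt_trans xC) // lte_fin ltrDl.
have [|z' [g2' [Gz' Cg2 l2]]] := @geo_dist_set_lt _ _ Om z (Gam (t - tau)) D%:E.
  by apply: le_lt_trans DP; apply: ereal_sup_ubound; exists t, z.
have : ((M1 + 4 * H)%:E < ereal_sup [set geo_dist_set Om y (Gam (t - tau)%R) |
      y in closure (P (t - tau)%R) `&` geo_sphere Om z' r])%E.
  apply: (@lt_le_trans _ _ (M1 + 4 * H + 1)%:E); first by rewrite lte_fin ltrDl.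
  by apply: (le_trans rP); apply: ereal_inf_lbound; exists (t - tau), z'.
move=> /ereal_sup_gt[_ [y [Py [cy yr]] <-] ydist].
have [w [a [Ow yw aO wa inP]]] := deep_ball Om_open geom H0 k01 spl M10 Py (ltW ydist).
have : (geo_dist Om z' y < (r + 1)%:E)%E by rewrite yr lte_fin ltrDl.
move=> /ereal_inf_lt[_ [g1 Cg1 <-] l1].
have s0 : positive_near Om H k v (t - tau) del w.
  exists a; split => // q qa; have qa' : eball a H q by rewrite /eball /=; nra.
  have [Pq dq] := inP q qa'; apply: deep; first exact: subset_closure.
  by apply: le_trans dq; rewrite lee_fin le_max lexx.
have s1 := st0 _ _ w y del0 cy yw s0.
have s2 := st1 _ _ _ _ p0 (linked_sym (link1 _ _ _ Cg1 (ltW l1))) s1.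
have s3 := st2 _ _ _ _ p1 (linked_sym (link2 _ _ _ Cg2 (ltW l2))) s2.
have s4 := st3 _ _ _ _ p2 (linked_sym (link3 _ _ _ Cg3 (ltW l3))) s3.
have := st4 _ _ _ p3 cx s4.
by rewrite (_ : t - tau + sig + sig + sig + sig + sig = t) // /sig; field.
Unshelve. all: by end_near. Qed.

End NearInterface.

(** * Consequences of the geometric conditions *)

Section Interfaces.
Context {R : realType} {n : nat}.
Notation V := 'rV[R]_n.+1.
Implicit Types (Om : set V) (Omm Omp P Pc Gam : R -> set V) (u : R * V -> R).

Lemma geometric_splits Om Omm Omp : geometric_conditions Om Omm Omp ->
  splits Om (interface Om Omm) Omp Omm /\ splits Om (interface Om Omm) Omm Omp.
Proof.
move=> [adm adp g1 _ _]; split=> t.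
  have [om _ mO _] := adm t; have [op _ pO _] := adp t.
  have [dis _ cov _ _] := g1 t; split => //; first by rewrite setIC.
  by rewrite -[X in X `<=` _]cov => x [[|]|]; [right|left; right|left; left].
have [om _ mO _] := adm t; have [op _ pO _] := adp t.
by have [dis _ cov _ _] := g1 t; split => //; rewrite cov.
Qed.

(** Otherwise the connected set [Om] would be the disjoint union of two nonempty
    open sets. *)
Lemma interface_nonempty Om Omm Omp t : connected Om ->
  geometric_conditions Om Omm Omp -> exists x, interface Om Omm t x.
Proof.
move=> con geo; have [_ spl] := geometric_splits geo.
have [oP oPc PPc PO cov] := spl t.
have [adm adp _ _ _] := geo; have [_ [x Px] _ _] := adm t; have [_ [y Py] pO _] := adp t.
apply: contrapT => noG.
have OmP : Om `<=` Omm t.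
  apply: (connected_in_side oP oPc PPc con) => [z Oz|].
    by case: (cov z Oz) => [[|Gz]|]; [left|case: noG; exists z|right].
  by exists x; split => //; exact: PO.
have : (Omm t `&` Omp t) y by split => //; apply/OmP/pO.
by rewrite PPc.
Qed.

Lemma closure_two_sides Om Omm Omp t x : geometric_conditions Om Omm Omp ->
  closure Om x -> closure (Omm t) x \/ closure (Omp t) x.
Proof.
move=> geo; have [_ spl] := geometric_splits geo; have [_ _ _ _ cov] := spl t.
have cl : closed (closure (Omm t) `|` closure (Omp t)) by apply: closedU; exact: closed_closure.
have sub : Om `<=` closure (Omm t) `|` closure (Omp t).
  move=> z /cov[[Pz|[[cz _] _]]|Pz]; [left|left|right] => //; exact: subset_closure.
by move=> /(closure_subset sub); rewrite -((closure_id _).1 cl).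
Qed.

Lemma values_bounds Om Gam u (C pm pp del1 del2 : R) : 0 < del1 -> 0 < del2 ->
  (exists t x, closure Om x /\ (geo_dist_set Om x (Gam t) <= C%:E)%E) ->
  (forall t x, closure Om x -> (geo_dist_set Om x (Gam t) <= C%:E)%E ->
     pm + del1 <= u (t, x) /\ u (t, x) <= pp - del2) ->
  let S := values_near_interface Om Gam u C in
  [/\ (pm%:E < ereal_inf S)%E, (ereal_inf S <= ereal_sup S)%E &
        (ereal_sup S < pp%:E)%E].
Proof.
move=> d1 d2 [t [x [cx xC]]] bd S; split.
- apply: (@lt_le_trans _ _ (pm + del1)%:E); first by rewrite lte_fin ltrDl.
  apply: le_ereal_inf_tmp => _ [s [y [cy yC ->]]]; rewrite lee_fin.
  by have [] := bd s y cy yC.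
- have Sx : S (u (t, x))%:E by exists t, x.
  by apply: (le_trans (ereal_inf_lbound Sx)); exact: ereal_sup_ubound.
- apply: (@le_lt_trans _ _ (pp - del2)%:E); last by rewrite lte_fin ltrBlDr ltrDl.
  apply: ge_ereal_sup => _ [s [y [cy yC ->]]]; rewrite lee_fin.
  by have [] := bd s y cy yC.
Qed.

(** Far from the interface [u] is closer to [pp] or to [pm] than [lam] is. *)
Lemma level_sets_bounded Om Gam P Pc u (pm pp : R) :
  (forall t x, closure Om x -> closure (P t) x \/ closure (Pc t) x) ->
  converges_away Om P Gam u (fun=> pp) -> converges_away Om Pc Gam u (fun=> pm) ->
  level_sets_near_interface Om pm pp Gam u.
Proof.
move=> sides cp cm lam /andP[pl lp].
have [M1 M1P] : exists M, forall t x, closure (P t) x ->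
    (M%:E <= geo_dist_set Om x (Gam t))%E -> `|u (t, x) - pp| <= (pp - lam) / 2.
  by apply: cp; lra.
have [M2 M2P] : exists M, forall t x, closure (Pc t) x ->
    (M%:E <= geo_dist_set Om x (Gam t))%E -> `|u (t, x) - pm| <= (lam - pm) / 2.
  by apply: cm; lra.
apply: (@le_lt_trans _ _ (Num.max M1 M2)%:E); last exact: ltry.
apply: ge_ereal_sup => _ [t [x [cx ux ->]]]; rewrite leNgt; apply/negP => far.
have far1 : (M1%:E <= geo_dist_set Om x (Gam t))%E.
  by apply: le_trans (ltW far); rewrite lee_fin le_max lexx.
have far2 : (M2%:E <= geo_dist_set Om x (Gam t))%E.
  by apply: le_trans (ltW far); rewrite lee_fin le_max lexx orbT.
case: (sides t x cx) => cPx.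
  by have := M1P t x cPx far1; rewrite ux ler_norml => /andP[]; lra.
by have := M2P t x cPx far2; rewrite ux ler_norml => /andP[]; lra.
Qed.

End Interfaces.

(** * Limits on the two sides *)

Section Converse.
Context {R : realType} {n : nat}.
Notation V := 'rV[R]_n.+1.
Variables (Om : set V) (Gam : R -> set V) (pm pp : R) (u : R * V -> R).
Hypotheses (u_cont : {within setT `*` closure Om, continuous u})
  (u_in : forall t x, closure Om x -> pm < u (t, x) < pp)
  (levels : level_sets_near_interface Om pm pp Gam u).

(** The values on a connected far region form an interval, which shrinks to a
    point since every value of (pm, pp) is taken only at bounded distance from
    the interface. The limit [l] is the lower limit; if [l + eps] is less than
    [pp] it is not a value on some far region, so the values there are all above
    or all below it, and the former contradicts the choice of [l]. *)
Lemma limit_on_side (P : R -> set V) (d0 : R) :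
  (forall t, P t `<=` Om) ->
  (forall d, exists z, far_region Om P Gam d z) ->
  (forall d, d0 <= d -> connected (far_region Om P Gam d)) ->
  exists2 l : R, pm <= l <= pp & forall eps : R, 0 < eps -> exists d : R,
    forall z, far_region Om P Gam d z -> `|u z - l| <= eps.
Proof.
move=> PO ne con; set F := far_region Om P Gam.
have Fcl d z : F d z -> closure Om z.2 by case=> Pz _; exact: closure_subset (PO _) _ Pz.
have uF d z : F d z -> pm < u z < pp.
  by move=> /Fcl cz; case: z cz => t x; exact: u_in.
have Fmono d d' : d <= d' -> F d' `<=` F d.
  by move=> dd z [Pz dz]; split => //; apply: le_trans dz; rewrite lee_fin.
pose lower := [set lam | exists d, forall z, F d z -> lam <= u z].
have lower_pm : lower pm by exists 0 => z /uF/andP[/ltW].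
have lower_ub lam : lower lam -> lam <= pp.
  move=> [d lamd]; have [z Fz] := ne d.
  by apply: (le_trans (lamd z Fz)); have /andP[_ /ltW] := uF _ _ Fz.
have hs : has_sup lower by split; [exists pm|exists pp => lam; exact: lower_ub].
pose l := sup lower.
have pml : pm <= l by apply: ub_le_sup lower_pm; case: hs.
have lpp : l <= pp by apply: ge_sup; [case: hs|exact: lower_ub].
exists l => [|eps eps0]; first by rewrite pml lpp.
have [lam [d1 lamd] laml] := sup_adherent eps0 hs.
have [d2 d2P] : exists d2, forall z, F d2 z -> u z <= l + eps.
  have [ppl|lpe] := leP pp (l + eps).
    by exists 0 => z /uF/andP[_ /ltW up]; exact: le_trans ppl.
  have lamI : pm < l + eps < pp by rewrite lpe andbT; lra.
  have [D D0 DP] := lt_pinfty_bound (levels lamI).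
  have miss z : F (Num.max (D + 1) d0) z -> u z <> l + eps.
    case: z => t x Fz ux; have /= cx := Fcl _ _ Fz; have /= [_ dx] := Fz.
    have : (geo_dist_set Om x (Gam t) <= D%:E)%E.
      by apply: le_trans (ltW DP); apply: ereal_sup_ubound; exists t, x.
    apply/negP; rewrite -ltNge.
    by apply: lt_le_trans dx; rewrite lte_fin lt_max ltrDl ltr01.
  have int : is_interval (u @` F (Num.max (D + 1) d0)).
    apply/connected_intervalP; apply: connected_continuous_connected.
      by apply: con; rewrite le_max lexx orbT.
    apply: continuous_subspaceW u_cont => z /Fcl cz; split => //.
  exists (Num.max (D + 1) d0) => z Fz; rewrite leNgt; apply/negP => uz.
  suff : lower (l + eps).
    by move=> lo; have : l + eps <= l by [apply: ub_le_sup lo; case: hs]; lra.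
  exists (Num.max (D + 1) d0) => z' Fz'; rewrite leNgt; apply/negP => uz'.
  have [w Fw uw] : (u @` F (Num.max (D + 1) d0)) (l + eps).
    apply: (int (u z') (u z)); [by exists z'|by exists z|].
    by rewrite (ltW uz) (ltW uz').
  exact: miss Fw uw.
exists (Num.max d1 d2) => z Fz.
have z1 : F d1 z by apply: Fmono Fz; rewrite le_max lexx.
have z2 : F d2 z by apply: Fmono Fz; rewrite le_max lexx orbT.
by rewrite ler_norml; have := lamd z z1; have := d2P z z2; rewrite -/l in laml; lra.
Qed.

End Converse.

(** * The two implications *)

Lemma real_above {R : realType} (a : R) (x : \bar R) :
  (a%:E < x)%E -> exists2 c : R, a < c & (c%:E <= x)%E.
Proof.
case: x => [r| |] //; first by rewrite lte_fin => ar; exists r.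
by exists (a + 1); rewrite ?leey // ltrDl.
Qed.

Lemma real_below {R : realType} (a : R) (x : \bar R) :
  (x < a%:E)%E -> exists2 c : R, c < a & (x <= c%:E)%E.
Proof.
case: x => [r| |] //; first by rewrite lte_fin => ar; exists r.
by exists (a - 1); rewrite ?leNye // ltrBlDr ltrDl.
Qed.

Section MainResult.
Context {R : realType} {n : nat}.
Notation V := 'rV[R]_n.+1.
Variables (b : R) (Om : set V) (nu : V -> V) (A : R * V -> 'M[R]_n.+1)
  (q : R * V -> V) (f : R * V -> R -> R) (mu : R * V -> V) (pm pp : R)
  (u : R * V -> R).
Hypotheses (Om_open : open Om) (Om_connected : connected Om)
  (Om_smooth : globally_smooth b Om)
  (nu_normal : forall y, frontier Om y -> outward_unit_normal b Om y (nu y))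
  (coefs : coefficient_conditions b Om A q f)
  (mu_oblique : boundary_field_conditions b Om nu mu)
  (pm_lt_pp : pm < pp)
  (pm_sol : classical_solution Om A q f mu (fun=> pm))
  (pp_sol : classical_solution Om A q f mu (fun=> pp))
  (u_sol : classical_solution Om A q f mu u)
  (u_in : forall t x, closure Om x -> pm < u (t, x) < pp).

(** The signs [sg = 1] and [sg = - 1] treat the differences [u - pm] and [pp - u]
    together. *)
Lemma away_from_one_limit (Gam P Pc : R -> set V) (tau M C p del sg : R) :
  classical_solution Om A q f mu (fun=> p) -> `|sg| = 1 ->
  (forall t x, closure Om x -> 0 <= sg * (u (t, x) - p)) ->
  splits Om Gam P Pc -> G2_side Om P Gam ->
  0 < tau -> bounded_interface_moves Om Gam tau -> 0 < del ->
  (forall t x, closure (P t) x -> (M%:E <= geo_dist_set Om x (Gam t))%E ->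
     del <= sg * (u (t, x) - p)) ->
  exists2 del', 0 < del' & forall t x, closure Om x ->
    (geo_dist_set Om x (Gam t) <= C%:E)%E -> del' <= sg * (u (t, x) - p).
Proof.
move=> p_sol sg1 v0 spl g2 tau0 moves del0 far.
have [H [k [H0 k01 geom]]] := ball_geometry_exists Om_open Om_smooth nu_normal mu_oblique.
have [_ mu1 _] := mu_oblique; have inward := mu_inward geom.
have u_bounded : exists M, forall t x, closure Om x -> `|u (t, x)| <= M.
  exists (`|pm| + `|pp|) => t x cx; have /andP[h1 h2] := u_in t cx.
  have := ler_norm pp; have := ler_norm (- pm); rewrite normrN.
  have := normr_ge0 pp; have := normr_ge0 pm; rewrite ler_norml.
  by move=> *; apply/andP; split; lra.
have [al [K [L [al0 K0 L0 super]]]] :=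
  supersolution_of_solution Om_open coefs mu1 inward p_sol u_sol u_bounded.
exact: (positive_near_interface C Om_open geom H0 k01 mu1 al0 K0 L0 (super sg sg1 v0)
  v0 spl g2 tau0 moves del0 far).
Qed.

(** On the side [P], where [u] tends to [pp], the difference [u - pm] is bounded
    away from 0, and on the side [Pc] so is [pp - u]; each of the two bounds
    propagates to the interface. *)
Lemma values_away (Gam P Pc : R -> set V) (tau : R) :
  splits Om Gam P Pc -> splits Om Gam Pc P ->
  G2_side Om P Gam -> G2_side Om Pc Gam ->
  0 < tau -> bounded_interface_moves Om Gam tau ->
  (forall t, exists2 x, Gam t x & closure Om x) ->
  converges_away Om P Gam u (fun=> pp) -> converges_away Om Pc Gam u (fun=> pm) ->
  values_away_from_limits Om pm pp Gam u.
Proof.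
move=> spl spl' g2 g2' tau0 moves ne cp cm C C0.
have pmpp := pm_lt_pp; have del0 : 0 < (pp - pm) / 2 by lra.
have [M1 M1P] := cp _ del0; have [M2 M2P] := cm _ del0.
have [||del1 del10 lo] := @away_from_one_limit Gam P Pc tau M1 C pm _ 1 pm_sol
    (normr1 _) _ spl g2 tau0 moves del0.
- by move=> t x cx; have /andP[h1 _] := u_in t cx; rewrite mul1r; lra.
- by move=> t x cx /(M1P t x cx); rewrite ler_norml => /andP[]; lra.
have [||del2 del20 hi] := @away_from_one_limit Gam Pc P tau M2 C pp _ (-1) pp_sol
    (normrN1 _) _ spl' g2' tau0 moves del0.
- by move=> t x cx; have /andP[_ h1] := u_in t cx; lra.
- by move=> t x cx /(M2P t x cx); rewrite ler_norml => /andP[]; lra.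
apply: (values_bounds del10 del20) => [|t x cx xC].
  have [x Gx cx] := ne 0; exists 0, x; split => //.
  by apply: (le_trans (geo_dist_set_self cx Gx)); rewrite lee_fin.
by have := lo t x cx xC; have := hi t x cx xC; split; lra.
Qed.

Lemma wave_estimates (Omm Omp : R -> set V) :
  transition_wave_with Om A q f mu Omm Omp (fun=> pm) (fun=> pp) u \/
  transition_wave_with Om A q f mu Omm Omp (fun=> pp) (fun=> pm) u ->
  (exists tau : R, 0 < tau /\ bounded_interface_moves Om (interface Om Omm) tau) ->
  level_sets_near_interface Om pm pp (interface Om Omm) u /\
  values_away_from_limits Om pm pp (interface Om Omm) u.
Proof.
move=> wave [tau [tau0 moves]].
have geo : geometric_conditions Om Omm Omp by case: wave => -[].
have [splp splm] := geometric_splits geo; have [_ _ _ [g2m g2p] _] := geo.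
have ne t : exists2 x, interface Om Omm t x & closure Om x.
  have [x Gx] := interface_nonempty t Om_connected geo.
  by exists x => //; apply: subset_closure; case: Gx.
have sides t x := @closure_two_sides R n Om Omm Omp t x geo.
case: wave => -[_ _ _ _ [cm cp]]; split.
- by apply: level_sets_bounded cp cm => t x /(sides t)[]; [right|left].
- exact: values_away splp splm g2p g2m tau0 moves ne cp cm.
- by apply: level_sets_bounded cm cp => t x /(sides t).
- exact: values_away splm splp g2m g2p tau0 moves ne cm cp.
Qed.

Lemma far_region_nonempty (Gam P : R -> set V) d :
  ereal_sup [set geo_dist_set Om x (Gam 0) | x in P 0] = +oo%E ->
  exists z, far_region Om P Gam d z.
Proof.
move=> sup_oo; apply: contrapT => none.
have : (+oo <= d%:E)%E; last by rewrite leye_eq.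
rewrite -sup_oo.
apply: ge_ereal_sup => _ [x Px <-]; rewrite leNgt; apply/negP => /ltW dx.
by apply: none; exists (0, x); split => //; exact: subset_closure.
Qed.

(** Values of [u] close to [pm] are taken, but not within a given distance of the
    interface; so they are taken far from it, where [u] is close to one of its
    limits [lm] and [lp] on the two sides. Hence [pm], and likewise [pp], is one
    of the limits. *)
Lemma wave_of_estimates (Omm Omp : R -> set V) :
  Om !=set0 -> geometric_conditions Om Omm Omp ->
  [set u z | z in setT `*` closure Om] = `]pm, pp[%classic ->
  level_sets_near_interface Om pm pp (interface Om Omm) u ->
  values_away_from_limits Om pm pp (interface Om Omm) u ->
  (exists d0 : R, 0 < d0 /\ forall d : R, d0 <= d ->
     connected (far_region Om Omp (interface Om Omm) d) /\
     connected (far_region Om Omm (interface Om Omm) d)) ->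
  transition_wave Om A q f mu (fun=> pm) (fun=> pp) u \/
  transition_wave Om A q f mu (fun=> pp) (fun=> pm) u.
Proof.
move=> [x0 Ox0] geo range levels away [d0 [_ con]].
have [u_cont _ _ _ _] := u_sol.
have [adm adp g1 _ _] := geo; have [_ _ _ supp supm] := g1 0.
have Omm_sub t : Omm t `<=` Om by have [] := adm t.
have Omp_sub t : Omp t `<=` Om by have [] := adp t.
have [lm /andP[lm1 lm2] cm] := limit_on_side u_cont u_in levels Omm_sub
  (fun d => far_region_nonempty d supm) (fun d dd => (con d dd).2).
have [lp /andP[lp1 lp2] cp] := limit_on_side u_cont u_in levels Omp_sub
  (fun d => far_region_nonempty d supp) (fun d dd => (con d dd).1).
have near_limit eps : 0 < eps -> exists2 C, 0 <= C & forall t x, closure Om x ->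
    ((geo_dist_set Om x (interface Om Omm t) <= C%:E)%E \/
     (`|u (t, x) - lm| <= eps \/ `|u (t, x) - lp| <= eps)).
  move=> eps0; have [d1 d1P] := cm _ eps0; have [d2 d2P] := cp _ eps0.
  exists (Num.max 0 (Num.max d1 d2)) => [|t x cx]; first by rewrite le_max lexx.
  have [//|far] := leP (geo_dist_set Om x (interface Om Omm t)) (Num.max 0 (Num.max d1 d2))%:E; first by left.
  right; have [cxm|cxp] := closure_two_sides t geo cx; [left|right].
    apply: (d1P (t, x)); split => //; apply: le_trans (ltW far).
    by rewrite lee_fin !le_max lexx !orbT.
  apply: (d2P (t, x)); split => //; apply: le_trans (ltW far).
  by rewrite lee_fin !le_max lexx !orbT.
have attained c : pm < c < pp -> exists t x, closure Om x /\ u (t, x) = c.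
  move=> cI; have : `]pm, pp[%classic c by rewrite /= in_itv.
  by rewrite -range => -[[t x] [_ cx] ux]; exists t, x.
have pm_limit : pm = lm \/ pm = lp.
  apply: contrapT => /not_orP[/eqP nm /eqP np].
  pose eps := Num.min (lm - pm) (lp - pm) / 2.
  have eps0 : 0 < eps by rewrite divr_gt0 // lt_min !subr_gt0 !lt_neqAle nm np lm1.
  have [e1 e2] : 2 * eps <= lm - pm /\ 2 * eps <= lp - pm.
    by rewrite /eps mulrC divfK ?pnatr_eq0 // !ge_min !lexx orbT.
  have [C C0 CP] := near_limit _ eps0; have [Slo _ _] := away _ C0.
  have [c pc cS] := real_above Slo.
  (* A value w below all those near the interface, and closer to pm than lm and
     lp are. *)
  have [w pw /and3P[wpp wc we]] : exists2 w, pm < w & [&& w < pp, w < c & w < pm + eps].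
    have m0 : pm < Num.min pp (Num.min c (pm + eps)) by rewrite !lt_min pm_lt_pp pc ltrDl.
    by exists ((pm + Num.min pp (Num.min c (pm + eps))) / 2); rewrite ?midf_lt // -!lt_min midf_lt.
  have [|t [x [cx ux]]] := attained w; first by rewrite pw.
  case: (CP t x cx) => [xC|].
    have : (c%:E <= (u (t, x))%:E)%E.
      by apply: le_trans cS _; apply: ereal_inf_lbound; exists t, x.
    by rewrite lee_fin ux leNgt wc.
  by rewrite ux !ler_norml => -[] /andP[]; lra.
have pp_limit : pp = lm \/ pp = lp.
  apply: contrapT => /not_orP[/eqP nm /eqP np].
  pose eps := Num.min (pp - lm) (pp - lp) / 2.
  have eps0 : 0 < eps.
    by rewrite divr_gt0 // lt_min !subr_gt0 !lt_neqAle eq_sym nm lm2 eq_sym np.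
  have [e1 e2] : 2 * eps <= pp - lm /\ 2 * eps <= pp - lp.
    by rewrite /eps mulrC divfK ?pnatr_eq0 // !ge_min !lexx orbT.
  have [C C0 CP] := near_limit _ eps0; have [_ _ Shi] := away _ C0.
  have [c pc cS] := real_below Shi.
  have [w pw /and3P[wpp wc we]] : exists2 w, w < pp & [&& pm < w, c < w & pp - eps < w].
    have m0 : Num.max pm (Num.max c (pp - eps)) < pp.
      by rewrite !gt_max pm_lt_pp pc ltrBlDr ltrDl.
    by exists ((Num.max pm (Num.max c (pp - eps)) + pp) / 2); rewrite ?midf_lt // -!gt_max midf_lt.
  have [|t [x [cx ux]]] := attained w; first by rewrite pw wpp.
  case: (CP t x cx) => [xC|].
    have : ((u (t, x))%:E <= c%:E)%E.
      by apply: le_trans cS; apply: ereal_sup_ubound; exists t, x.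
    by rewrite lee_fin ux leNgt wc.
  by rewrite ux !ler_norml => -[] /andP[]; lra.
have conv (P : R -> set V) l : (forall eps : R, 0 < eps -> exists d, forall z,
    far_region Om P (interface Om Omm) d z -> `|u z - l| <= eps) ->
    converges_away Om P (interface Om Omm) u (fun=> l).
  by move=> h eps /h[d dP]; exists d => t x Px dx; exact: (dP (t, x)).
have cOx0 := subset_closure Ox0; have /andP[u1 u2] := u_in 0 cOx0.
have ni p : p = pm \/ p = pp -> not_identical Om u (fun=> p).
  move=> hp; exists 0, x0; split => // up.
  by case: hp => hp; move: u1 u2; rewrite up hp ltxx.
have nm := ni pm (or_introl erefl); have np := ni pp (or_intror erefl).
have [e1|e1] := pm_limit.
  left; exists Omm, Omp; split => //; split; apply: conv; first by rewrite e1.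
  by case: pp_limit => e2; [move: pm_lt_pp; rewrite e1 e2 ltxx|rewrite e2].
right; exists Omm, Omp; split => //; split; apply: conv; last by rewrite e1.
by case: pp_limit => e2; [rewrite e2|move: pm_lt_pp; rewrite e1 e2 ltxx].
Qed.

End MainResult.

Unset Implicit Arguments.
Set Strict Implicit.

Theorem theorem1p2 (R : realType) (n : nat) (b : R) (Om : set 'rV[R]_n.+1)
    (nu : 'rV[R]_n.+1 -> 'rV[R]_n.+1)
    (A : R * 'rV[R]_n.+1 -> 'M[R]_n.+1) (q : R * 'rV[R]_n.+1 -> 'rV[R]_n.+1)
    (f : R * 'rV[R]_n.+1 -> R -> R) (mu : R * 'rV[R]_n.+1 -> 'rV[R]_n.+1)
    (pm pp : R) (u : R * 'rV[R]_n.+1 -> R)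
    (b_gt0 : 0 < b)
    (Om_open : open Om) (Om_nonempty : Om !=set0) (Om_connected : connected Om)
    (Om_smooth : globally_smooth b Om)
    (nu_normal : forall y, frontier Om y -> outward_unit_normal b Om y (nu y))
    (Om_unbounded : geo_unbounded Om Om)
    (coefs : coefficient_conditions b Om A q f)
    (mu_oblique : boundary_field_conditions b Om nu mu)
    (pm_lt_pp : pm < pp)
    (pm_sol : classical_solution Om A q f mu (fun=> pm))
    (pp_sol : classical_solution Om A q f mu (fun=> pp))
    (u_sol : classical_solution Om A q f mu u)
    (u_range : [set u z | z in setT `*` closure Om] = `]pm, pp[%classic) :
  (forall Omm Omp : R -> set 'rV[R]_n.+1,
     transition_wave_with Om A q f mu Omm Omp (fun=> pm) (fun=> pp) u \/
     transition_wave_with Om A q f mu Omm Omp (fun=> pp) (fun=> pm) u ->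
     (exists tau : R, 0 < tau /\
        bounded_interface_moves Om (interface Om Omm) tau) ->
     level_sets_near_interface Om pm pp (interface Om Omm) u /\
     values_away_from_limits Om pm pp (interface Om Omm) u) /\
  (forall Omm Omp : R -> set 'rV[R]_n.+1,
     geometric_conditions Om Omm Omp ->
     level_sets_near_interface Om pm pp (interface Om Omm) u ->
     values_away_from_limits Om pm pp (interface Om Omm) u ->
     (exists d0 : R, 0 < d0 /\ forall d : R, d0 <= d ->
        connected (far_region Om Omp (interface Om Omm) d) /\
        connected (far_region Om Omm (interface Om Omm) d)) ->
     transition_wave Om A q f mu (fun=> pm) (fun=> pp) u \/
     transition_wave Om A q f mu (fun=> pp) (fun=> pm) u).
Proof.
have u_in t x : closure Om x -> pm < u (t, x) < pp.
  move=> cx; have : [set u z | z in setT `*` closure Om] (u (t, x)) by exists (t, x).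
  by rewrite u_range /= in_itv.
split=> Omm Omp.
  exact: (wave_estimates Om_open Om_connected Om_smooth nu_normal coefs mu_oblique
    pm_lt_pp pm_sol pp_sol u_sol u_in).
move=> geo; exact: (wave_of_estimates pm_lt_pp pm_sol pp_sol u_sol u_in Om_nonempty geo u_range).
Qed.
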